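(* Let $(M,Q),(M_1,Q_1),(M_2,Q_2),\ldots$ be i.i.d. random vectors with values in $\mathbb{R}_+^2$, $\mathbb{R}_+=[0,\infty)$, let $\Pi_n:=M_1M_2\cdots M_n$, and let $(X_n)_{n\ge 0}$ be the Markov chain on $\mathbb{R}_+$ given by $X_n=M_nX_{n-1}+Q_n$ for $n\ge 1$, where $X_0\ge 0$ is independent of $(M_k,Q_k)_{k\ge 1}$. Assume that: (i) $\mathbb{P}(M=0)=0$ and $\mathbb{P}(Q=0)<1$; (ii) $\mathbb{P}(Mr+Q=r)<1$ for all $r\ge 0$; (iii) $\lim_{n\to\infty}\Pi_n=0$ a.s. and $I_Q:=\int_{(1,\infty)}J_-(x)\,\mathbb{P}(\log Q\in \mathrm{d}x)=\infty$, where $J_-(y):=\dfrac{y}{\mathbb{E}(y\wedge\log_-M)}$ for $y>0$; (iv) $\mathbb{E}\log_+M=\mathbb{E}\log_-M=\infty$; (v) $s^*:=\limsup_{t\to\infty}t\,\mathbb{P}(\log Q>t)<\infty$. Then $(X_n)_{n\ge 0}$ is null recurrent.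
   Context: Conventions: $\log_+x=\max(\log x,0)$, $\log_-x=-\min(\log x,0)$, $\log 0=-\infty$. For $x\in\mathbb{R}_+$, $X_n^x$ denotes the chain started at $X_0=x$, all $X_n^x$ being built from the same sequence $(M_k,Q_k)_{k\ge1}$. Recurrent: there is a nonempty closed set $L$ such that $\mathbb{P}(X_n^x\in U\text{ infinitely often})=1$ for every $x\in L$ and every open set $U$ that intersects $L$. Since $|X_n^x-X_n^y|=\Pi_n|x-y|\to0$ a.s., the chain is contractive. For such a recurrent chain the following is known: there is a deterministic closed set $L$ (the attractor set) which a.s. equals, for all $x$, the set $\bigcap_{m\ge1}\overline{\{X_n^x:n\ge m\}}$ of accumulation points of $(X_n^x)_{n\ge 0}$, and there is a locally finite invariant measure $\nu\neq 0$, unique up to a multiplicative constant. Taking $L$ to be the attractor set, a recurrent chain is called positive recurrent if $\nu(L)<\infty$ and null recurrent otherwise, i.e. if $\nu(L)=\infty$. *)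

(* Defs.v *)
From HB Require Import structures.
From mathcomp Require Import all_boot all_order all_algebra.
From mathcomp Require Import all_classical all_reals all_analysis.
From mathcomp Require Import measurable_realfun.

Set Implicit Arguments.
Unset Strict Implicit.
Unset Printing Implicit Defensive.

Import Order.TTheory GRing.Theory Num.Theory.
Import numFieldNormedType.Exports.

Local Open Scope classical_set_scope.
Local Open Scope ring_scope.

Section Log.
Local Open Scope ereal_scope.
Context {R : realType}.

(* [lne] is extended-valued, with [lne 0 = -oo]. *)
Definition log_plus (x : R) : \bar R := maxe (lne x%:E) 0.

Definition log_minus (x : R) : \bar R := - mine (lne x%:E) 0.

End Log.

Section IID.
Context {d d' : measure_display} {T : measurableType d} {E : measurableType d'}
  {R : realType}.
Variable P : probability T R.

Definition mutually_independent (X : nat -> T -> E) : Prop :=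
  forall (J : seq nat) (A : nat -> set E),
    uniq J -> (forall j, measurable (A j)) ->
    P (\bigcap_(j in [set` J]) (X j @^-1` A j)) =
    (\prod_(j <- J) P (X j @^-1` A j))%E.

Definition identically_distributed (X : nat -> T -> E) : Prop :=
  forall (k : nat) (A : set E),
    measurable A -> P (X k @^-1` A) = P (X 0%N @^-1` A).

Definition iid (X : nat -> T -> E) : Prop :=
  mutually_independent X /\ identically_distributed X.

End IID.

(* Throughout, [(M k, Q k)] for [k >= 1] drives the chain, while [(M 0, Q 0)]
   is the generic copy [(M, Q)], which enters only through its law. *)
Section RandomDifferenceEquation.
Context {d : measure_display} {T : measurableType d} {R : realType}.
Variable P : probability T R.
Variables M Q : nat -> T -> R.

Definition Pi (n : nat) (w : T) : R := \prod_(1 <= k < n.+1) M k w.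

Fixpoint chain (x : R) (n : nat) (w : T) : R :=
  if n is n'.+1 then M n w * chain x n' w + Q n w else x.

Section Integrals.
Local Open Scope ereal_scope.

(* The expectation lies in [0, y]; if it vanished the quotient would be +oo. *)
Definition J_minus (y : \bar R) : \bar R :=
  y / \int[P]_w mine y (log_minus (M 0%N w)).

Definition log_law : set (\bar R) -> \bar R :=
  pushforward P (fun w => lne (Q 0%N w)%:E).

Definition I_Q : \bar R :=
  \int[log_law]_(x in [set x | 1 < x < +oo]) J_minus x.

Definition s_star : \bar R :=
  limf_esup (fun t : R => t%:E * P [set w | t%:E < lne (Q 0%N w)%:E])
    (pinfty_nbhs R).

End Integrals.

(* The state space is [0, +oo[, viewed inside R: every chain started in it
   stays in it, and its closed (open) subsets are the traces of those of R. *)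
Definition recurrent : Prop :=
  exists L : set R,
    [/\ L !=set0, closed L, L `<=` `[0, +oo[ &
        forall (x : R) (U : set R), L x -> open U -> (L `&` U) !=set0 ->
          P (lim_sup_set (fun n => [set w | U (chain x n w)])) = 1%E].

Definition accumulation_set (x : R) (w : T) : set R :=
  \bigcap_m closure [set chain x n w | n in [set n | (m <= n)%N]].

Definition attractor_set (L : set R) : Prop :=
  closed L /\
  {ae P, forall w, forall x : R, 0 <= x -> accumulation_set x w = L}.

(* A measure on [0, +oo[ is a Borel measure on R that vanishes on ]-oo, 0[. *)
Definition invariant_measure (nu : {measure set R -> \bar R})
  : Prop :=
  nu [set x | x < 0] = 0%E /\
  forall A : set R, measurable A ->
    nu A = (\int[nu]_(x in `[0%R, +oo[)
              P [set w | A (M 0%N w * x + Q 0%N w)%R])%E.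

Definition locally_finite (nu : {measure set R -> \bar R})
  : Prop :=
  forall x : R, exists U : set R, [/\ open U, U x & (nu U < +oo)%E].

Definition admissible (nu : {measure set R -> \bar R})
  : Prop :=
  [/\ nu setT <> 0%E, locally_finite nu & invariant_measure nu].

(* The measure [nu] is unique only up to a positive factor, which does not
   affect [nu L = +oo]; quantifying over all of them, and requiring that L and
   nu exist, avoids choosing one and rules out vacuity. *)
Definition null_recurrent : Prop :=
  recurrent /\
  exists L : set R,
    [/\ attractor_set L,
        exists nu, admissible nu &
        forall nu, admissible nu -> nu L = +oo%E].

End RandomDifferenceEquation.

(* Main.v *)
Require Import Defs.
From HB Require Import structures.
From mathcomp Require Import all_boot all_order all_algebra.
From mathcomp Require Import all_classical all_reals all_analysis.
From mathcomp Require Import measurable_realfun.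
From mathcomp Require Import lra ring zify.

Set Implicit Arguments.
Unset Strict Implicit.
Unset Printing Implicit Defensive.

Import Order.TTheory GRing.Theory Num.Theory.
Import numFieldNormedType.Exports.

Local Open Scope classical_set_scope.
Local Open Scope ring_scope.

(** Three facts have to be established: the chain does not escape to infinity,
    it admits an invariant measure, and the attractor has infinite mass for each of
    these.

    Non-transience is the heart of the matter, as the perpetuities
    [\sum_k Pi_{k-1} Q_k] diverge. The chain is observed at the descending ladder
    epochs of the multiplicative walk [Pi_n], the first of which has a finite
    mean: reversing time turns it into the number of records of a walk that tends to
    [0] ([ladder_epoch_integrable]). The function [ln (1 + ln (1 + x))]
    is a Lyapunov function for the chain at these epochs ([ladder_lyapunov]): the
    inputs [Q] push it up by [O (1 / ln x)], because the tail of [ln Q] is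
    [O (1 / t)], and the contraction pulls it down by [A / ln x] for [A] as large as
    desired, because [ln_- M] has an infinite mean. If the chain were transient, a
    last exit argument ([last_exit]) would bound the potential [u] of [[0, c]], and
    the minimum principle for [u + e V] would yield [u >= inf_[0, c] u]
    everywhere, which is absurd since [u = 1 + P u] on [[0, c]]
    ([lyapunov_not_transient]).

    Since the chain contracts, a zero-one law makes the set of accumulation
    points of its trajectories deterministic and independent of the starting
    point; by non-transience this attractor is not empty, which is recurrence
    ([ae_accumulation], [attractor_neq0]).

    An invariant measure is obtained as a limit of the occupation measures of
    the chain from [0], normalised on [[0, c]]. Helly's theorem and Fatou's lemma give
    a measure that dominates its image under one step; as the potential of
    [[0, c]] is infinite by recurrence, it is invariant ([excessive_invariant],
    [invariant_exists]).

    For the mass, the divergence of [I_Q] says that the events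
    [Q_k * \prod_{i < k} min (M_i, 1) > 1] have a divergent sum of probabilities, by
    Wald's inequality for the renewal function of [ln_- M]; by last exit they occur
    infinitely often, so that the perpetuities tend to infinity almost surely, and by
    time reversal the chain tends to infinity in probability
    ([escape_in_probability]). A finite invariant measure is then impossible
    ([infinite_mass]). Finally any invariant measure vanishes outside of the
    attractor: a ball which the trajectories leave for ever is visited boundedly
    often in the mean, whereas its occupation under the stationary chain is
    proportional to time ([null_of_bounded_visits]). Hence the attractor carries the
    whole infinite mass ([attractor_infinite_mass]). *)

(** * Independent sequences and their laws *)

Section SequenceSpace.
Context {d : measure_display} {E : measurableType d}.

Definition cylinder (m : nat) (A : nat -> set E) : set (nat -> E) :=
  [set s | forall j, (j < m)%N -> A j (s j)].

Definition cylinders : set (set (nat -> E)) :=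
  [set C | exists m A, (forall j, measurable (A j)) /\ C = cylinder m A].

Definition seq_space : Type := g_sigma_algebraType cylinders.

HB.instance Definition _ := Measurable.on seq_space.

Lemma cylinders_setI_closed : setI_closed cylinders.
Proof.
move=> _ _ [m [A [mA ->]]] [n [B [mB ->]]].
exists (maxn m n), (fun j => (if (j < m)%N then A j else setT) `&`
  (if (j < n)%N then B j else setT)); split.
  by move=> j; apply: measurableI; case: ifP.
apply/seteqP; split=> [s [As Bs] j _|s ABs]; first split.
- by case: ifPn => // /As.
- by case: ifPn => // /Bs.
split=> j jm.
- by have := ABs j; rewrite leq_max jm => /(_ isT)[].
- by have := ABs j; rewrite leq_max jm orbT => /(_ isT)[].
Qed.

Lemma measurable_cylinder m A : (forall j, measurable (A j)) ->
  measurable (cylinder m A : set seq_space).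
Proof. by move=> mA; apply: sub_sigma_algebra; exists m, A. Qed.

Lemma measurable_coord k : measurable_fun setT (fun s : seq_space => s k).
Proof.
move=> _ B mB; rewrite setTI.
rewrite (_ : _ @^-1` B = cylinder k.+1 (fun j => if j == k then B else setT)).
  by apply: measurable_cylinder => j; case: ifP.
apply/seteqP; split=> [s Bs j _|s /(_ k)]; first by case: eqP => // ->.
by rewrite ltnSn eqxx; exact.
Qed.

Lemma measurable_fun_seq d' (T : measurableType d') (f : T -> seq_space) :
  (forall k, measurable_fun setT (fun x => f x k)) -> measurable_fun setT f.
Proof.
move=> mf; apply: (@measurability _ _ T seq_space setT f cylinders) => //.
move=> _ [_ [m [A [mA ->]]] <-]; rewrite setTI.
rewrite (_ : f @^-1` _ = \bigcap_(j in [set j | (j < m)%N])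
    ((fun x => f x j) @^-1` A j)); last first.
  by apply/seteqP; split=> x //= fx j /=; exact: fx.
by apply: bigcap_measurableType => // j _; rewrite -[X in measurable X]setTI; exact: mf.
Qed.

Definition splice (n : nat) (s t : nat -> E) : nat -> E :=
  fun k => if (k < n)%N then s k else t (k - n)%N.

Lemma measurable_splice n :
  measurable_fun setT (fun st : seq_space * seq_space =>
    splice n st.1 st.2 : seq_space).
Proof.
apply: measurable_fun_seq => k; rewrite /splice; case: (k < n)%N.
- apply: (measurableT_comp (measurable_coord k)); exact: measurable_fst.
- apply: (measurableT_comp (measurable_coord (k - n))); exact: measurable_snd.
Qed.

Lemma eq_law_seq (R : realType)
  (m1 m2 : {measure set seq_space -> \bar R}) : (m1 setT < +oo)%E ->
  (forall m A, (forall j, measurable (A j)) ->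
    m1 (cylinder m A) = m2 (cylinder m A)) ->
  forall C, measurable C -> m1 C = m2 C.
Proof.
move=> m1fin m12 C mC; apply: (@measure_unique _ _ seq_space cylinders (fun=> setT)) => //.
- exact: cylinders_setI_closed.
- move=> _; exists 0%N, (fun=> setT); split => //.
  by apply/seteqP; split => //= s _ j.
- by rewrite bigcup_const //; exists 0%N.
- by move=> _ [m [A [mA ->]]]; exact: m12.
Qed.

End SequenceSpace.
Arguments seq_space {d} E.

Section IidSequences.
Context {d d' : measure_display} {T : measurableType d} {E : measurableType d'}.
Context {R : realType}.
Variable P : probability T R.
Implicit Types X : nat -> T -> E.

Lemma iid_reindex X (f : nat -> nat) : injective f ->
  iid P X -> iid P (X \o f).
Proof.
move=> f_inj [indX idX]; split; last first.
  by move=> k A mA /=; rewrite (idX (f k))// (idX (f 0%N)).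
move=> J A uJ mA.
pose g i := if pselect (exists j, f j = i) is left h
  then projT1 (cid h) else 0%N.
have gf : cancel f g.
  move=> j; rewrite /g; case: pselect => [h|[]]; last by exists j.
  by apply: f_inj; case: (cid h).
have ufJ : uniq (map f J) by rewrite map_inj_uniq.
have := indX (map f J) (A \o g) ufJ (fun j => mA (g j)); rewrite big_map.
rewrite (_ : \bigcap_(j in [set` map f J]) _ =
    \bigcap_(j in [set` J]) ((X \o f) j @^-1` A j)); last first.
  apply/seteqP; split=> [w h j /= jJ|w h i /= /mapP[j jJ ->]].
    by have := h (f j); rewrite /= mem_map// jJ gf; exact.
  by rewrite gf; exact: h.
by move=> ->; apply: eq_bigr => j _; rewrite /= gf.
Qed.

Lemma iid_cylinder X m A : iid P X -> (forall j, measurable (A j)) ->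
  P [set w | cylinder m A (X ^~ w)] =
  (\prod_(0 <= j < m) P (X 0%N @^-1` A j))%E.
Proof.
move=> [indX idX] mA.
rewrite (_ : [set w | _] = \bigcap_(j in [set` iota 0 m]) (X j @^-1` A j)).
  rewrite indX ?iota_uniq// /index_iota subn0.
  by apply: eq_bigr => j _; exact: idX.
apply/seteqP; split=> [w /= h j /=|w h j jm]; rewrite ?mem_iota ?add0n.
  by move=> jm; exact: h.
by apply: h; rewrite /= mem_iota.
Qed.

Lemma measurable_sequence X : (forall k, measurable_fun setT (X k)) ->
  measurable_fun setT ((fun w => X ^~ w) : T -> seq_space E).
Proof. by move=> mX; exact: measurable_fun_seq. Qed.

Lemma measurable_sequence_event X (C : set (seq_space E)) :
  (forall k, measurable_fun setT (X k)) -> measurable C ->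
  measurable [set w | C (X ^~ w)].
Proof.
move=> mX mC; rewrite -[X in measurable X]setTI.
exact: (measurable_sequence mX).
Qed.

Lemma iid_eq_law X Y : (forall k, measurable_fun setT (X k)) ->
  (forall k, measurable_fun setT (Y k)) -> iid P X -> iid P Y ->
  (forall A, measurable A -> P (X 0%N @^-1` A) = P (Y 0%N @^-1` A)) ->
  forall C : set (seq_space E), measurable C ->
  P [set w | C (X ^~ w)] = P [set w | C (Y ^~ w)].
Proof.
move=> mX mY iX iY XY C mC.
have mX' := measurable_sequence mX; have mY' := measurable_sequence mY.
pose mfX := isMeasurableFun.Build _ _ _ _ _ mX'.
pose mfY := isMeasurableFun.Build _ _ _ _ _ mY'.
pose fX : {mfun T >-> seq_space E} := HB.pack (fun w => X ^~ w : seq_space E) mfX.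
pose fY : {mfun T >-> seq_space E} := HB.pack (fun w => Y ^~ w : seq_space E) mfY.
apply: (@eq_law_seq _ _ _ (distribution P fX) (distribution P fY)) => //.
  by rewrite -ge0_fin_numE // fin_num_measure.
move=> m A mA; rewrite /distribution /pushforward/=.
transitivity (P [set w | cylinder m A (X ^~ w)]); first by [].
rewrite iid_cylinder//; transitivity (P [set w | cylinder m A (Y ^~ w)]) => //.
by rewrite iid_cylinder//; apply: eq_bigr => j _; exact: XY.
Qed.

(** Cutting an i.i.d. sequence at time [n] and continuing it with the beginning of
    an independent copy does not change its law: this is the independence of
    past and future together with the invariance of the law under the shift. *)
Lemma ge0_expectation_splice X n (F : seq_space E -> \bar R) :
  (forall k, measurable_fun setT (X k)) -> iid P X ->
  measurable_fun setT F -> (forall s, 0 <= F s)%E ->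
  (\int[P]_w F (X ^~ w) =
   \int[P]_w \int[P]_w' F (splice n (X ^~ w) (X ^~ w')))%E.
Proof.
move=> mX iX mF F0.
have mX' := measurable_sequence mX.
pose mfX := isMeasurableFun.Build _ _ _ _ _ mX'.
pose fX : {mfun T >-> seq_space E} := HB.pack (fun w => X ^~ w : seq_space E) mfX.
pose h (ww : T * T) : seq_space E := splice n (X ^~ ww.1) (X ^~ ww.2).
have mh : measurable_fun setT h.
  rewrite (_ : h = (fun st : seq_space E * seq_space E =>
      splice n st.1 st.2 : seq_space E) \o (fun ww => (fX ww.1, fX ww.2)))//.
  apply: (measurableT_comp (measurable_splice n)).
  apply/measurable_fun_pair.
  - apply: (measurableT_comp mX'); exact: measurable_fst.
  - apply: (measurableT_comp mX'); exact: measurable_snd.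
pose mfh := isMeasurableFun.Build _ _ _ _ _ mh.
pose fh : {mfun (T * T)%type >-> seq_space E} := HB.pack h mfh.
transitivity (\int[distribution P fX]_s F s)%E.
  by rewrite ge0_integral_distribution.
transitivity (\int[distribution (P \x P)%E fh]_s F s)%E; last first.
  rewrite ge0_integral_distribution// fubini_tonelli1//.
  - exact: (measurableT_comp mF mh).
  - by move=> ww; exact: F0.
apply: eq_measure_integral => C mC _.
apply: (@eq_law_seq _ _ _ (distribution P fX) (distribution (P \x P)%E fh)) => //.
  by rewrite -ge0_fin_numE // fin_num_measure.
move=> m A mA; rewrite /distribution /pushforward/=.
transitivity (P [set w | cylinder m A (X ^~ w)]); first by [].
rewrite iid_cylinder//.
rewrite (_ : h @^-1` _ = [set w | cylinder (minn n m) A (X ^~ w)] `*`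
    [set w | cylinder (m - n) (fun j => A (n + j)%N) (X ^~ w)]); last first.
  apply/seteqP; split=> [[w w'] /= hC|[w w'] [/= h1 h2] j jm]; first split => j /=.
  - by rewrite leq_min => /andP[jn jm]; have := hC j jm; rewrite /h /splice /= jn.
  - move=> jmn; have := hC (n + j)%N; rewrite /h /splice /= -ltn_subRL jmn.
    by rewrite ltnNge leq_addr/= addKn; exact.
  - rewrite /h /splice /=; case: ltnP => jn; first by apply: h1; rewrite leq_min jn.
    have := h2 (j - n)%N; rewrite subnKC//; apply; lia.
rewrite product_measure1E.
- rewrite [X in (X * _)%E](iid_cylinder _ iX mA).
  rewrite [X in (_ * X)%E](iid_cylinder _ iX (fun j => mA (n + j)%N)).
  have [nm|mn] := leqP n m.
    rewrite (@big_cat_nat _ _ _ n)//=.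
    rewrite -[in X in (_ * X)%E](add0n n) big_addn; congr (_ * _)%E.
    by apply: eq_bigr => j _; rewrite addnC.
  rewrite (_ : (m - n = 0)%N); last lia.
  by rewrite [X in (_ * X)%E]big_geq// mule1.
- by apply: measurable_sequence_event => //; exact: measurable_cylinder.
- by apply: measurable_sequence_event => //; exact: measurable_cylinder.
Qed.

End IidSequences.

(** * Trajectories of the random affine recursion *)

Section Trajectories.
Context {R : realType}.
Implicit Types (s t : nat -> R * R) (x y : R) (n m k : nat).

Definition shift n s : nat -> R * R := fun k => s (n + k)%N.

Fixpoint traj x s n : R :=
  if n is n'.+1 then (s n').1 * traj x s n' + (s n').2 else x.

Fixpoint prodM s n : R := if n is n'.+1 then prodM s n' * (s n').1 else 1.

Definition nneg s := forall k, 0 <= (s k).1 /\ 0 <= (s k).2.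

Lemma shift_splice n s t : shift n (splice n s t) = t.
Proof.
by apply/funext => k; rewrite /shift /splice ltnNge leq_addr/= addKn.
Qed.

Lemma traj_past n x s t m : (m <= n)%N -> traj x (splice n s t) m = traj x s m.
Proof.
by elim: m => //= m IH mn; rewrite IH ?(ltnW mn)// /splice mn.
Qed.

Lemma prodM_past n s t m : (m <= n)%N -> prodM (splice n s t) m = prodM s m.
Proof.
by elim: m => //= m IH mn; rewrite IH ?(ltnW mn)// /splice mn.
Qed.

Lemma traj_shift x s n m : traj x s (n + m) = traj (traj x s n) (shift n s) m.
Proof. by elim: m => [|m IH]; rewrite ?addn0// addnS /= IH. Qed.

Lemma prodM_shift s n m : prodM s (n + m) = prodM s n * prodM (shift n s) m.
Proof. by elim: m => [|m IH]; rewrite ?addn0 ?mulr1// addnS /= IH mulrA. Qed.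

Lemma prodM_ge0 s n : nneg s -> 0 <= prodM s n.
Proof. by move=> s0; elim: n => //= n IH; rewrite mulr_ge0//; case: (s0 n). Qed.

Lemma traj_sub x y s n : traj x s n - traj y s n = prodM s n * (x - y).
Proof.
elim: n => [|n IH] /=; first by rewrite mul1r.
by rewrite opprD addrACA subrr addr0 -mulrBr IH mulrCA mulrA.
Qed.

Lemma le_traj x y s n : nneg s -> x <= y -> traj x s n <= traj y s n.
Proof.
move=> s0 xy; rewrite -subr_ge0 traj_sub mulr_ge0 ?subr_ge0//.
exact: prodM_ge0.
Qed.

Lemma traj_ge0 x s n : nneg s -> 0 <= x -> 0 <= traj x s n.
Proof.
by move=> s0 x0; elim: n => //= n IH; case: (s0 n) => *; rewrite addr_ge0 ?mulr_ge0.
Qed.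

Lemma nneg_shift n s : nneg s -> nneg (shift n s).
Proof. by move=> s0 k; exact: s0. Qed.

Local Notation Omega := (seq_space (R * R)%type).

Lemma measurable_coord1 k : measurable_fun setT (fun s : Omega => (s k).1).
Proof.
exact: (measurableT_comp measurable_fst (measurable_coord k)).
Qed.

Lemma measurable_coord2 k : measurable_fun setT (fun s : Omega => (s k).2).
Proof.
exact: (measurableT_comp measurable_snd (measurable_coord k)).
Qed.

Lemma measurable_shift n : measurable_fun setT (shift n : Omega -> Omega).
Proof. by apply: measurable_fun_seq => k; exact: measurable_coord. Qed.

Lemma measurable_prodM n : measurable_fun setT (fun s : Omega => prodM s n).
Proof.
by elim: n => //= n IH; apply: measurable_funM => //; exact: measurable_coord1.
Qed.

Lemma measurable_traj n :
  measurable_fun setT (fun xs : R * Omega => traj xs.1 xs.2 n).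
Proof.
elim: n => [|n IH] /=; first exact: measurable_fst.
apply: measurable_funD; first apply: measurable_funM => //.
- exact: (measurableT_comp (measurable_coord1 n) measurable_snd).
- exact: (measurableT_comp (measurable_coord2 n) measurable_snd).
Qed.

Lemma measurable_traj2 x n : measurable_fun setT (fun s : Omega => traj x s n).
Proof.
exact: (measurableT_comp (measurable_traj n) (pair1_measurable x)).
Qed.

End Trajectories.

Section RandomSequence.
Context {d : measure_display} {T : measurableType d} {R : realType}.
Variables (P : probability T R) (X : nat -> T -> R * R).
Hypothesis mX : forall k, measurable_fun setT (X k).
Hypothesis iX : iid P X.
Hypothesis X_ge0 : forall w, nneg (X ^~ w).
Local Notation Omega := (seq_space (R * R)%type).
Local Notation z w := ((X ^~ w) : Omega).
Implicit Types (A B : set Omega) (f g : R -> \bar R).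

Let mE A : measurable A -> measurable [set w | A (z w)].
Proof. exact: measurable_sequence_event. Qed.

Lemma measurable_z : measurable_fun setT (fun w => z w).
Proof. exact: measurable_sequence. Qed.

Local Open Scope ereal_scope.

Lemma prob_indic A : measurable A -> P [set w | A (z w)] = \int[P]_w (\1_A (z w))%:E.
Proof.
move=> mA; have := @integral_indic _ _ _ P setT measurableT _ (mE mA).
by rewrite setIT => <-; apply: eq_integral.
Qed.

Definition depends_on_past n A := forall s t, A (splice n s t) <-> A s.

(** Independence of past and future, applied to a product of indicators. *)
Lemma prob_past_future n A B : measurable A -> measurable B ->
  depends_on_past n A ->
  P [set w | A (z w) /\ B (shift n (z w))] = P [set w | A (z w)] * P [set w | B (z w)].
Proof.
move=> mA mB pA.
have mB' : measurable (shift n @^-1` B : set Omega).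
  by rewrite -[X in measurable X]setTI; exact: measurable_shift.
have mAB : measurable (A `&` shift n @^-1` B) by exact: measurableI.
rewrite (prob_indic mAB).
rewrite (ge0_expectation_splice (F := fun s => (\1_(A `&` shift n @^-1` B) s)%:E)
  n mX iX); last 2 first.
- exact/measurable_EFinP.
- by move=> s; rewrite lee_fin.
have mzB : measurable_fun setT (fun w => (\1_B (z w))%:E : \bar R).
  by apply/measurable_EFinP; exact: (measurableT_comp _ measurable_z).
have mzA : measurable_fun setT (fun w => (\1_A (z w))%:E : \bar R).
  by apply/measurable_EFinP; exact: (measurableT_comp _ measurable_z).
rewrite (prob_indic mA) (prob_indic mB) -ge0_integralZr//; last first.
  by apply: integral_ge0 => w _; rewrite lee_fin.
apply: eq_integral => w _; rewrite -ge0_integralZl//.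
apply: eq_integral => w' _; rewrite -EFinM; congr (_%:E).
rewrite !indicE -natrM mulnb; congr ((nat_of_bool _)%:R).
apply/idP/andP; rewrite !inE => -[].
- by rewrite /preimage /= shift_splice => /pA.
- by move=> /pA ? ?; split => //; rewrite /preimage /= shift_splice.
Qed.

(** Last exit: if each visit to [A] has, independently of the past, a chance
    [P B] of being followed by no visit after a further [N] steps, then the
    visits are too few for their expected number to be infinite. *)
Lemma last_exit (A : nat -> set Omega) B N :
  (forall n, measurable (A n)) -> measurable B ->
  (forall n, depends_on_past n (A n)) ->
  (forall s n m, nneg s -> A n s -> B (shift n s) -> (n + N <= m)%N -> ~ A m s) ->
  forall K, (\sum_(0 <= n < K) P [set w | A n (z w)]) * P [set w | B (z w)] <= N%:R%:E.
Proof.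
move=> mA mB pA AB K.
pose D n := [set w | A n (z w) /\ B (shift n (z w))].
have mD n : measurable (D n).
  apply: measurableI; first exact: mE.
  apply: (mE (A := shift n @^-1` B)).
  by rewrite -[X in measurable X]setTI; exact: measurable_shift.
have PD n : P [set w | A n (z w)] * P [set w | B (z w)] = P (D n).
  exact/esym/prob_past_future.
rewrite ge0_sume_distrl//.
rewrite (eq_bigr (fun n => P (D n))); last by move=> n _; exact: PD.
have cnt w : (\sum_(0 <= n < K) \1_(D n) w <= N%:R :> R)%R.
  have [[n0 Kn0 Dn0]|noD] := pselect (exists2 n, (n < K)%N & D n w); last first.
    rewrite big1_seq ?ler0n// => n; rewrite mem_index_iota => /andP[_ /andP[_ nK]].
    by rewrite indicE memNset// => Dn; apply: noD; exists n.
  have [n1 [Dn1 n1min]] : exists n1, D n1 w /\ forall n, D n w -> (n1 <= n)%N.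
    have ex : exists n, `[< D n w >] by exists n0; apply/asboolP.
    exists (ex_minn ex); case: ex_minnP => n1 /asboolP Dn1 n1min; split => // n.
    by move=> /asboolP; exact: n1min.
  have near n : D n w -> (n1 <= n < n1 + N)%N.
    move=> Dn; rewrite n1min//= ltnNge; apply/negP => /AB h.
    by case: Dn1 => An1 Bn1; case: Dn => An _; exact: (h (z w)).
  apply: (@le_trans _ _ (\sum_(0 <= n < K | (n1 <= n < n1 + N)%N) 1%R)%R).
    rewrite big_mkcond [leRHS]big_mkcond; apply: ler_sum => n _.
    have [Dn|Dn] := pselect (D n w); first by rewrite near// indicE mem_set.
    by rewrite indicE memNset//; case: ifP.
  rewrite -(natr_sum R _ _ (fun=> 1%N)) sum1_count ler_nat -size_filter.
  rewrite -[leqRHS](size_iota n1); apply: uniq_leq_size.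
    by rewrite filter_uniq// iota_uniq.
  by move=> n; rewrite mem_filter mem_iota => /andP[].
rewrite (eq_bigr (fun n => \int[P]_w (\1_(D n) w)%:E)); last first.
  by move=> n _; rewrite integral_indic ?setIT.
rewrite -ge0_integral_sum//; last first.
  by move=> n; apply/measurable_EFinP.
rewrite (_ : N%:R%:E = \int[P]_w (N%:R%:E)); last first.
  by rewrite integral_cst//= probability_setT mule1.
apply: ge0_le_integral => //.
- by move=> w _; apply: sume_ge0.
- by apply: emeasurable_sum => n; apply/measurable_EFinP.
- by move=> w _; rewrite sumEFin lee_fin.
Qed.

Lemma last_exit_bound (A : nat -> set Omega) B N :
  (forall n, measurable (A n)) -> measurable B ->
  (forall n, depends_on_past n (A n)) ->
  (forall s n m, nneg s -> A n s -> B (shift n s) -> (n + N <= m)%N -> ~ A m s) ->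
  0 < P [set w | B (z w)] ->
  forall K, \sum_(0 <= n < K) P [set w | A n (z w)] <=
    (N%:R / fine (P [set w | B (z w)]))%:E.
Proof.
move=> mA mB pA AB PB K; have := last_exit mA mB pA AB K.
have pE : P [set w | B (z w)] = (fine (P [set w | B (z w)]))%:E.
  by rewrite fineK// fin_num_measure//; exact: mE.
by rewrite {1}pE EFinM lee_pdivlMr// -lte_fin -pE.
Qed.

End RandomSequence.

(** * Time reversal and transition operators *)

Section Reversal.
Context {R : realType}.
Implicit Types s : nat -> R * R.

Definition flip n k := if (k < n)%N then (n.-1 - k)%N else k.

Lemma flip_inj n : injective (flip n).
Proof. move=> i j; rewrite /flip; case: (ltnP i n) => ?; case: (ltnP j n) => ? ?; lia. Qed.

Lemma prodM_flip n j s : (j <= n)%N ->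
  prodM s n = prodM s (n - j) * prodM (s \o flip n) j.
Proof.
elim: j => [|j IH] jn; first by rewrite subn0 mulr1.
rewrite IH ?(ltnW jn)//= (_ : n - j = (n - j.+1).+1)%N; last lia.
rewrite /= [flip n j]/flip jn (_ : n.-1 - j = n - j.+1)%N; last lia.
by rewrite -!mulrA; congr (_ * _); rewrite mulrC.
Qed.

(** The perpetuity is what the chain started at [0] becomes when the order of
    the random inputs is reversed; unlike the chain it is monotone in time. *)
Fixpoint perpetuity s n : R :=
  if n is n'.+1 then perpetuity s n' + prodM s n' * (s n').2 else 0.

Lemma traj_flip n s : traj 0 (s \o flip n) n = perpetuity s n.
Proof.
suff H j : (j <= n)%N -> perpetuity s n =
    perpetuity s (n - j) + prodM s (n - j) * traj 0 (s \o flip n) j.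
  by rewrite (H n)// subnn/= add0r mul1r.
elim: j => [|j IH] jn; first by rewrite subn0 mulr0 addr0.
rewrite IH ?(ltnW jn)//= (_ : n - j = (n - j.+1).+1)%N; last lia.
rewrite /= [flip n j]/flip jn (_ : n.-1 - j = n - j.+1)%N; last lia.
ring.
Qed.

End Reversal.

Section ChainOperators.
Context {d : measure_display} {T : measurableType d} {R : realType}.
Variables (P : probability T R) (X : nat -> T -> R * R).
Hypothesis mX : forall k, measurable_fun setT (X k).
Hypothesis iX : iid P X.
Hypothesis X_ge0 : forall w, nneg (X ^~ w).
Local Notation Omega := (seq_space (R * R)%type).
Local Notation z w := ((X ^~ w) : Omega).
Implicit Types (A B : set Omega) (f g : R -> \bar R).
Local Open Scope ereal_scope.

Lemma measurable_z_comp d' (T' : measurableType d') (F : Omega -> T') :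
  measurable_fun setT F -> measurable_fun setT (fun w => F (z w)).
Proof. by move=> mF; exact: (measurableT_comp mF (measurable_z mX)). Qed.

(** The law of an i.i.d. sequence is invariant under permutations of the indices. *)
Lemma prob_flip n A : measurable A ->
  P [set w | A (z w \o flip n)] = P [set w | A (z w)].
Proof.
move=> mA; case: (iX) => _ idX.
apply: (@iid_eq_law _ _ _ _ _ P (X \o flip n) X) => //.
- by move=> k; exact: mX.
- exact: (iid_reindex (@flip_inj n)).
- by move=> C mC /=; exact: idX.
Qed.

(** The [n]-step transition operator of the chain. *)
Definition op n f (x : R) : \bar R := \int[P]_w f (traj x (z w) n).

Lemma op0 f : op 0 f = f.
Proof.
by apply/funext => x; rewrite /op/= integral_cst//= probability_setT mule1.
Qed.

Lemma op_ge0 n f : (forall x, 0 <= f x) -> forall x, 0 <= op n f x.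
Proof. by move=> f0 x; exact: integral_ge0. Qed.

Lemma measurable_traj_comp f n x : measurable_fun setT f ->
  measurable_fun setT (fun w => f (traj x (z w) n)).
Proof.
move=> mf; apply: (measurableT_comp mf).
by apply: (measurable_z_comp (F := fun s => traj x s n)); exact: measurable_traj2.
Qed.

Lemma measurable_op n f : measurable_fun setT f -> (forall x, 0 <= f x) ->
  measurable_fun setT (op n f).
Proof.
move=> mf f0.
apply: (@measurable_fun_fubini_tonelli_F _ _ _ _ _ P
  (fun xw => f (traj xw.1 (z xw.2) n))) => //.
apply: (measurableT_comp mf).
rewrite (_ : (fun xw : R * T => _) = (fun xs : R * Omega => traj xs.1 xs.2 n) \o
  (fun xw => (xw.1, z xw.2)))//.
apply: (measurableT_comp (measurable_traj n)).
apply/measurable_fun_pair; first exact: measurable_fst.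
by apply: (measurableT_comp (measurable_z mX)); exact: measurable_snd.
Qed.

Lemma opD n m f : measurable_fun setT f -> (forall x, 0 <= f x) ->
  op (n + m) f = op n (op m f).
Proof.
move=> mf f0; apply/funext => x; rewrite {1}/op.
rewrite (ge0_expectation_splice (F := fun s => f (traj x s (n + m))) n mX iX).
- apply: eq_integral => w _; apply: eq_integral => w' _.
  by rewrite traj_shift shift_splice traj_past.
- by apply: (measurableT_comp mf); exact: measurable_traj2.
- by move=> s; exact: f0.
Qed.

Lemma le_op n f g x : measurable_fun setT f -> (forall y, 0 <= f y) ->
  measurable_fun setT g -> (0 <= x)%R ->
  (forall y, (0 <= y)%R -> f y <= g y) -> op n f x <= op n g x.
Proof.
move=> mf f0 mg x0 fg; apply: ge0_le_integral => //.
- exact: measurable_traj_comp.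
- exact: measurable_traj_comp.
- by move=> w _; apply: fg; exact: traj_ge0.
Qed.

Lemma op_cst n (c : \bar R) x : op n (fun=> c) x = c.
Proof. by rewrite /op integral_cst//= probability_setT mule1. Qed.

Lemma op_add n f g x : measurable_fun setT f -> (forall y, 0 <= f y) ->
  measurable_fun setT g -> (forall y, 0 <= g y) ->
  op n (fun y => f y + g y) x = op n f x + op n g x.
Proof.
by move=> mf f0 mg g0; rewrite /op ge0_integralD//; exact: measurable_traj_comp.
Qed.

Lemma op_scale n (k : R) f x : (0 <= k)%R -> measurable_fun setT f ->
  (forall y, 0 <= f y) -> op n (fun y => k%:E * f y) x = k%:E * op n f x.
Proof.
by move=> k0 mf f0; rewrite /op ge0_integralZl//; exact: measurable_traj_comp.
Qed.

Lemma op_sum n (f : nat -> R -> \bar R) K x :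
  (forall k, measurable_fun setT (f k)) -> (forall k y, 0 <= f k y) ->
  op n (fun y => \sum_(0 <= k < K) f k y) x = \sum_(0 <= k < K) op n (f k) x.
Proof.
move=> mf f0; rewrite /op ge0_integral_sum// => k.
exact: measurable_traj_comp.
Qed.

Lemma op_nneseries n (f : nat -> R -> \bar R) x :
  (forall k, measurable_fun setT (f k)) -> (forall k y, 0 <= f k y) ->
  op n (fun y => \sum_(k <oo) f k y) x = \sum_(k <oo) op n (f k) x.
Proof.
move=> mf f0; rewrite /op integral_nneseries// => k.
exact: measurable_traj_comp.
Qed.

Definition lev (r : R) : R -> \bar R := fun y => (\1_[set y | (y <= r)%R] y)%:E.

Lemma levE r y : lev r y = ((y <= r)%R)%:R%:E.
Proof. by rewrite /lev indicE; congr ((nat_of_bool _)%:R%:E); apply/idP/idP; rewrite inE. Qed.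

Lemma measurable_lev r : measurable_fun setT (lev r).
Proof.
apply/measurable_EFinP/measurable_indic.
rewrite (_ : [set y | _] = `]-oo, r]%classic)//.
Qed.

Lemma lev_ge0 r y : 0 <= lev r y.
Proof. by rewrite lee_fin. Qed.

Lemma measurable_traj_le x n r :
  measurable ([set s | (traj x s n <= r)%R] : set Omega).
Proof.
rewrite -[X in measurable X]setTI.
rewrite (_ : [set s | _] = (fun s => traj x s n) @^-1` `]-oo, r]); last first.
  by apply/seteqP; split => y /=; rewrite in_itv.
exact: measurable_traj2.
Qed.

Lemma op_lev n r x : op n (lev r) x = P [set w | (traj x (z w) n <= r)%R].
Proof.
by rewrite (prob_indic P mX (measurable_traj_le x n r)).
Qed.

Lemma ae_prob1 (p : set T) : measurable p -> {ae P, forall w, p w} -> P p = 1.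
Proof.
move=> mp ap; rewrite -[p]setCK probability_setC; last exact: measurableC.
suff -> : P (~` p) = 0 by rewrite sube0.
by apply/negligibleP => //; exact: measurableC.
Qed.

Lemma prob1_ae (p : set T) : measurable p -> P p = 1 -> {ae P, forall w, p w}.
Proof.
move=> mp p1; apply/negligibleP; first exact: measurableC.
by have := probability_setC P mp; rewrite p1 subee.
Qed.

(** The random time from which [A] holds is bounded by a deterministic one with a
    positive probability, as a countable union of null sets is null. *)
Lemma prob_eventually (A : nat -> set T) : (forall m, measurable (A m)) ->
  {ae P, forall w, exists N, forall m, (N <= m)%N -> A m w} ->
  exists N, 0 < P (\bigcap_(m in [set m | (N <= m)%N]) A m).
Proof.
move=> mA aeA; pose B N := \bigcap_(m in [set m | (N <= m)%N]) A m.
have mB N : measurable (B N) by exact: bigcap_measurableType.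
have mU : measurable (\bigcup_N B N) by exact: bigcup_measurable.
have PU : P (\bigcup_N B N) = 1.
  apply: ae_prob1 => //; apply: filterS aeA => w [N AN].
  by exists N => // m; exact: AN.
apply: contrapT => /forallNP h.
have : P (\bigcup_N B N) = 0.
  apply/negligibleP => //; apply: negligible_bigcup => N.
  apply/negligibleP => //; apply/eqP; rewrite -measure_le0 leNgt; apply/negP.
  exact: h.
by move=> /eqP; rewrite PU onee_eq0.
Qed.

End ChainOperators.

(** * Ladder epochs of the multiplicative walk *)

Section Ladder.
Context {d : measure_display} {T : measurableType d} {R : realType}.
Variables (P : probability T R) (X : nat -> T -> R * R).
Hypothesis mX : forall k, measurable_fun setT (X k).
Hypothesis iX : iid P X.
Hypothesis X_ge0 : forall w, nneg (X ^~ w).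
Hypothesis prodM_cvg0 : {ae P, forall w, (prodM (X ^~ w) n @[n --> \oo] --> 0)}.
Local Notation Omega := (seq_space (R * R)%type).
Local Notation z w := ((X ^~ w) : Omega).
Implicit Types (A B : set Omega) (f g : R -> \bar R).
Local Notation op := (op P X).

(** The first descending ladder epoch of the products, the first [n] with
    [prodM s n < 1], exceeds [n] on [stay n] and equals [n.+1] on [descend n]. *)
Definition stay n : set Omega :=
  [set s | forall j, (j <= n)%N -> 1 <= prodM s j].

Definition descend n : set Omega := stay n `&` [set s | prodM s n.+1 < 1].

Lemma measurable_prodM_ge n (c : R) : measurable ([set s | c <= prodM s n] : set Omega).
Proof.
rewrite -[X in measurable X]setTI.
rewrite (_ : [set s | _] = (fun s => prodM s n) @^-1` `[c, +oo[); last first.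
  by apply/seteqP; split => y /=; rewrite in_itv/= andbT.
exact: measurable_prodM.
Qed.

Lemma measurable_prodM_lt n (c : R) : measurable ([set s | prodM s n < c] : set Omega).
Proof.
rewrite (_ : [set s | _] = ~` [set s | c <= prodM s n]); last first.
  by apply/seteqP; split => s /=; rewrite ltNge => /negP.
by apply: measurableC; exact: measurable_prodM_ge.
Qed.

Lemma measurable_stay n : measurable (stay n).
Proof.
rewrite (_ : stay n = \bigcap_(j in [set j | (j <= n)%N]) [set s | 1 <= prodM s j]).
  by apply: bigcap_measurableType => j _; exact: measurable_prodM_ge.
by apply/seteqP; split.
Qed.

Lemma measurable_descend n : measurable (descend n).
Proof.
apply: measurableI; [exact: measurable_stay|exact: measurable_prodM_lt].
Qed.

Lemma stay_past n : depends_on_past n (stay n).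
Proof.
by move=> s t; split => h j jn; have := h j jn; rewrite prodM_past.
Qed.

Lemma indic_stayS n s : \1_(stay n) s = \1_(descend n) s + \1_(stay n.+1) s :> R.
Proof.
have [sn|sn] := pselect (stay n s); last first.
  have nd : ~ descend n s by case.
  have ns : ~ stay n.+1 s.
    by move=> h; apply: sn => j jn; apply: h; rewrite (leq_trans jn).
  by rewrite !indicE (memNset sn) (memNset nd) (memNset ns) addr0.
rewrite !indicE (mem_set sn); have [lt1|ge1] := ltP (prodM s n.+1) 1.
  have ns : ~ stay n.+1 s by move=> /(_ n.+1 (leqnn _)); rewrite leNgt lt1.
  have nd : descend n s by split.
  by rewrite (mem_set nd) (memNset ns) addr0.
have nd : ~ descend n s by move=> [_] /=; rewrite ltNge ge1.
have ns : stay n.+1 s.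
  by move=> j; rewrite leq_eqVlt => /predU1P[->//|]; rewrite ltnS; exact: sn.
by rewrite (memNset nd) (mem_set ns) add0r.
Qed.

Definition record n : set Omega :=
  [set s | forall j, (j <= n)%N -> prodM s j <= prodM s n].

Lemma measurable_record n : measurable (record n).
Proof.
rewrite (_ : record n = \bigcap_(j in [set j | (j <= n)%N])
    ~` [set s | prodM s n - prodM s j < 0]).
  apply: bigcap_measurableType => j _; apply: measurableC.
  rewrite -[X in measurable X]setTI.
  rewrite (_ : [set s | _] = (fun s => prodM s n - prodM s j) @^-1` `]-oo, 0[); last first.
    by apply/seteqP; split => y /=; rewrite in_itv.
  by apply: measurable_funB => //; exact: measurable_prodM.
by apply/seteqP; split=> s h j /h /=; rewrite subr_lt0 leNgt => /negP.
Qed.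

Local Open Scope ereal_scope.

Lemma prodM_eventually_lt (c : R) : (0 < c)%R ->
  exists N, 0 < P [set w | forall m, (N <= m)%N -> (prodM (z w) m < c)%R].
Proof.
move=> c0; have [||N PN] := @prob_eventually _ _ _ P
    (fun m => [set w | (prodM (z w) m < c)%R]).
- move=> m; apply: (measurable_sequence_event mX (C := [set s | prodM s m < c]%R)).
  exact: measurable_prodM_lt.
- apply: filterS prodM_cvg0 => w /cvgr0_norm_lt/(_ _ c0)[N _ h].
  by exists N => m /h /=; rewrite ger0_norm// prodM_ge0.
- by exists N; rewrite (_ : [set w | _] = \bigcap_(m in [set m | (N <= m)%N])
    [set w | (prodM (z w) m < c)%R]).
Qed.

(** The mean of the ladder epoch is finite: reversing time turns the event
    that the products have not yet gone below [1] into the event that the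
    present product is a record, and since the products tend to [0] there are
    only finitely many records in the mean. *)
Lemma ladder_epoch_integrable : exists2 C : R, (0 <= C)%R &
  forall K, \sum_(0 <= n < K) P [set w | stay n (z w)] <= C%:E.
Proof.
have [N PN] := prodM_eventually_lt ltr01.
pose B : set Omega := [set s | forall m, (N <= m)%N -> (prodM s m < 1)%R].
have mB : measurable B.
  rewrite (_ : B = \bigcap_(m in [set m | (N <= m)%N]) [set s | (prodM s m < 1)%R])//.
  by apply: bigcap_measurableType => m _; exact: measurable_prodM_lt.
have PB : 0 < P [set w | B (z w)] by [].
have le_stay n : P [set w | stay n (z w)] <= P [set w | record n (z w)].
  rewrite -(prob_flip mX iX n (measurable_record n)).
  apply: le_measure; rewrite ?inE.
  - exact: (measurable_sequence_event mX (measurable_stay n)).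
  - apply: (measurable_sequence_event (fun k => mX (flip n k))).
    exact: measurable_record.
  - move=> w /= sw j jn; rewrite [leRHS](_ : _ = prodM (z w) n); last first.
      by rewrite (prodM_flip (z w) (leqnn n)) subnn mul1r.
    rewrite (prodM_flip (z w) jn) ler_peMl ?sw ?leq_subr//.
    by apply: prodM_ge0 => k; exact: X_ge0.
exists (N%:R / fine (P [set w | B (z w)]))%R.
  by rewrite divr_ge0// fine_ge0.
move=> K; apply: le_trans (lee_sum _ (fun n _ => le_stay n)) _.
apply: (last_exit_bound mX iX X_ge0 measurable_record mB _ _ PB) => //.
- by move=> n s t; split => h j jn; have := h j jn; rewrite !prodM_past.
- move=> s n m s0 rn Bs nm /(_ n); rewrite (leq_trans (leq_addr _ _) nm) => /(_ isT).
  have pn0 : (0 < prodM s n)%R by exact: lt_le_trans ltr01 (rn 0%N isT).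
  rewrite -(subnKC (leq_trans (leq_addr _ _) nm)) prodM_shift leNgt.
  by rewrite gtr_pMr// Bs//; lia.
Qed.

Lemma indic_comp_measurable A : measurable A ->
  measurable_fun setT (fun w => (\1_A (z w))%:E : \bar R).
Proof.
by move=> mA; apply/measurable_EFinP; exact: (measurable_z_comp mX (measurable_indic mA)).
Qed.

Lemma expectation_past n m A f x : measurable A -> depends_on_past n A ->
  measurable_fun setT f -> (forall y, 0 <= f y) ->
  \int[P]_w ((\1_A (z w))%:E * f (traj x (z w) (n + m))) =
  \int[P]_w ((\1_A (z w))%:E * op m f (traj x (z w) n)).
Proof.
move=> mA pA mf f0.
rewrite (ge0_expectation_splice
  (F := fun s => (\1_A s)%:E * f (traj x s (n + m))) n mX iX).
- apply: eq_integral => w _; rewrite /op -ge0_integralZl//; last first.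
    exact: measurable_traj_comp.
  apply: eq_integral => w' _; rewrite traj_shift shift_splice traj_past//.
  by congr (_%:E * _); rewrite !indicE; congr ((nat_of_bool _)%:R);
    apply/idP/idP; rewrite !inE => /pA.
- apply: emeasurable_funM; first exact/measurable_EFinP.
  by apply: (measurableT_comp mf); exact: measurable_traj2.
- by move=> s; rewrite mule_ge0// lee_fin.
Qed.

Lemma expectation_past_next n A (c : R * R -> R) : measurable A ->
  depends_on_past n A -> measurable_fun setT c -> (forall y, 0 <= c y)%R ->
  \int[P]_w (\1_A (z w) * c (X n w))%:E =
  P [set w | A (z w)] * \int[P]_w (c (X 0%N w))%:E.
Proof.
move=> mA pA mc c0.
rewrite (ge0_expectation_splice (F := fun s => (\1_A s * c (s n))%:E) n mX iX).
- rewrite (prob_indic P mX mA) -ge0_integralZr//; last 2 first.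
  + exact: indic_comp_measurable.
  + by apply: integral_ge0 => w _; rewrite lee_fin.
  apply: eq_integral => w _; rewrite -ge0_integralZl//; last 2 first.
  + by apply/measurable_EFinP; apply: (measurableT_comp mc).
  + by move=> w' _; rewrite lee_fin.
  apply: eq_integral => w' _; rewrite EFinM; congr (_%:E * _%:E).
    by rewrite !indicE; congr ((nat_of_bool _)%:R); apply/idP/idP; rewrite !inE => /pA.
  by rewrite /splice ltnn subnn.
- apply/measurable_EFinP; apply: measurable_funM; first exact: (measurable_indic mA).
  by apply: (measurableT_comp mc); exact: measurable_coord.
- by move=> s; rewrite lee_fin mulr_ge0.
Qed.

(** Killing the chain when the products first go below [1]. *)
Definition stayE n f x := \int[P]_w ((\1_(stay n) (z w))%:E * f (traj x (z w) n)).

Definition descendE n f x :=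
  \int[P]_w ((\1_(descend n) (z w))%:E * f (traj x (z w) n.+1)).

(** The transition operator of the chain observed at its ladder epochs. *)
Definition ladder f x := \sum_(n <oo) descendE n f x.

Lemma stayE_split n f x : measurable_fun setT f -> (forall y, 0 <= f y) ->
  stayE n (op 1 f) x = descendE n f x + stayE n.+1 f x.
Proof.
move=> mf f0.
rewrite /stayE -(expectation_past 1 _ (measurable_stay n) (@stay_past n))//.
rewrite addn1 -ge0_integralD//.
- by apply: eq_integral => w _; rewrite indic_stayS EFinD ge0_muleDl ?lee_fin.
- by move=> w _; rewrite mule_ge0 ?lee_fin.
- apply: emeasurable_funM; last exact: measurable_traj_comp.
  exact: (indic_comp_measurable (measurable_descend _)).
- by move=> w _; rewrite mule_ge0 ?lee_fin.
- apply: emeasurable_funM; last exact: measurable_traj_comp.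
  exact: (indic_comp_measurable (measurable_stay _)).
Qed.

Lemma descendE_ge0 n f x : (forall y, 0 <= f y) -> 0 <= descendE n f x.
Proof. by move=> f0; apply: integral_ge0 => w _; rewrite mule_ge0 ?lee_fin. Qed.

Lemma stayE_ge0 n f x : (forall y, 0 <= f y) -> 0 <= stayE n f x.
Proof. by move=> f0; apply: integral_ge0 => w _; rewrite mule_ge0 ?lee_fin. Qed.

(** Optional stopping of a nonnegative supermartingale at the ladder epoch. *)
Lemma ladder_superharmonic f x : measurable_fun setT f -> (forall y, 0 <= f y) ->
  (forall y, (0 <= y)%R -> op 1 f y <= f y) -> (0 <= x)%R ->
  ladder f x <= op 1 f x.
Proof.
move=> mf f0 fsuper x0.
apply: lime_le; first by apply: is_cvg_nneseries => n _ _; exact: descendE_ge0.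
apply: nearW => K.
suff H : \sum_(0 <= n < K) descendE n f x + stayE K (op 1 f) x <= op 1 f x.
  by apply: le_trans H; rewrite leeDl// stayE_ge0// => y; exact: op_ge0.
elim: K => [|K IH].
  rewrite big_geq// add0e /stayE; under eq_integral do rewrite /=.
  rewrite (eq_integral (cst (op 1 f x))) => [|w _].
    by rewrite integral_cst//= probability_setT mule1.
  by rewrite indicE mem_set ?mul1e// => -[|//] _ /=.
rewrite big_nat_recr; last by [].
rewrite /= -addeA; apply: le_trans IH.
apply: leeD2l; rewrite (stayE_split K)//; apply: leeD2l.
apply: ge0_le_integral => //.
- by move=> w _; rewrite mule_ge0 ?lee_fin//; exact: op_ge0.
- apply: emeasurable_funM; last exact: (measurable_traj_comp mX _ _ (measurable_op P mX _ mf f0)).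
  exact: (indic_comp_measurable (measurable_stay _)).
- apply: emeasurable_funM; last exact: measurable_traj_comp.
  exact: (indic_comp_measurable (measurable_stay _)).
- move=> w _; rewrite lee_wpmul2l ?lee_fin//; apply: fsuper.
  by apply: traj_ge0.
Qed.

Lemma le_ladder f g x : measurable_fun setT f -> (forall y, 0 <= f y) ->
  measurable_fun setT g -> (0 <= x)%R ->
  (forall y, (0 <= y)%R -> f y <= g y) -> ladder f x <= ladder g x.
Proof.
move=> mf f0 mg x0 fg; apply: lee_nneseries => [n _ _|n _]; first exact: descendE_ge0.
apply: ge0_le_integral => //.
- by move=> w _; rewrite mule_ge0 ?lee_fin.
- apply: emeasurable_funM; last exact: measurable_traj_comp.
  exact: (indic_comp_measurable (measurable_descend _)).
- apply: emeasurable_funM; last exact: measurable_traj_comp.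
  exact: (indic_comp_measurable (measurable_descend _)).
- move=> w _; rewrite lee_wpmul2l ?lee_fin//; apply: fg.
  exact: (@traj_ge0 R _ _ _ (X_ge0 w) x0).
Qed.

Lemma ladder_add f g x : measurable_fun setT f -> (forall y, 0 <= f y) ->
  measurable_fun setT g -> (forall y, 0 <= g y) ->
  ladder (fun y => f y + g y) x = ladder f x + ladder g x.
Proof.
move=> mf f0 mg g0; rewrite /ladder -nneseriesD; last 2 first.
- by move=> n _ _; exact: descendE_ge0.
- by move=> n _ _; exact: descendE_ge0.
apply: eq_eseriesr => n _; rewrite /descendE -ge0_integralD//.
- by apply: eq_integral => w _; rewrite ge0_muleDr.
- by move=> w _; rewrite mule_ge0 ?lee_fin.
- apply: emeasurable_funM; last exact: measurable_traj_comp.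
  exact: (indic_comp_measurable (measurable_descend _)).
- by move=> w _; rewrite mule_ge0 ?lee_fin.
- apply: emeasurable_funM; last exact: measurable_traj_comp.
  exact: (indic_comp_measurable (measurable_descend _)).
Qed.

Lemma ladder_scale (k : R) f x : (0 <= k)%R -> measurable_fun setT f ->
  (forall y, 0 <= f y) -> ladder (fun y => k%:E * f y) x = k%:E * ladder f x.
Proof.
move=> k0 mf f0; rewrite /ladder -nneseriesZl; last first.
  by move=> n _; exact: descendE_ge0.
apply: eq_eseriesr => n _; rewrite /descendE -ge0_integralZl//.
- by apply: eq_integral => w _; rewrite muleCA.
- apply: emeasurable_funM; last exact: measurable_traj_comp.
  exact: (indic_comp_measurable (measurable_descend _)).
- by move=> w _; rewrite mule_ge0 ?lee_fin.
Qed.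

Lemma ladder_ge0 f x : (forall y, 0 <= f y) -> 0 <= ladder f x.
Proof. by move=> f0; apply: nneseries_ge0 => n _ _; exact: descendE_ge0. Qed.

Lemma ladder_sum (f : nat -> R -> \bar R) K x :
  (forall k, measurable_fun setT (f k)) -> (forall k y, 0 <= f k y) ->
  ladder (fun y => \sum_(0 <= k < K) f k y) x = \sum_(0 <= k < K) ladder (f k) x.
Proof.
move=> mf f0; elim: K => [|K IH].
  rewrite big_geq//; under [X in ladder X]eq_fun do rewrite big_geq//.
  apply: eseries0 => n _ _; apply: integral0_eq => w _; exact: mule0.
rewrite big_nat_recr; last by [].
rewrite /= -IH -ladder_add//; first last.
- by move=> y; exact: sume_ge0.
- exact: emeasurable_sum.
by congr (ladder _ x); apply/funext => y; rewrite big_nat_recr.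
Qed.

Lemma measurable_ladder f : measurable_fun setT f -> (forall y, 0 <= f y) ->
  measurable_fun setT (ladder f).
Proof.
move=> mf f0; apply: ge0_emeasurable_sum => [n x _ _|n _]; first exact: descendE_ge0.
apply: (@measurable_fun_fubini_tonelli_F _ _ _ _ _ P (fun xw =>
   (\1_(descend n) (z xw.2))%:E * f (traj xw.1 (z xw.2) n.+1))).
  apply: emeasurable_funM.
    apply: (measurableT_comp (indic_comp_measurable (measurable_descend n))).
    exact: measurable_snd.
  apply: (measurableT_comp mf).
  rewrite (_ : (fun xw : R * T => _) = (fun xs : R * Omega => traj xs.1 xs.2 n.+1) \o
    (fun xw => (xw.1, z xw.2)))//.
  apply: (measurableT_comp (measurable_traj n.+1)).
  apply/measurable_fun_pair; first exact: measurable_fst.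
  by apply: (measurableT_comp (measurable_z mX)); exact: measurable_snd.
by move=> xw; rewrite mule_ge0 ?lee_fin.
Qed.

Lemma sum_descend K :
  \sum_(0 <= n < K) P [set w | descend n (z w)] + P [set w | stay K (z w)] = 1.
Proof.
elim: K => [|K IH].
  rewrite big_geq// add0e (_ : [set w | _] = setT) ?probability_setT//.
  by apply/seteqP; split => // w _ [|//].
rewrite big_nat_recr; last by [].
rewrite /= -addeA -[in RHS]IH; congr (_ + _).
rewrite !(prob_indic P mX)//; last 3 first.
- exact: measurable_stay.
- exact: measurable_stay.
- exact: measurable_descend.
rewrite -ge0_integralD//; last 2 first.
- exact: (indic_comp_measurable (measurable_descend _)).
- exact: (indic_comp_measurable (measurable_stay _)).
by apply: eq_integral => w _; rewrite (indic_stayS K) EFinD.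
Qed.

Lemma prob_stay_small (e : R) : (0 < e)%R ->
  exists K, P [set w | stay K (z w)] <= e%:E.
Proof.
move=> e0; have [C C0 HC] := ladder_epoch_integrable.
apply: contrapT => /forallNP h.
have [K KC] : exists K : nat, (C < K%:R * e)%R.
  by exists (Num.bound (C / e)); rewrite -ltr_pdivrMr// archi_boundP// divr_ge0// ltW.
have := HC K; apply/negP; rewrite -ltNge.
apply: (@lt_le_trans _ _ (\sum_(0 <= n < K) e%:E)).
  by rewrite sumEFin lte_fin sumr_const_nat subn0 -mulr_natl.
by apply: lee_sum => n _; rewrite ltW// ltNge; exact/negP/h.
Qed.

Lemma ladder_cst (a : R) x : (0 <= a)%R -> a%:E <= ladder (fun=> a%:E) x.
Proof.
move=> a0; rewrite (_ : ladder _ _ = a%:E * \sum_(n <oo) P [set w | descend n (z w)]).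
  rewrite -[leLHS]mule1 lee_wpmul2l ?lee_fin//; apply/lee_addgt0Pr => e e0.
  have [K PK] := prob_stay_small e0.
  rewrite -(sum_descend K) leeD//; apply: nneseries_lim_ge => n _ _.
  exact: measure_ge0.
rewrite -nneseriesZl//; apply: eq_eseriesr => n _.
rewrite (prob_indic P mX); last exact: measurable_descend.
rewrite -ge0_integralZl//; last exact: (indic_comp_measurable (measurable_descend _)).
by apply: eq_integral => w _; rewrite muleC.
Qed.

End Ladder.

(** * Lyapunov functions exclude transience *)

Section Transience.
Context {d : measure_display} {T : measurableType d} {R : realType}.
Variables (P : probability T R) (X : nat -> T -> R * R).
Hypothesis mX : forall k, measurable_fun setT (X k).
Hypothesis iX : iid P X.
Hypothesis X_ge0 : forall w, nneg (X ^~ w).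
Hypothesis prodM_cvg0 : {ae P, forall w, (prodM (X ^~ w) n @[n --> \oo] --> 0)}.
Local Notation Omega := (seq_space (R * R)%type).
Local Notation z w := ((X ^~ w) : Omega).
Implicit Types (A B : set Omega) (f g : R -> \bar R).
Local Notation op := (op P X).
Local Notation ladder := (ladder P X).

Definition transient := {ae P, forall w, forall r : R,
  exists N, forall m, (N <= m)%N -> r < traj 0 (z w) m}.

Local Open Scope ereal_scope.

(** Last exit, for the event that the chain restarted at [0] remains above [r]
    from some time on: as the chain started at [0] stays below all the others, the
    bound on the expected number of visits is uniform in the starting point. *)
Lemma transient_visits r : transient -> exists2 C : R, (0 <= C)%R &
  forall x K, (0 <= x)%R -> \sum_(0 <= n < K) op n (lev r) x <= C%:E.
Proof.
move=> tr.
have mA m : measurable [set w | (r < traj 0 (z w) m)%R].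
  rewrite (_ : [set w | _] = ~` [set w | (traj 0 (z w) m <= r)%R]); last first.
    by apply/seteqP; split => w /=; rewrite ltNge => /negP.
  apply: measurableC.
  apply: (measurable_sequence_event mX (C := [set s | (traj 0 s m <= r)%R])).
  exact: measurable_traj_le.
have [|N PN] := @prob_eventually _ _ _ P _ mA.
  by apply: filterS tr => w /(_ r).
pose B : set Omega := [set s | forall m, (N <= m)%N -> (r < traj 0 s m)%R].
have mB : measurable B.
  rewrite (_ : B = \bigcap_(m in [set m | (N <= m)%N]) ~` [set s | (traj 0 s m <= r)%R]).
    apply: bigcap_measurableType => m _; apply: measurableC.
    exact: measurable_traj_le.
  by apply/seteqP; split => s h m /h /=; rewrite ltNge => /negP.
exists (N%:R / fine (P [set w | B (z w)]))%R; first by rewrite divr_ge0// fine_ge0.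
move=> x K x0; under eq_bigr do rewrite (op_lev P mX).
apply: (last_exit_bound mX iX X_ge0 (A := fun n => [set s | (traj x s n <= r)%R])
  _ mB _ _ PN).
- by move=> n; exact: measurable_traj_le.
- by move=> n s t /=; rewrite traj_past.
- move=> s n m s0 /= _ Bs nm; apply/negP; rewrite -ltNge.
  rewrite -(subnKC (leq_trans (leq_addr _ _) nm)) traj_shift.
  apply: lt_le_trans (le_traj _ (nneg_shift _ s0) (traj_ge0 _ s0 x0)).
  by apply: Bs; lia.
Qed.

(** A transient chain has a bounded potential [u] of the interval [[0, c]].  If
    the chain observed at its ladder epochs had a Lyapunov function [V], then
    [u + e * V] would satisfy the minimum principle outside of [[0, c]], hence
    so would [u]; but the potential is, on [[0, c]], at least one more than its
    infimum. *)
Lemma lyapunov_not_transient (V : R -> R) (c : R) :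
  measurable_fun setT V -> (forall x, 0 <= V x)%R ->
  (forall A : R, exists r, forall x, r < x -> A <= V x)%R ->
  (0 <= c)%R ->
  (forall x, (c < x)%R -> ladder (fun y => (V y)%:E) x <= (V x)%:E) ->
  ~ transient.
Proof.
move=> mV V0 Voo c0 LV tr.
have mVE : measurable_fun setT (fun y => (V y)%:E) by exact/measurable_EFinP.
have VE0 y : 0 <= (V y)%:E by rewrite lee_fin.
pose u r x := \sum_(n <oo) op n (lev r) x.
have mop n r : measurable_fun setT (op n (lev r)).
  by apply: measurable_op => //; [exact: measurable_lev|exact: lev_ge0].
have opn0 n r x : 0 <= op n (lev r) x by apply: op_ge0; exact: lev_ge0.
have u0 r x : 0 <= u r x by apply: nneseries_ge0.
have mu r : measurable_fun setT (u r) by apply: ge0_emeasurable_sum.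
have u_split r x : u r x = lev r x + op 1 (u r) x.
  rewrite /u op_nneseries//.
  under [in RHS]eq_eseriesr => n _.
    rewrite -[op 1 _ x]/(op 1 (op n (lev r)) x) -opD//; [|exact: measurable_lev|exact: lev_ge0].
    over.
  rewrite nneseries_recl; last 2 first.
  - by move=> n _; exact: opn0.
  - by [].
  rewrite op0; congr (_ + _).
  by rewrite -nneseries_addn//; apply: eq_eseriesr => n _; rewrite addnC.
have u_super r x : (0 <= x)%R -> op 1 (u r) x <= u r x.
  by move=> _; rewrite [leRHS]u_split leeDr// lev_ge0.
have u_bound r : exists2 C : R, (0 <= C)%R & forall x, (0 <= x)%R -> u r x <= C%:E.
  have [C C0 HC] := transient_visits r tr; exists C => // x x0.
  apply: lime_le; first exact: is_cvg_nneseries.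
  by apply: nearW => K; exact: HC.
have Lu r x : (0 <= x)%R -> ladder (u r) x <= op 1 (u r) x.
  by move=> x0; apply: ladder_superharmonic => //; exact: u_super.
pose rho r := fix rho n := if n is n'.+1 then ladder (rho n') else lev r.
have rho_spec r n : measurable_fun setT (rho r n) /\ forall y, 0 <= rho r n y.
  elim: n => [|n [mr r0]] /=; first by split; [exact: measurable_lev|exact: lev_ge0].
  by split; [exact: measurable_ladder|move=> y; exact: ladder_ge0].
have mrho r n := (rho_spec r n).1; have rho0 r n := (rho_spec r n).2.
have sum_rho r N x : (0 <= x)%R -> \sum_(0 <= n < N) rho r n x <= u r x.
  elim: N x => [|N IH] x x0; first by rewrite big_geq.
  rewrite big_nat_recl//= u_split leeD2l//.
  rewrite -(ladder_sum P mX)//; apply: le_trans (Lu r x x0).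
  apply: le_ladder => //; first exact: emeasurable_sum.
  by move=> y; exact: sume_ge0.
have rho_small r x (e : R) : (0 <= x)%R -> (0 < e)%R -> exists n, rho r n x <= e%:E.
  move=> x0 e0; have [C C0 HC] := u_bound r.
  apply: contrapT => /forallNP h.
  have [K KC] : exists K : nat, (C < K%:R * e)%R.
    by exists (Num.bound (C / e)); rewrite -ltr_pdivrMr// archi_boundP// divr_ge0// ltW.
  have := le_trans (sum_rho r K x x0) (HC x x0); apply/negP; rewrite -ltNge.
  apply: (@lt_le_trans _ _ (\sum_(0 <= n < K) e%:E)).
    by rewrite sumEFin lte_fin sumr_const_nat subn0 -mulr_natl.
  by apply: lee_sum => n _; rewrite ltW// ltNge; exact/negP/h.
pose I := [set x : R | (0 <= x <= c)%R].
pose a := fine (ereal_inf (u c @` I)).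
have I0 : I 0%R by rewrite /I/= lexx.
have inf_ge0 : 0 <= ereal_inf (u c @` I) by apply: le_ereal_inf_tmp => _ [y _ <-].
have aE : ereal_inf (u c @` I) = a%:E.
  rewrite fineK// ge0_fin_numE//; have [C _ HC] := u_bound c.
  apply: le_lt_trans (ltry C); apply: le_trans (HC 0%R (lexx _)).
  by apply: ereal_inf_lbound; exists 0%R.
have a0 : (0 <= a)%R by rewrite fine_ge0.
have u_I x : I x -> a%:E <= u c x by move=> Ix; rewrite -aE; apply: ereal_inf_lbound; exists x.
(* the minimum principle for the perturbed potential *)
have minV (e : R) x : (0 < e)%R -> (0 <= x)%R -> a%:E <= u c x + e%:E * (V x)%:E.
  move=> e0 x0; have [r Vr] := Voo (a / e)%R.
  have H n y : (0 <= y)%R ->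
      a%:E <= u c y + e%:E * (V y)%:E + a%:E * rho r n y.
    elim: n y => [|n IH] y y0.
      rewrite /= levE; have [yr|ry] := leP y r.
        by rewrite mule1 leeDr// adde_ge0// mule_ge0 ?lee_fin ?(ltW e0).
      rewrite mule0 adde0; apply: le_trans (leeDr _ (u0 c y)).
      by rewrite -EFinM lee_fin mulrC -ler_pdivrMr// Vr.
    have [yc|cy] := leP y c.
      apply: le_trans (u_I y _) _; first by rewrite /I/= y0.
      by rewrite -addeA leeDl// adde_ge0 ?mule_ge0 ?lee_fin ?(ltW e0).
    have meV : measurable_fun setT (fun y => e%:E * (V y)%:E) by exact: measurable_funeM.
    have marho : measurable_fun setT (fun y => a%:E * rho r n y) by exact: measurable_funeM.
    have eV0 x' : 0 <= e%:E * (V x')%:E by rewrite mule_ge0 ?lee_fin ?(ltW e0).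
    have arho0 x' : 0 <= a%:E * rho r n x' by rewrite mule_ge0 ?lee_fin.
    apply: le_trans (ladder_cst mX iX X_ge0 prodM_cvg0 y a0) _.
    apply: le_trans (le_ladder P mX X_ge0 _ _ _ y0 (IH)) _.
    - exact: measurable_cst.
    - by move=> x'; rewrite lee_fin.
    - by apply: emeasurable_funD => //; exact: emeasurable_funD.
    rewrite ladder_add//; last 2 first.
    - exact: emeasurable_funD.
    - by move=> x'; rewrite adde_ge0.
    rewrite ladder_add// !ladder_scale ?(ltW e0)//=.
    apply: leeD => //; apply: leeD.
      exact: le_trans (Lu c y y0) (u_super c y y0).
    by rewrite lee_wpmul2l ?lee_fin ?(ltW e0)// LV.
  apply/lee_addgt0Pr => t t0.
  have t1 : (0 < t / (a + 1))%R by rewrite divr_gt0// ltr_wpDl.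
  have [n rn] := rho_small r x _ x0 t1.
  apply: le_trans (H n x x0) _; rewrite leeD2l//.
  apply: le_trans (lee_wpmul2l _ rn) _; first by rewrite lee_fin.
  rewrite -EFinM lee_fin mulrCA ger_pMr// ler_pdivrMr ?ltr_wpDl//.
  by rewrite mul1r lerDl.
have u_min x : (0 <= x)%R -> a%:E <= u c x.
  move=> x0; apply/lee_addgt0Pr => t t0.
  have t1 : (0 < t / (V x + 1))%R by rewrite divr_gt0// ltr_wpDl.
  apply: le_trans (minV _ x t1 x0) _; rewrite leeD2l//.
  rewrite -EFinM lee_fin -mulrA ger_pMr// mulrC ler_pdivrMr ?ltr_wpDl//.
  by rewrite mul1r lerDl.
have : (a + 1)%:E <= a%:E.
  rewrite -[leRHS]aE; apply: le_ereal_inf_tmp => _ [x /andP[x0 xc] <-].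
  rewrite u_split levE xc addrC EFinD leeD2l//.
  rewrite -[leLHS](op_cst P X 1 _ x); apply: le_op => //.
by rewrite lee_fin gerDl ler10.
Qed.

End Transience.

(** * The iterated logarithm *)

Section IteratedLogarithm.
Context {R : realType}.
Implicit Types x y z a q p K : R.

(** [1 + ln (1 + x)] on the half-line, extended to be positive on the line. *)
Definition ln1p x : R := 1 + ln (1 + `|x|).

(** The Lyapunov function. It is concave on the half-line, and its increments
    over a multiplication by a constant are of the order of [(ln x)^-1], which is
    also the order of the tail of [ln Q] at [ln x]. *)
Definition lnln x : R := ln (ln1p x).

Lemma ln1p_ge1 x : 1 <= ln1p x.
Proof. by rewrite /ln1p lerDl ln_ge0// lerDl. Qed.

Lemma ln1p_gt0 x : 0 < ln1p x.
Proof. exact: lt_le_trans ltr01 (ln1p_ge1 x). Qed.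

Lemma lnln_ge0 x : 0 <= lnln x.
Proof. by rewrite ln_ge0// ln1p_ge1. Qed.

Lemma measurable_lnln : measurable_fun setT lnln.
Proof.
apply: (measurableT_comp (measurable_ln (R := R))).
apply: measurable_funD => //.
apply: (measurableT_comp (measurable_ln (R := R))).
apply: measurable_funD => //; exact: measurable_normr.
Qed.

Lemma le_ln1p x y : 0 <= x -> x <= y -> ln1p x <= ln1p y.
Proof.
move=> x0 xy; rewrite lerD2l ler_ln ?posrE ?ltr_pwDl//.
by rewrite lerD2l !ger0_norm// (le_trans x0).
Qed.

Lemma le_lnln x y : 0 <= x -> x <= y -> lnln x <= lnln y.
Proof. by move=> x0 xy; rewrite ler_ln ?posrE ?ln1p_gt0// le_ln1p. Qed.

Lemma lnln_unbounded A : exists r, forall x, r < x -> A <= lnln x.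
Proof.
exists (expR (expR A)) => x rx.
have x0 : 0 < x by rewrite (lt_trans _ rx)// expR_gt0.
rewrite -[leLHS]expRK ler_ln ?posrE ?expR_gt0 ?ln1p_gt0//.
rewrite /ln1p -[leLHS]expRK gtr0_norm//.
apply: (@le_trans _ _ (ln (1 + x))); last by rewrite lerDr.
by rewrite ler_ln ?posrE ?expR_gt0 ?addr_gt0// (le_trans (ltW rx))// lerDr.
Qed.

Definition lnlnD z a : R := lnln (z + a) - lnln z.

Lemma lnlnD_ge0 z a : 0 <= z -> 0 <= a -> 0 <= lnlnD z a.
Proof. by move=> z0 a0; rewrite subr_ge0 le_lnln// lerDl. Qed.

Lemma lnlnDE z a : 0 <= z -> 0 <= a ->
  lnlnD z a = ln (1 + (ln (1 + z + a) - ln (1 + z)) / ln1p z).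
Proof.
move=> z0 a0; rewrite /lnlnD /lnln -ln_div ?posrE ?ln1p_gt0//; congr ln.
have -> : ln1p (z + a) = 1 + ln (1 + z + a).
  by rewrite /ln1p ger0_norm ?addr_ge0// addrA.
have D0 := lt0r_neq0 (ln1p_gt0 z); apply: (mulIf D0).
by rewrite divfK// mulrDl divfK// /ln1p ger0_norm//; ring.
Qed.

Lemma lnlnD_nonincreasing z z' a : 0 <= z -> z <= z' -> 0 <= a ->
  lnlnD z' a <= lnlnD z a.
Proof.
move=> z0 zz a0; have z'0 := le_trans z0 zz.
have p1 y : 0 <= y -> 0 < 1 + y by move=> ?; rewrite ltr_pwDl.
have p2 y : 0 <= y -> 0 < 1 + y + a by move=> ?; rewrite ltr_wpDr// p1.
have l0 y : 0 <= y -> 0 <= ln (1 + y + a) - ln (1 + y).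
  by move=> y0; rewrite subr_ge0 ler_ln ?posrE ?p1 ?p2// lerDl.
have q0 y : 0 <= y -> 0 < 1 + (ln (1 + y + a) - ln (1 + y)) / ln1p y.
  by move=> y0; rewrite ltr_pwDl// divr_ge0 ?l0// ltW// ln1p_gt0.
rewrite !lnlnDE// ler_ln ?posrE ?q0// lerD2l ler_pM ?l0//.
- by rewrite invr_ge0 ltW// ln1p_gt0.
- rewrite -!ln_div ?posrE ?p1 ?p2// ler_ln ?posrE ?divr_gt0 ?p1 ?p2//.
  rewrite ler_pdivrMr ?p1// mulrAC ler_pdivlMr ?p1//.
  nra.
- by rewrite lef_pV2 ?posrE ?ln1p_gt0// le_ln1p.
Qed.

Lemma lnln_addn z (q : nat -> R) n : 0 <= z -> (forall k, 0 <= q k) ->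
  lnln (z + \sum_(0 <= k < n) q k) <= lnln z + \sum_(0 <= k < n) lnlnD z (q k).
Proof.
move=> z0 q0; elim: n => [|n IH]; first by rewrite !big_geq// !addr0.
rewrite !big_nat_recr//= !addrA.
set S := \sum_(0 <= k < n) q k; have S0 : 0 <= S by exact: sumr_ge0.
have zS : z <= z + S by rewrite lerDl.
have := lnlnD_nonincreasing z0 zS (q0 n); rewrite /lnlnD => h.
rewrite -/S in IH; lra.
Qed.

Lemma pow2_bracket y : 1 <= y -> exists2 J : nat,
  (forall j, (j < J)%N -> 2 ^+ j <= y) & ln (1 + y) <= J%:R *+ 2.
Proof.
move=> y1; have ex : exists n, y < 2 ^+ n.
  exists (Num.bound y); apply: lt_le_trans (archi_boundP (le_trans ler01 y1)) _.
  by rewrite -natrX ler_nat ltnW// ltn_expl.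
exists (ex_minn ex).
  case: ex_minnP => J yJ Jmin j jJ; rewrite leNgt; apply/negP => /Jmin.
  by rewrite leqNgt jJ.
case: ex_minnP => J yJ _.
have J1 : (0 < J)%N by rewrite lt0n; apply: contraTneq yJ => ->; rewrite expr0 -leNgt.
apply: (@le_trans _ _ (ln (2 ^+ J.+1))).
  by rewrite ler_ln ?posrE ?exprn_gt0// ?exprS; nra.
rewrite lnXn//; apply: (@le_trans _ _ (1 *+ J.+1)).
  by rewrite lerMn2r -[X in _ <= X](expRK 1); apply/orP; right;
    rewrite ler_ln ?posrE ?expR_gt0// (le_trans _ (expR_ge1Dx 1)).
by rewrite -mulrnA ler_nat; lia.
Qed.

(** The increments of the Lyapunov function: jumps smaller than the present
    state contribute the first term, and larger ones the logarithm of the ratio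
    of the logarithms, bounded here by a dyadic count. *)
Lemma lnlnD_bound z q : 0 < z -> 0 <= q -> exists2 J : nat,
  (forall j, (j < J)%N -> 2 ^+ j * ln (1 + z) <= ln (1 + q)) &
  lnlnD z q <= (ln1p z)^-1 + J%:R *+ 2.
Proof.
move=> z0 q0; have z1 : 0 < 1 + z by rewrite addr_gt0.
have L0 : 0 < ln (1 + z) by rewrite ln_gt0// ltrDl.
have Lz : ln (1 + z) <= ln1p z by rewrite /ln1p gtr0_norm// lerDr.
have q1 : 0 < 1 + q by rewrite ltr_pwDl.
have zq1 : 0 < 1 + z + q by rewrite ltr_wpDr.
rewrite lnlnDE ?(ltW z0)//.
have [qz|zq] := leP q z.
  exists 0%N => //; rewrite mul0rn addr0 -ln_div ?posrE//.
  apply: le_trans (le_ln1Dx _) _.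
    rewrite (lt_le_trans (ltrN10 _))// divr_ge0 ?(ltW (ln1p_gt0 z))// ln_ge0//.
    by rewrite ler_pdivlMr// mul1r lerDl.
  rewrite -[leRHS]mul1r ler_pM2r ?invr_gt0 ?ln1p_gt0//.
  rewrite -[leRHS]expRK ler_ln ?posrE ?divr_gt0 ?expR_gt0//.
  apply: le_trans (expR_ge1Dx 1); rewrite ler_pdivrMr//; nra.
have y1 : 1 <= ln (1 + q) / ln (1 + z).
  by rewrite ler_pdivlMr// mul1r ler_ln ?posrE// lerD2l ltW.
have [J HJ lnJ] := pow2_bracket y1; exists J.
  by move=> j /HJ; rewrite ler_pdivlMr.
apply: (@le_trans _ _ (J%:R *+ 2)); last by rewrite lerDr invr_ge0 ltW// ln1p_gt0.
apply: le_trans lnJ.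
have a0 : 0 <= ln (1 + z + q) - ln (1 + z).
  by rewrite subr_ge0 ler_ln ?posrE// lerDl.
rewrite ler_ln ?posrE; last 2 first.
- by rewrite ltr_pwDl// divr_ge0// ltW// ln1p_gt0.
- by rewrite ltr_pwDl// (le_trans ler01).
rewrite lerD2l ler_pM ?invr_ge0 ?(ltW (ln1p_gt0 z))//.
  rewrite lerBlDr -lnM ?posrE// ler_ln ?posrE ?mulr_gt0//; nra.
by rewrite lef_pV2 ?posrE ?ln1p_gt0.
Qed.

(** The negative part of the logarithm, truncated at the level [K]. *)
Definition clog K p : R := - ln (Num.max (Num.min p 1) (expR (- K))).

Lemma clog_ge0 K p : 0 <= K -> 0 <= clog K p.
Proof.
by move=> K0; rewrite oppr_ge0 ln_le0// ge_max ge_min lexx orbT/= expR_le1 oppr_le0.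
Qed.

Lemma clog_eq0 K p : 0 <= K -> 1 <= p -> clog K p = 0.
Proof.
move=> K0 p1; rewrite /clog (min_idPr p1) (max_idPl _) ?ln1 ?oppr0//.
by rewrite expR_le1 oppr_le0.
Qed.

Lemma clog_le K p : clog K p <= K.
Proof.
rewrite /clog lerNl -[leLHS]expRK ler_ln ?posrE ?expR_gt0//.
  by rewrite le_max lexx orbT.
by rewrite lt_max expR_gt0 orbT.
Qed.

Lemma measurable_clog K : measurable_fun setT (clog K).
Proof.
apply: measurableT_comp => //; apply: (measurableT_comp (measurable_ln (R := R))).
by apply: measurable_maxr => //; apply: measurable_minr.
Qed.

(** Contracting a large state by a factor [r >= expR (- K)] lowers the Lyapunov
    function by at least [- ln r / ln1p x], up to an error of the same order, which a
    large mean of [clog K] outweighs. *)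
Lemma lnln_contract K p x : 0 <= K -> 0 <= p -> p <= 1 -> expR K <= x ->
  lnln (Num.max p (expR (- K)) * x) + clog K p / ln1p x <= lnln x + (ln1p x)^-1.
Proof.
move=> K0 p0 p1 xK; have x0 : 0 < x := lt_le_trans (expR_gt0 K) xK.
rewrite /clog (min_idPl p1); set r := Num.max _ _.
have r0 : 0 < r by rewrite lt_max expR_gt0 orbT.
have rK : expR (- K) <= r by rewrite le_max lexx orbT.
have r1 : r <= 1 by rewrite ge_max p1 expR_le1 oppr_le0.
have rx0 : 0 < r * x by rewrite mulr_gt0.
have Dx := ln1p_gt0 x; have Drx := ln1p_gt0 (r * x).
(* [ln b - ln a >= (b - a) / b], then a comparison of [1 + x] and [1 + r * x] *)
have h1 : lnln (r * x) - lnln x <= (ln1p (r * x) - ln1p x) / ln1p x.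
  rewrite /lnln -ln_div ?posrE// mulrBl divff ?gt_eqF//.
  rewrite -{1}[_ / _](subrK 1) addrC; apply: le_ln1Dx.
  by rewrite ltrBrDr addNr divr_gt0.
have h2 : ln1p (r * x) - ln1p x <= 1 + ln r.
  suff : ln (1 + r * x) <= ln (expR 1 * (r * (1 + x))).
    rewrite !lnM ?posrE ?expR_gt0 ?mulr_gt0 ?addr_gt0// expRK.
    by rewrite /ln1p !gtr0_norm//; lra.
  rewrite ler_ln ?posrE ?mulr_gt0 ?expR_gt0 ?addr_gt0//.
  have e2 : 2 <= expR 1 :> R by have := expR_ge1Dx (1 : R).
  have rx1 : 1 <= r * x.
    apply: (@le_trans _ _ (expR (- K) * expR K)); first by rewrite mulrC expRxMexpNx_1.
    by rewrite ler_pM ?expR_ge0.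
  nra.
have h3 : lnln (r * x) - lnln x <= (1 + ln r) / ln1p x.
  by apply: le_trans h1 _; rewrite ler_pM2r ?invr_gt0.
rewrite mulrDl mul1r in h3; rewrite mulNr; lra.
Qed.

End IteratedLogarithm.

(** * Wald's identity at the ladder epoch *)

Section LadderDrift.
Context {d : measure_display} {T : measurableType d} {R : realType}.
Variables (P : probability T R) (X : nat -> T -> R * R).
Hypothesis mX : forall k, measurable_fun setT (X k).
Hypothesis iX : iid P X.
Hypothesis X_ge0 : forall w, nneg (X ^~ w).
Hypothesis prodM_cvg0 : {ae P, forall w, (prodM (X ^~ w) n @[n --> \oo] --> 0)}.
Local Notation Omega := (seq_space (R * R)%type).
Local Notation z w := ((X ^~ w) : Omega).
Local Notation ladder := (ladder P X).

(** Before the ladder epoch the products are at least [1], so that dividing by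
    them only diminishes the inputs; at the epoch the product is below [1]. *)
Lemma descend_traj x (s : nat -> R * R) n : nneg s -> 0 <= x -> descend n s ->
  traj x s n.+1 <= prodM s n.+1 * x + \sum_(0 <= k < n.+1) (s k).2.
Proof.
move=> s0 x0 [sn /=]; set p := prodM s n * (s n).1 => lt1.
have H k : (k <= n)%N -> traj x s k <= prodM s k * (x + \sum_(0 <= j < k) (s j).2).
  elim: k => [|k IH] kn /=; first by rewrite big_geq// addr0 mul1r.
  have [mk0 qk0] := s0 k; have pk1 := sn k.+1 kn.
  rewrite big_nat_recr//=; set S := \sum_(0 <= j < k) _ in IH *.
  apply: (@le_trans _ _ ((s k).1 * (prodM s k * (x + S)) + prodM s k.+1 * (s k).2)).
    by rewrite lerD// ?ler_wpM2l ?IH ?(ltnW kn)// ler_peMl.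
  by rewrite le_eqVlt; apply/orP; left; apply/eqP => /=; ring.
have [m0 q0] := s0 n; have p0 : 0 <= p by rewrite mulr_ge0// prodM_ge0.
have S0 : 0 <= \sum_(0 <= j < n) (s j).2 by apply: sumr_ge0 => j _; case: (s0 j).
have := ler_wpM2l m0 (H n (leqnn n)).
rewrite mulrA [_ * prodM _ _]mulrC -/p big_nat_recr//= => h.
apply: (le_trans (lerD h (lexx _))).
by rewrite mulrDr addrA lerD2r lerD2l ler_piMl// ltW.
Qed.

Local Open Scope ereal_scope.

(** Wald's identity in the form of an upper bound for what a function can gain
    up to the ladder epoch from bounds on its one-step gains. *)
Lemma ladder_wald (C : R) (f g c : R -> R) (x v : R) :
  (forall K, \sum_(0 <= n < K) P [set w | stay n (z w)] <= C%:E) ->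
  measurable_fun setT f -> (forall y, 0 <= f y)%R ->
  measurable_fun setT g -> (forall y, 0 <= g y)%R ->
  measurable_fun setT c -> (forall y, 0 <= c y)%R ->
  (0 <= v)%R ->
  (forall p, 1 <= p -> g p = 0)%R ->
  (forall s n, nneg s -> descend n s ->
    f (traj x s n.+1) + g (s 0%N).1 *+ (n == 0%N) <=
      v + \sum_(0 <= k < n.+1) c (s k).2)%R ->
  ladder (fun y => (f y)%:E) x + \int[P]_w (g (X 0%N w).1)%:E <=
    v%:E + C%:E * \int[P]_w (c (X 0%N w).2)%:E.
Proof.
move=> HC mf f0 mg g0 mc c0 v0 g1 Hstep.
have C0 : (0 <= C)%R by rewrite -lee_fin; apply: le_trans (HC 0%N); rewrite big_geq.
have mfE : measurable_fun setT (fun y => (f y)%:E) by exact/measurable_EFinP.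
pose Fn n (s : nat -> R * R) : R := (\1_(descend n) s * (f (traj x s n.+1) + g (s 0%N).1 *+ (n == 0%N)))%R.
pose Cn n (s : nat -> R * R) : R := (\1_(stay n) s * c (s n).2)%R.
have pointwise s K : nneg s ->
    (\sum_(0 <= n < K) Fn n s + \1_(stay K) s * (v + \sum_(0 <= k < K) c (s k).2) <=
     v + \sum_(0 <= n < K) Cn n s)%R.
  move=> s0; elim: K => [|K IH].
    rewrite !big_geq// !(add0r, addr0) indicE mem_set ?mul1r//.
    by move=> j; rewrite leqn0 => /eqP ->.
  rewrite [X in (X + _ <= _)%R]big_nat_recr// [X in (_ <= _ + X)%R]big_nat_recr//=.
  have Fle : (Fn K s <= \1_(descend K) s * (v + \sum_(0 <= k < K.+1) c (s k).2))%R.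
    rewrite /Fn indicE; have [ds|ds] := pselect (descend K s).
      by rewrite mem_set// !mul1r Hstep.
    by rewrite memNset// !mul0r.
  have := indic_stayS K s => E.
  have E2 : (\1_(descend K) s * (v + \sum_(0 <= k < K.+1) c (s k).2) +
    \1_(stay K.+1) s * (v + \sum_(0 <= k < K.+1) c (s k).2) =
    \1_(stay K) s * (v + \sum_(0 <= k < K) c (s k).2) + Cn K s)%R.
    by rewrite -mulrDl -E big_nat_recr//= addrA mulrDr.
  lra.
have mzf n : measurable_fun setT (fun w => (f (traj x (z w) n))%:E : \bar R).
  exact: (measurable_traj_comp mX _ _ mfE).
have mg0 : measurable_fun setT (fun w => (g (X 0%N w).1)%:E).
  apply/measurable_EFinP; apply: (measurableT_comp mg).
  by apply: (measurableT_comp measurable_fst).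
have mck k : measurable_fun setT (fun w => (c (X k w).2)%:E).
  apply/measurable_EFinP; apply: (measurableT_comp mc).
  by apply: (measurableT_comp measurable_snd).
have ck0 k w : 0 <= (c (X k w).2)%:E.
  by rewrite lee_fin.
have mFn n : measurable_fun setT (fun w => (Fn n (z w))%:E).
  under eq_fun do rewrite EFinM.
  apply: emeasurable_funM; first exact: (indic_comp_measurable mX (measurable_descend n)).
  under eq_fun do rewrite EFinD.
  apply: emeasurable_funD => //.
  by case: (n == 0%N) => //=; under eq_fun do rewrite mulr0n; exact: measurable_cst.
have Fn0 n w : 0 <= (Fn n (z w))%:E.
  by rewrite lee_fin mulr_ge0// addr_ge0// mulrn_wge0.
have mCn n : measurable_fun setT (fun w => (Cn n (z w))%:E).
  under eq_fun do rewrite EFinM.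
  by apply: emeasurable_funM => //; exact: (indic_comp_measurable mX (measurable_stay n)).
have Cn0 n w : 0 <= (Cn n (z w))%:E by rewrite /Cn EFinM mule_ge0 ?lee_fin.
(* the two sides, as expectations of the two sides of the pointwise bound *)
have lhs K : \int[P]_w (\sum_(0 <= n < K.+1) Fn n (z w))%:E =
    \sum_(0 <= n < K.+1) descendE P X n (fun y => (f y)%:E) x +
    \int[P]_w (g (X 0%N w).1)%:E.
  under eq_integral do rewrite -sumEFin.
  rewrite ge0_integral_sum// !big_nat_recl//= [RHS]addeAC; congr (_ + _); last first.
    apply: eq_bigr => n _; apply: eq_integral => w _.
    by rewrite /Fn mulr0n addr0 EFinM.
  rewrite /descendE -ge0_integralD//.
  - apply: eq_integral => w _; rewrite /Fn mulr1n mulrDr EFinD EFinM; congr (_ + _%:E).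
    rewrite indicE; have [d0|d0] := pselect (descend 0 (z w)).
      by rewrite mem_set// mul1r.
    rewrite memNset// mul0r g1// leNgt; apply/negP => lt1; apply: d0.
    by split => /=; [move=> j; rewrite leqn0 => /eqP ->|rewrite mul1r].
  - by move=> w _; rewrite mule_ge0 ?lee_fin.
  - apply: emeasurable_funM => //.
    exact: (indic_comp_measurable mX (measurable_descend 0)).
  - by move=> w _; rewrite lee_fin.
have intCn n : \int[P]_w (Cn n (z w))%:E =
    P [set w | stay n (z w)] * \int[P]_w (c (X 0%N w).2)%:E.
  apply: (expectation_past_next mX iX (c := fun y => c y.2)
    (measurable_stay n) (@stay_past R n)) => //.
  exact: (measurableT_comp mc measurable_snd).
have rhs K : \int[P]_w (v + \sum_(0 <= n < K) Cn n (z w))%:E <=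
    v%:E + C%:E * \int[P]_w (c (X 0%N w).2)%:E.
  under eq_integral do rewrite EFinD -sumEFin.
  rewrite ge0_integralD//; last 2 first.
  - by move=> w _; exact: sume_ge0.
  - exact: emeasurable_sum.
  rewrite integral_cst//= probability_setT mule1 leeD2l// ge0_integral_sum//.
  under eq_bigr do rewrite intCn.
  rewrite -ge0_sume_distrl//; apply: lee_wpmul2r => //.
  by apply: integral_ge0 => w _; exact: ck0.
set G := \int[P]_w _ in lhs *; set B := _ + _ in rhs *.
have G0 : 0 <= G by apply: integral_ge0 => w _; rewrite lee_fin.
have H K : \sum_(0 <= n < K) descendE P X n (fun y => (f y)%:E) x + G <= B.
  apply: (@le_trans _ _ (\sum_(0 <= n < K.+1) descendE P X n (fun y => (f y)%:E) x + G)).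
    by rewrite leeD2r// big_nat_recr//= leeDl// descendE_ge0.
  rewrite -lhs; apply: le_trans (rhs K.+1); apply: ge0_le_integral => //.
  - by move=> w _; rewrite -sumEFin sume_ge0.
  - under eq_fun do rewrite -sumEFin; exact: emeasurable_sum.
  - under eq_fun do rewrite EFinD -sumEFin.
    by apply: emeasurable_funD => //; exact: emeasurable_sum.
  - move=> w _; rewrite lee_fin; have := pointwise (z w) K.+1 (X_ge0 w).
    apply: le_trans; rewrite lerDl mulr_ge0// addr_ge0// sumr_ge0//.
have [->|Bfin] := eqVneq B +oo; first exact: leey.
have GB : G <= B by have := H 0%N; rewrite big_geq// add0e.
have Gfin : G \is a fin_num.
  rewrite ge0_fin_numE//; apply: le_lt_trans GB _; by rewrite ltey.
rewrite -leeBrDr//; apply: lime_le.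
  by apply: is_cvg_nneseries => n _ _; exact: descendE_ge0.
by apply: nearW => K; rewrite leeBrDr.
Qed.

End LadderDrift.

(** * Drift of the iterated logarithm *)

Section LadderLyapunov.
Context {d : measure_display} {T : measurableType d} {R : realType}.
Variables (P : probability T R) (X : nat -> T -> R * R).
Hypothesis mX : forall k, measurable_fun setT (X k).
Hypothesis iX : iid P X.
Hypothesis X_ge0 : forall w, nneg (X ^~ w).
Hypothesis prodM_cvg0 : {ae P, forall w, (prodM (X ^~ w) n @[n --> \oo] --> 0)}.
Local Notation ladder := (ladder P X).
Local Open Scope ereal_scope.

Hypothesis Q_tail : exists2 C : R, (0 <= C)%R & forall t, (0 < t)%R ->
  P [set w | (t <= ln (1 + (X 0%N w).2))%R] <= (C / t)%:E.

Hypothesis clog_infinite : forall A : R, exists2 K : R, (0 <= K)%R &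
  A%:E <= \int[P]_w (clog K (X 0%N w).1)%:E.

Lemma measurable_lnlnD z : measurable_fun setT (fun q : R => lnlnD z `|q|).
Proof.
apply: measurable_funB => //; apply: (measurableT_comp measurable_lnln).
by apply: measurable_funD => //; exact: measurable_normr.
Qed.

(** The dyadic bound of the increments, summed against the tail of [ln Q]: the levels
    [2 ^ j * ln z] contribute a geometric series in [1 / ln z]. *)
Lemma expectation_lnlnD : exists2 C : R, (0 <= C)%R & forall z, (0 < z)%R ->
  \int[P]_w (lnlnD z `|(X 0%N w).2|)%:E <= ((ln1p z)^-1 + C / ln (1 + z))%:E.
Proof.
have [C C0 HC] := Q_tail; exists (4 * C)%R; first by rewrite mulr_ge0.
move=> z z0; set L := ln (1 + z).
have L0 : (0 < L)%R by rewrite ln_gt0// ltrDl.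
pose A j := [set w | (2 ^+ j * L <= ln (1 + (X 0%N w).2))%R].
have mQ : measurable_fun setT (fun w => (X 0%N w).2).
  exact: (measurableT_comp measurable_snd).
have mA j : measurable (A j).
  rewrite -[X in measurable X]setTI.
  rewrite (_ : A j = (fun w => ln (1 + (X 0%N w).2)) @^-1` `[(2 ^+ j * L)%R, +oo[); last first.
    by apply/seteqP; split => w /=; rewrite in_itv/= andbT.
  have : measurable_fun setT (fun w => ln (1 + (X 0%N w).2)).
    apply: (measurableT_comp (measurable_ln (R := R))).
    exact: measurable_funD.
  exact.
have mI j : measurable_fun setT (fun w => 2%:E * (\1_(A j) w)%:E : \bar R).
  by apply: measurable_funeM; exact/measurable_EFinP/measurable_indic.
have I0 j w : 0 <= 2%:E * (\1_(A j) w)%:E :> \bar R by rewrite mule_ge0 ?lee_fin.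
apply: (@le_trans _ _ (\int[P]_w ((ln1p z)^-1%:E + \sum_(j <oo) 2%:E * (\1_(A j) w)%:E))).
  apply: ge0_le_integral => //.
  - by move=> w _; rewrite lee_fin lnlnD_ge0// ltW.
  - by apply/measurable_EFinP; apply: (measurableT_comp (measurable_lnlnD z)).
  - apply: emeasurable_funD => //; exact: ge0_emeasurable_sum.
  - move=> w _; have q0 : (0 <= (X 0%N w).2)%R by case: (X_ge0 w 0%N).
    rewrite ger0_norm//; have [J HJ le1] := lnlnD_bound z0 q0.
    apply: (@le_trans _ _ ((ln1p z)^-1 + J%:R *+ 2)%:E); first by rewrite lee_fin.
    rewrite EFinD leeD2l//; apply: le_trans (nneseries_lim_ge J _) => //.
    rewrite -ge0_sume_distrr// sumEFin -EFinM lee_fin -mulr_natl ler_wpM2l//.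
    rewrite big_mkord (eq_bigr (fun=> 1%R)) => [|j _].
      by rewrite sumr_const card_ord.
    by rewrite indicE mem_set//; exact: HJ.
rewrite ge0_integralD//; last 3 first.
- by move=> w _; rewrite lee_fin invr_ge0 ltW// ln1p_gt0.
- by move=> w _; exact: nneseries_ge0.
- exact: ge0_emeasurable_sum.
rewrite integral_cst//= probability_setT mule1 [leRHS]EFinD leeD2l//.
rewrite integral_nneseries//; apply: lime_le.
  by apply: is_cvg_nneseries => j _ _; exact: integral_ge0.
apply: nearW => n.
apply: (@le_trans _ _ (\sum_(0 <= j < n) (2 * (C / (2 ^+ j * L)))%:E)).
  apply: lee_sum => j _; rewrite ge0_integralZl//; last first.
    exact/measurable_EFinP/measurable_indic.
  rewrite integral_indic// setIT EFinM lee_wpmul2l//; apply: HC.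
  by rewrite mulr_gt0// exprn_gt0.
rewrite sumEFin lee_fin.
suff -> : (\sum_(0 <= j < n) (2 * (C / (2 ^+ j * L))) = 4 * C / L * (1 - (2 ^+ n)^-1))%R.
  rewrite ler_piMr// ?gerBl ?invr_ge0 ?exprn_ge0//.
  by rewrite divr_ge0 ?mulr_ge0// ltW.
elim: n => [|n IH]; first by rewrite big_geq// expr0 invr1 subrr mulr0.
have Ln0 : L != 0%R by rewrite gt_eqF.
have pn0 : (2 ^+ n != 0 :> R)%R by rewrite expf_neq0.
by rewrite big_nat_recr//= IH exprS; field; rewrite ?Ln0 ?pn0.
Qed.

(** The drift of the iterated logarithm at the ladder epochs. The contraction
    gains [E (clog K M) / ln x], with a factor as large as desired since the
    negative part of [ln M] is not integrable, whereas the inputs up to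
    the ladder epoch cost [O (1 / ln x)] by Wald's identity. *)
Lemma ladder_lyapunov : exists2 c : R, (0 <= c)%R &
  forall x, (c < x)%R -> ladder (fun y => (lnln y)%:E) x <= (lnln x)%:E.
Proof.
have [Cs Cs0 HCs] := ladder_epoch_integrable mX iX X_ge0 prodM_cvg0.
have [C C0 HC] := expectation_lnlnD.
have [K K0 HK] := clog_infinite (1 + Cs * (2 + 2 * C)).
pose e := expR K.
have e1 : (1 <= e)%R by rewrite -expR0 ler_expR.
have e0 : (0 < e)%R by exact: expR_gt0.
exists (2 * expR 1 * e ^+ 2)%R; first by rewrite mulr_ge0// exprn_ge0// ltW.
have E1 : (1 <= expR 1 :> R)%R by rewrite -[leLHS]expR0 ler_expR.
move=> x cx; have ex : (e <= x)%R by nra.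
have x0 : (0 < x)%R := lt_le_trans e0 ex.
pose z := (expR (- K) * x)%R.
have z0 : (0 < z)%R by rewrite mulr_gt0// expR_gt0.
have zx : (z <= x)%R by rewrite ler_piMl ?(ltW x0)// expR_le1 oppr_le0.
set D := ln1p x; have D0 : (0 < D)%R := ln1p_gt0 x.
have L0 : (0 < ln (1 + z))%R by rewrite ln_gt0// ltrDl.
have DL : (D <= 2 * ln (1 + z))%R.
  have ez : (e * z = x)%R by rewrite /z mulrA expRxMexpNx_1 mul1r.
  have -> : (2 * ln (1 + z) = ln ((1 + z) ^+ 2))%R.
    by rewrite lnXn ?addr_gt0// mulr_natl.
  rewrite /D /ln1p gtr0_norm// -[X in (X + _)%R](expRK 1%R).
  rewrite -lnM ?posrE ?expR_gt0 ?addr_gt0// ler_ln ?posrE; last 2 first.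
  - by rewrite mulr_gt0 ?expR_gt0 ?addr_gt0.
  - by rewrite exprn_gt0// addr_gt0.
  have E0 : (0 < expR 1 :> R)%R by exact: expR_gt0.
  have zE : (2 * expR 1 * e <= z)%R by rewrite -(ler_pM2l e0) ez; nra.
  apply: (@le_trans _ _ (expR 1 * (2 * x))%R); first by rewrite ler_pM2l//; lra.
  apply: (@le_trans _ _ (z ^+ 2)%R); last by rewrite lerXn2r ?nnegrE ?addr_ge0 ?lerDr// ltW.
  have -> : (expR 1 * (2 * x) = 2 * expR 1 * e * z)%R by rewrite -ez; ring.
  by rewrite expr2 ler_pM2r.
have Dz : (D <= 2 * ln1p z)%R.
  by apply: le_trans DL _; rewrite ler_pM2l// /ln1p gtr0_norm// lerDr.
have step (s : nat -> R * R) n : nneg s -> descend n s ->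
    (lnln (traj x s n.+1) + (clog K (s 0%N).1 / D) *+ (n == 0%N) <=
      lnln x + D^-1 + \sum_(0 <= k < n.+1) lnlnD z `|(s k).2|)%R.
  move=> s0 ds; have q0 k : (0 <= (s k).2)%R by case: (s0 k).
  case: n ds => [|n] ds.
    have [p0 _] := s0 0%N; have p1 : ((s 0%N).1 <= 1)%R.
      by case: ds => _ /=; rewrite mul1r => /ltW.
    rewrite eqxx mulr1n big_nat1 ger0_norm//=.
    have := lnln_contract K0 p0 p1 ex; rewrite -/D.
    set r := Num.max _ _ => h.
    have rK : (expR (- K) <= r)%R by rewrite le_max lexx orbT.
    have zrx : (z <= r * x)%R by rewrite ler_pM2r.
    have := lnlnD_nonincreasing (ltW z0) zrx (q0 0%N).
    rewrite {1}/lnlnD => h2.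
    have h3 : (lnln ((s 0%N).1 * x + (s 0%N).2) <= lnln (r * x + (s 0%N).2))%R.
      apply: le_lnln; first by rewrite addr_ge0 ?mulr_ge0// ltW.
      by rewrite lerD2r ler_pM2r// le_max lexx.
    lra.
  rewrite mulr0n addr0; have [_ /ltW p1] := ds.
  have S0 : (0 <= \sum_(0 <= k < n.+2) (s k).2)%R by exact: sumr_ge0.
  apply: le_trans (le_lnln (traj_ge0 _ s0 (ltW x0)) (descend_traj s0 (ltW x0) ds)) _.
  apply: (@le_trans _ _ (lnln (x + \sum_(0 <= k < n.+2) (s k).2))).
    apply: le_lnln; last by rewrite lerD2r ler_piMl// ltW.
    by rewrite addr_ge0// mulr_ge0 ?prodM_ge0// ltW.
  apply: le_trans (lnln_addn _ (ltW x0) q0) _.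
  rewrite lerD//; first by rewrite lerDl invr_ge0 ltW.
  apply: ler_sum => k _; rewrite ger0_norm//.
  exact: lnlnD_nonincreasing (ltW z0) zx (q0 k).
have gge0 p : (0 <= clog K p / D)%R by rewrite divr_ge0 ?clog_ge0// ltW.
have mg : measurable_fun setT (fun p => clog K p / D)%R.
  by apply: measurable_funM => //; exact: measurable_clog.
have v0 : (0 <= lnln x + D^-1)%R by rewrite addr_ge0 ?lnln_ge0// invr_ge0 ltW.
have cge0 (q : R) : (0 <= lnlnD z `|q|)%R by rewrite lnlnD_ge0// ltW.
have g1 p : (1 <= p -> clog K p / D = 0)%R by move=> p1; rewrite clog_eq0// mul0r.
have W := ladder_wald mX iX X_ge0 HCs measurable_lnln lnln_ge0 mg gge0
  (measurable_lnlnD z) cge0 v0 g1 step.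
pose g0 := ((1 + Cs * (2 + 2 * C)) / D)%R.
have G0 : g0%:E <= \int[P]_w (clog K (X 0%N w).1 / D)%:E.
  under eq_integral do rewrite mulrC EFinM.
  rewrite ge0_integralZl//.
  - rewrite /g0 mulrC EFinM lee_wpmul2l// lee_fin invr_ge0 ltW//.
  - apply/measurable_EFinP; apply: (measurableT_comp (measurable_clog K)).
    by apply: (measurableT_comp measurable_fst).
  - by move=> w _; rewrite lee_fin clog_ge0.
  - by rewrite lee_fin invr_ge0 ltW.
suff : ladder (fun y => (lnln y)%:E) x + g0%:E <= (lnln x)%:E + g0%:E.
  by rewrite leeD2rE.
apply: le_trans (leeD2l _ G0) _; apply: le_trans W _.
apply: (@le_trans _ _ (lnln x + D^-1 + Cs * ((ln1p z)^-1 + C / ln (1 + z)))%:E).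
  by rewrite [leRHS]EFinD leeD2l// EFinM lee_wpmul2l ?lee_fin// HC.
rewrite -EFinD lee_fin -addrA lerD2l /g0 mulrDl mul1r lerD2l -mulrA ler_wpM2l//.
rewrite mulrDl lerD//.
  by rewrite ler_pdivlMr// mulrC ler_pdivrMr ?ln1p_gt0.
rewrite ler_pdivlMr// mulrAC ler_pdivrMr//; nra.
Qed.

End LadderLyapunov.

(** * Accumulation points and a zero-one law *)

Section AccumulationPoints.
Context {R : realType}.
Implicit Types (u v : nat -> R) (p q e : R).

Definition clusters u p :=
  forall m, closure [set u n | n in [set n | (m <= n)%N]] p.

(** Infinitely many terms of [u] in a compact part of [ball q e]; the margin
    makes the condition insensitive to perturbations that tend to [0]. *)
Definition io_near u q e := exists k, forall n, exists2 m,
  (n <= m)%N & `|u m - q| < e - k.+1%:R^-1.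

Lemma clustersP u p : clusters u p <->
  forall q e : rat, `|p - ratr q| < ratr e -> io_near u (ratr q) (ratr e).
Proof.
split=> [up q e pqe|h m B /nbhs_ballP[e /= e0 pB]].
  pose t := ratr e - `|p - ratr q|; have t0 : 0 < t by rewrite subr_gt0.
  have [k kt] : exists k : nat, (k.+1%:R^-1 : R) < t / 2.
    have [k] := ltr_add_invr (y := 0 : R) (x := t / 2) (divr_gt0 t0 (ltr0n _ 2)).
    by rewrite add0r; exists k.
  exists k => n; have [|_ [[m nm <-] pm]] := up n (ball p (t / 2)).
    by apply: nbhsx_ballx; rewrite divr_gt0.
  exists m => //; have := ler_normD (u m - p) (p - ratr q).
  rewrite addrA subrK; move: pm; rewrite /ball/= distrC => pm h.
  have lin (a b c i : R) : a < (b - c) / 2 -> i < (b - c) / 2 -> a + c < b - i by lra.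
  by apply: le_lt_trans h _; exact: lin.
have e4 : 0 < e / 4 by rewrite divr_gt0.
have lt1 : p - e / 4 < p + e / 4 by lra.
have lt2 : e / 4 < e / 2 by lra.
have [q] := rat_in_itvoo lt1; rewrite in_itv/= => /andP[q1 q2].
have [t] := rat_in_itvoo lt2; rewrite in_itv/= => /andP[t1 t2].
have pq : `|p - ratr q| < e / 4 by rewrite ltr_norml; lra.
have [k /(_ m)[n mn unq]] := h q t (lt_trans pq t1).
exists (u n); split; first by exists n.
apply: pB; rewrite /ball/=; have := ler_distD (ratr q) p (u n).
have k0 : 0 <= k.+1%:R^-1 :> R by rewrite invr_ge0.
rewrite [`|ratr q - u n|]distrC.
have lin (a b c i r : R) : a < e / 4 -> i < r - b -> r < e / 2 -> 0 <= b ->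
  c <= a + i -> c < e by lra.
exact: lin pq unq t2 k0.
Qed.

Lemma closed_clusters u : closed [set p | clusters u p].
Proof.
rewrite (_ : [set p | _] = \bigcap_m closure [set u n | n in [set n | (m <= n)%N]]).
  by apply: closed_bigI => m _; exact: closed_closure.
by apply/seteqP; split=> p h m //; exact: h.
Qed.

Lemma io_near_cvg u v q e : (u n - v n @[n --> \oo] --> 0) ->
  io_near u q e -> io_near v q e.
Proof.
move=> uv [k h]; exists k.+1 => n.
have k12 : 0 < k.+1%:R^-1 - k.+2%:R^-1 :> R.
  by rewrite subr_gt0 ltf_pV2 ?posrE// ltr_nat.
have /cvgr0_norm_lt/(_ _ k12)[N _ uvN] := uv.
have [m nm um] := h (maxn n N); exists m.
  by rewrite (leq_trans _ nm)// leq_maxl.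
have := uvN m; rewrite /= (leq_trans (leq_maxr _ _) nm) => /(_ isT) vm.
have := ler_distD (u m) (v m) q; rewrite [`|v m - u m|]distrC.
have lin (a b c i j : R) : a < e - i -> b < i - j -> c <= b + a -> c < e - j by lra.
exact: lin um vm.
Qed.

Lemma io_near_shift u q e n : io_near (fun m => u (n + m)%N) q e <-> io_near u q e.
Proof.
split=> -[k h]; exists k => m.
  have [j mj uj] := h m; exists (n + j)%N => //.
  exact: leq_trans mj (leq_addl _ _).
have [j mj uj] := h (n + m)%N; exists (j - n)%N; first lia.
by rewrite subnKC// (leq_trans (leq_addr _ _) mj).
Qed.

(** The sets that contain all late visits to the interval form a filter, which
    clusters in the interval by compactness. *)
Lemma bolzano_weierstrass_io u a b :
  (forall n, exists2 m, (n <= m)%N & a <= u m <= b) ->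
  exists p, clusters u p.
Proof.
move=> io; pose F : set_system R := [set A | exists N, forall n, (N <= n)%N ->
  a <= u n <= b -> A (u n)].
have FF : ProperFilter F.
  apply: Build_ProperFilter_ex.
    by move=> A [N AN]; have [m Nm um] := io N; exists (u m); exact: AN.
  split; first by exists 0%N.
    move=> A B [N AN] [N' BN]; exists (maxn N N') => n; rewrite geq_max => /andP[Nn N'n] un.
    by split; [exact: AN|exact: BN].
  by move=> A B AB [N AN]; exists N => n Nn un; apply/AB/AN.
have Fab : F `[a, b]%classic by exists 0%N => n _ un; rewrite /= in_itv.
have [p [_ Fp]] := @segment_compact R a b F FF Fab.
exists p => m B pB; have [|x [[n [mn un]] Bx]] := Fp [set x | exists n, (m <= n)%N /\ u n = x] B _ pB.
  by exists m => n mn _; exists n.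
by exists x; split => //; exists n.
Qed.

End AccumulationPoints.

Section ZeroOne.
Context {d : measure_display} {T : measurableType d} {R : realType}.
Variables (P : probability T R) (X : nat -> T -> R * R).
Hypothesis mX : forall k, measurable_fun setT (X k).
Hypothesis iX : iid P X.
Local Notation Omega := (seq_space (R * R)%type).
Local Notation z w := ((X ^~ w) : Omega).
Local Open Scope ereal_scope.

Lemma prob_ae_eq (A B : set T) : measurable A -> measurable B ->
  {ae P, forall w, A w <-> B w} -> P A = P B.
Proof.
move=> mA mB AB; rewrite -[A]setIT -[B]setIT -!integral_indic//.
apply: ae_eq_integral => //; [exact/measurable_EFinP/measurable_indic..|].
apply: filterS AB => w [AB BA] _ /=; rewrite !indicE; congr ((nat_of_bool _)%:R%:E).
by apply/idP/idP; rewrite !inE.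
Qed.

(** Kolmogorov's zero-one law, for an event that is not affected by the deletion
    of finitely many terms. *)
Lemma zero_one (A : set Omega) : measurable A ->
  {ae P, forall w, forall n, A (z w) <-> A (shift n (z w))} ->
  P [set w | A (z w)] = 0 \/ P [set w | A (z w)] = 1.
Proof.
move=> mA tailA; have mAz := measurable_sequence_event mX mA.
pose mfX := isMeasurableFun.Build _ _ _ _ _ (measurable_sequence mX).
pose fX : {mfun T >-> Omega} := HB.pack (fun w => z w) mfX.
have p0 : (0 <= fine (P [set w | A (z w)]))%R by exact: fine_ge0.
pose p := NngNum p0.
have pE : P [set w | A (z w)] = (p%:num)%:E by rewrite /= fineK// fin_num_measure.
have H : mrestr (distribution P fX) mA A = mscale p (distribution P fX) A.
  apply: (@eq_law_seq _ _ _ (mrestr (distribution P fX) mA) (mscale p (distribution P fX))) => //.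
    apply: (@le_lt_trans _ _ 1); last exact: ltry.
    apply: (@probability_le1 _ _ _ (distribution P fX) (setT `&` A)).
    exact: measurableI.
  move=> m B mB; have mC := measurable_cylinder m mB.
  transitivity (P [set w | cylinder m B (z w)] * P [set w | A (z w)]); last first.
    by rewrite pE muleC.
  have mS : measurable (shift m @^-1` A : set Omega).
    by rewrite -[X in measurable X]setTI; exact: measurable_shift.
  rewrite -(prob_past_future (n := m) mX iX mC mA).
    rewrite -[LHS]/(P [set w | (cylinder m B `&` A) (z w)]); apply: prob_ae_eq.
    - by apply: (measurable_sequence_event mX); exact: measurableI.
    - by apply: (measurable_sequence_event mX (C := cylinder m B `&` shift m @^-1` A)); exact: measurableI.
    - by apply: filterS tailA => w /(_ m)[h1 h2]; split => -[Bw /= Aw]; split; auto.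
  by move=> s t; split => h j jm; have := h j jm; rewrite /splice jm.
have {H} : P [set w | A (z w)] = (p%:num)%:E * P [set w | A (z w)].
  by move: H; rewrite /mrestr setIid.
rewrite pE /= -EFinM => -[]; move: (fine _) => x h.
have /eqP : (x * (1 - x) = 0)%R by rewrite mulrBr mulr1 -h subrr.
by rewrite mulf_eq0 subr_eq0 => /orP[/eqP->|/eqP<-]; [left|right].
Qed.

End ZeroOne.

(** * The attractor *)

Section Attractor.
Context {d : measure_display} {T : measurableType d} {R : realType}.
Variables (P : probability T R) (X : nat -> T -> R * R).
Hypothesis mX : forall k, measurable_fun setT (X k).
Hypothesis iX : iid P X.
Hypothesis X_ge0 : forall w, nneg (X ^~ w).
Hypothesis prodM_cvg0 : {ae P, forall w, (prodM (X ^~ w) n @[n --> \oo] --> 0)}.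
Hypothesis M_gt0 : {ae P, forall w, forall k, 0 < (X k w).1}.
Local Notation Omega := (seq_space (R * R)%type).
Local Notation z w := ((X ^~ w) : Omega).
Implicit Types s : nat -> R * R.

Definition contracting s := (forall k, 0 < (s k).1) /\
  (prodM s n @[n --> \oo] --> 0).

Lemma contracting_shift n s : contracting s -> contracting (shift n s).
Proof.
move=> [s0 cs]; split; first by move=> k; exact: s0.
have p0 : prodM s n != 0.
  by elim: n => [|n IH] /=; rewrite ?oner_eq0// mulf_neq0// gt_eqF.
have -> : prodM (shift n s) = (fun m => (prodM s n)^-1 * prodM s (m + n)%N).
  by apply/funext => m; rewrite addnC prodM_shift mulKf.
have cs' : prodM s (m + n)%N @[m --> \oo] --> 0 by rewrite cvg_shiftn.
by have := @cvgMl_tmp _ _ _ _ _ (prodM s n)^-1 _ cs'; rewrite mulr0; exact.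
Qed.

Lemma traj_sub_cvg0 s x y : contracting s ->
  (traj x s n - traj y s n @[n --> \oo] --> 0).
Proof.
move=> [_ cs]; under eq_fun do rewrite traj_sub.
by have := @cvgMr_tmp _ _ _ _ _ _ (x - y) cs; rewrite mul0r; exact.
Qed.

Lemma io_near_traj s x y q e : contracting s ->
  io_near (traj x s) q e <-> io_near (traj y s) q e.
Proof. by move=> cs; split; apply: io_near_cvg; exact: traj_sub_cvg0. Qed.

Lemma io_near_traj_shift s n q e : contracting s ->
  io_near (traj 0 s) q e <-> io_near (traj 0 (shift n s)) q e.
Proof.
move=> cs; rewrite -(io_near_shift _ q e n).
rewrite (_ : (fun m => traj 0 s (n + m)) = traj (traj 0 s n) (shift n s)).
  exact: (io_near_traj _ _ _ _ (contracting_shift n cs)).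
by apply/funext => m; rewrite traj_shift.
Qed.

Lemma ae_contracting : {ae P, forall w, contracting (z w)}.
Proof. by apply: filterS2 prodM_cvg0 M_gt0 => w ? ?; split. Qed.

Lemma measurable_io_near q e : measurable ([set s | io_near (traj 0 s) q e] : set Omega).
Proof.
rewrite (_ : [set s | _] = \bigcup_k \bigcap_n \bigcup_(m in [set m | (n <= m)%N])
    [set s | `|traj 0 s m - q| - (e - k.+1%:R^-1) < 0]).
  apply: bigcup_measurable => k _; apply: bigcap_measurableType => n _.
  apply: bigcup_measurable => m _; rewrite -[X in measurable X]setTI.
  rewrite (_ : [set s | _] = (fun s => `|traj 0 s m - q| - (e - k.+1%:R^-1)) @^-1`
    `]-oo, 0[); last by apply/seteqP; split => s /=; rewrite in_itv.
  apply: measurable_funB => //; apply: measurableT_comp => //.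
  by apply: measurable_funB => //; exact: measurable_traj2.
apply/seteqP; split=> s [k].
  by move=> h; exists k => // n _; have [m nm sm] := h n; exists m => //=; rewrite subr_lt0.
by move=> _ h; exists k => n; have [m nm sm] := h n Logic.I; exists m => //; rewrite -subr_lt0.
Qed.

(** A deterministic description of the almost sure set of accumulation points
    by countably many events, each of probability [0] or [1]. *)
Definition attractor : set R := [set p | forall q e : rat,
  `|p - ratr q| < ratr e ->
  P [set w | io_near (traj 0 (z w)) (ratr q) (ratr e)] = 1%E].

(** The shift changes the starting point, which contraction makes irrelevant. *)
Lemma io_near_zero_one q e :
  P [set w | io_near (traj 0 (z w)) q e] = 0%E \/
  P [set w | io_near (traj 0 (z w)) q e] = 1%E.
Proof.
apply: (zero_one mX iX (measurable_io_near q e)).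
apply: filterS ae_contracting => w cw n; exact: io_near_traj_shift.
Qed.

(** By the zero-one law almost every trajectory enters infinitely often
    precisely those balls which it enters infinitely often with probability [1],
    for the countably many rational balls; by contraction the exceptional event
    is the same for all starting points. *)
Lemma ae_accumulation : {ae P, forall w, contracting (z w) /\ forall x,
  [set p | clusters (traj x (z w)) p] = attractor}.
Proof.
have H : {ae P, forall w, forall n, if @unpickle (rat * rat)%type n is Some qe then
    io_near (traj 0 (z w)) (ratr qe.1) (ratr qe.2) <->
    P [set w | io_near (traj 0 (z w)) (ratr qe.1) (ratr qe.2)] = 1%E else True}.
  apply: ae_foralln => n; case: unpickle => [[q e]|]; last exact: aeW.
  have mW := measurable_sequence_event mX (measurable_io_near (ratr q) (ratr e)).
  have [p0|p1] := io_near_zero_one (ratr q) (ratr e).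
    exists [set w | io_near (traj 0 (z w)) (ratr q) (ratr e)]; split => //.
    move=> w /= h; apply: contrapT => nw; apply: h; split => // p1.
    by exfalso; move: p0; rewrite p1 => /eqP; rewrite onee_eq0.
  apply: filterS (prob1_ae mW p1) => w; by split.
apply: filterS2 ae_contracting H => w cw Hw; split => // x.
apply/seteqP; split=> p /=.
  move=> /clustersP h q e pqe; have := Hw (pickle (q, e)); rewrite pickleK /= => <-.
  by rewrite (io_near_traj 0 x _ _ cw); exact: h.
move=> h; apply/clustersP => q e pqe.
have := Hw (pickle (q, e)); rewrite pickleK /= (io_near_traj 0 x _ _ cw) => ->.
exact: h.
Qed.

Lemma attractor_witness : exists w, contracting (z w) /\ forall x,
  [set p | clusters (traj x (z w)) p] = attractor.
Proof.
apply: contrapT => /forallNP h; have [N [mN N0 hN]] := ae_accumulation.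
have : P setT = 0%E.
  by apply: (subset_measure0 measurableT mN) => // w _; apply: hN; exact: h.
by rewrite probability_setT => /eqP; rewrite onee_eq0.
Qed.

Lemma closed_attractor : closed attractor.
Proof. by have [w [_ /(_ 0) <-]] := attractor_witness; exact: closed_clusters. Qed.

Lemma attractor_ge0 p : attractor p -> 0 <= p.
Proof.
have [w [_ /(_ 0) <-]] := attractor_witness => ap.
rewrite leNgt; apply/negP => p0; have [|x [[n _ <-]]] := ap 0%N [set x | x < 0].
  by apply: open_nbhs_nbhs; split => //; exact: open_lt.
by rewrite /= ltNge traj_ge0.
Qed.

(** By the zero-one law a chain that is not transient almost surely visits some
    fixed bounded interval infinitely often, and clusters there. *)
Lemma attractor_neq0 : ~ transient P X -> attractor !=set0.
Proof.
move=> ntr; have [e pe] : exists e : nat,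
    P [set w | io_near (traj 0 (z w)) 0 e%:R] = 1%E.
  apply: contrapT => /forallNP h; apply: ntr.
  have : {ae P, forall w, forall e : nat, ~ io_near (traj 0 (z w)) 0 e%:R}.
    apply: ae_foralln => e; have [p0|//] := io_near_zero_one 0 e%:R; last first.
      by move=> /h.
    exists [set w | io_near (traj 0 (z w)) 0 e%:R]; split => //.
      exact: (measurable_sequence_event mX (measurable_io_near 0 e%:R)).
    by move=> w /=; apply: contra_notP.
  apply: filterS => w h2 r; apply: contrapT => /forallNP h3.
  apply: (h2 (Num.bound `|r|).+1); exists 0%N => n.
  have /existsNP[m /not_implyP[nm /negP]] := h3 n.
  rewrite -leNgt => mr; exists m => //; rewrite subr0 ger0_norm ?traj_ge0//.
  rewrite invr1 -natr1 addrK; apply: le_lt_trans mr _.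
  exact: le_lt_trans (ler_norm r) (archi_boundP (normr_ge0 r)).
have mW := measurable_sequence_event mX (measurable_io_near 0 e%:R).
have : {ae P, forall w, io_near (traj 0 (z w)) 0 e%:R} by exact: prob1_ae.
move=> aeio; have : {ae P, forall w, attractor !=set0}.
  apply: filterS2 ae_accumulation aeio => w [_ /(_ 0) <-] [k h].
  apply: (@bolzano_weierstrass_io _ _ (- e%:R) e%:R) => n.
  have [m nm um] := h n; exists m => //.
  rewrite subr0 in um; rewrite -ler_norml (le_trans (ltW um))// gerBl.
  by rewrite invr_ge0.
move=> [N [mN N0 hN]]; apply: contrapT => noA.
have : P setT = 0%E by apply: (subset_measure0 measurableT mN) => // w _; exact: hN.
by rewrite probability_setT => /eqP; rewrite onee_eq0.
Qed.

(** Almost surely a given point of the attractor is an accumulation point of all the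
    trajectories, which thus visit its neighbourhood for ever. *)
Lemma ae_bounded_io : attractor !=set0 -> exists2 c : R, 0 <= c &
  {ae P, forall w, forall x, forall n, exists2 m, (n <= m)%N & traj x (z w) m <= c}.
Proof.
move=> [p ap]; exists (p + 1); first by rewrite addr_ge0// attractor_ge0.
apply: filterS ae_accumulation => w [_ H] x n.
have : [set p | clusters (traj x (z w)) p] p by rewrite H.
move=> /(_ n) /= clp; have [|y [[m nm <-]]] := clp (ball p 1).
  exact: nbhsx_ballx.
rewrite /ball/= distrC => h; exists m => //.
by rewrite -lerBlDl ltW// (le_lt_trans (ler_norm _)).
Qed.

End Attractor.

(** * Escape in probability *)

Section Escape.
Context {d : measure_display} {T : measurableType d} {R : realType}.
Variables (P : probability T R) (X : nat -> T -> R * R).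
Hypothesis mX : forall k, measurable_fun setT (X k).
Hypothesis iX : iid P X.
Hypothesis X_ge0 : forall w, nneg (X ^~ w).
Hypothesis prodM_cvg0 : {ae P, forall w, (prodM (X ^~ w) n @[n --> \oo] --> 0)}.
Local Notation Omega := (seq_space (R * R)%type).
Local Notation z w := ((X ^~ w) : Omega).
Implicit Types s : nat -> R * R.

(** The product of the multipliers truncated at [1]: a monotone lower bound of
    [prodM]. *)
Fixpoint minprod s n : R :=
  if n is n'.+1 then minprod s n' * Num.min (s n').1 1 else 1.

Lemma minprod_past n s t m : (m <= n)%N -> minprod (splice n s t) m = minprod s m.
Proof.
by elim: m => //= m IH mn; rewrite IH ?(ltnW mn)// /splice mn.
Qed.

Lemma minprod_shift s n m : minprod s (n + m) = minprod s n * minprod (shift n s) m.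
Proof. by elim: m => [|m IH]; rewrite ?addn0 ?mulr1// addnS /= IH mulrA. Qed.

Lemma min1_ge0 s k : nneg s -> 0 <= Num.min (s k).1 1.
Proof. by move=> s0; rewrite le_min ler01 andbT; case: (s0 k). Qed.

Lemma minprod_ge0 s n : nneg s -> 0 <= minprod s n.
Proof. by move=> s0; elim: n => //= n IH; rewrite mulr_ge0// min1_ge0. Qed.

Lemma minprod_le1 s n : nneg s -> minprod s n <= 1.
Proof.
move=> s0; elim: n => //= n IH.
by rewrite mulr_ile1 ?minprod_ge0 ?min1_ge0// ge_min lexx orbT.
Qed.

Lemma minprod_le_prodM s n : nneg s -> minprod s n <= prodM s n.
Proof.
move=> s0; elim: n => //= n IH; rewrite ler_pM ?minprod_ge0 ?min1_ge0//.
by rewrite ge_min lexx.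
Qed.

Lemma measurable_minprod n : measurable_fun setT (fun s : Omega => minprod s n).
Proof.
elim: n => //= n IH; apply: measurable_funM => //.
by apply: measurable_minr => //; exact: measurable_coord1.
Qed.

(* truncating at the level [K] the sum of the [clog K] amounts to stopping the
   product when it falls below [expR (- K)] *)
Lemma clog_sum_minprod s K n : nneg s -> 0 <= K ->
  expR (- \sum_(0 <= k < n) clog K (s k).1) <= Num.max (minprod s n) (expR (- K)).
Proof.
move=> s0 K0; elim: n => [|n IH].
  by rewrite big_geq// oppr0 expR0 le_max lexx.
rewrite big_nat_recr//= opprD expRD {2}/clog opprK lnK; last first.
  by rewrite posrE lt_max expR_gt0 orbT.
have m0 := min1_ge0 n s0; have m1 : Num.min (s n).1 1 <= 1 by rewrite ge_min lexx orbT.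
have a0 := minprod_ge0 n s0; have a1 := minprod_le1 n s0.
have c0 := expR_gt0 (- K); have c1 : expR (- K) <= 1 by rewrite expR_le1 oppr_le0.
apply: (le_trans (ler_wpM2r _ IH)); first by rewrite le_max m0.
move: (minprod s n) (Num.min _ _) (expR (- K)) a0 a1 m0 m1 c0 c1 => a m c a0 a1 m0 m1 c0 c1.
rewrite le_max; case: (leP a c) => ac; case: (leP m c) => mc; apply/orP.
- right; nra.
- right; nra.
- right; nra.
- by left.
Qed.

Definition below (q : R) k : set Omega := [set s | 1 < q * minprod s k].

Lemma measurable_below q k : measurable (below q k).
Proof.
rewrite -[X in measurable X]setTI.
rewrite (_ : below q k = (fun s => q * minprod s k) @^-1` `]1, +oo[); last first.
  by apply/seteqP; split => s /=; rewrite in_itv/= andbT.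
by apply: measurable_funM => //; exact: measurable_minprod.
Qed.

Lemma below_past q k : depends_on_past k (below q k).
Proof. by move=> s t; rewrite /below /= minprod_past. Qed.

Lemma clog_sum_below s K q : nneg s -> (prodM s n @[n --> \oo] --> 0) -> 0 <= K ->
  q = expR K -> exists n, K <= \sum_(0 <= k < n) \1_(below q k) s * clog K (s k).1.
Proof.
move=> s0 cs K0 qE; have q0 : 0 < q by rewrite qE expR_gt0.
have ex : exists n, q * minprod s n <= 1.
  have qi : 0 < q^-1 by rewrite invr_gt0.
  have /cvgr0_norm_lt/(_ _ qi)[N _ /(_ N (leqnn N))] := cs.
  rewrite /= ger0_norm ?prodM_ge0// => lt1; exists N.
  rewrite -ler_pdivlMl// mulr1; exact: le_trans (minprod_le_prodM N s0) (ltW lt1).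
exists (ex_minn ex); case: ex_minnP => n qn nmin.
rewrite big_nat (eq_bigr (fun k => clog K (s k).1)) => [|k /andP[_ kn]]; last first.
  rewrite indicE mem_set ?mul1r// /below /= ltNge; apply/negP => /nmin.
  by rewrite leqNgt kn.
rewrite -big_nat -lerN2 -ler_expR; apply: le_trans (clog_sum_minprod n s0 K0) _.
by rewrite ge_max lexx andbT expRN -qE -[leRHS]mulr1 ler_pdivlMl.
Qed.

Local Open Scope ereal_scope.

Lemma fin_expectation_clog K : (0 <= K)%R ->
  \int[P]_w (clog K (X 0%N w).1)%:E \is a fin_num.
Proof.
move=> K0; have E0 : 0 <= \int[P]_w (clog K (X 0%N w).1)%:E.
  by apply: integral_ge0 => w _; rewrite lee_fin clog_ge0.
rewrite ge0_fin_numE//; apply: (@le_lt_trans _ _ (\int[P]_w K%:E)).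
  apply: ge0_le_integral => //.
  - by move=> w _; rewrite lee_fin clog_ge0.
  - apply/measurable_EFinP; apply: (measurableT_comp (measurable_clog K)).
    exact: (measurableT_comp measurable_fst).
  - by move=> w _; rewrite lee_fin clog_le.
by rewrite integral_cst//= probability_setT mule1 ltry.
Qed.

(** Wald's inequality for the renewal function of the negative part of the walk. *)
Lemma renewal_lower_bound K q : (0 <= K)%R -> q = expR K ->
  K%:E <= (\sum_(k <oo) P [set w | below q k (z w)]) *
    \int[P]_w (clog K (X 0%N w).1)%:E.
Proof.
move=> K0 qE.
have mc : measurable_fun setT (fun y : R * R => clog K y.1).
  exact: (measurableT_comp (measurable_clog K) measurable_fst).
have mI k : measurable_fun setT (fun w => (\1_(below q k) (z w) * clog K (X k w).1)%:E).
  apply/measurable_EFinP; apply: measurable_funM.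
    exact: (measurable_z_comp mX (measurable_indic (measurable_below q k))).
  exact: (measurableT_comp mc).
have I0 k w : 0 <= (\1_(below q k) (z w) * clog K (X k w).1)%:E.
  by rewrite lee_fin mulr_ge0// clog_ge0.
rewrite (_ : _ * _ = \int[P]_w
    \sum_(k <oo) (\1_(below q k) (z w) * clog K (X k w).1)%:E).
  have -> : K%:E = \int[P]_w K%:E by rewrite integral_cst//= probability_setT mule1.
  apply: ae_ge0_le_integral => //.
  - by move=> w _; exact: nneseries_ge0.
  - exact: ge0_emeasurable_sum.
  apply: filterS prodM_cvg0 => w cw _.
  have [n Kn] := clog_sum_below (X_ge0 w) cw K0 qE.
  apply: le_trans (nneseries_lim_ge n _) => //.
  by rewrite sumEFin lee_fin.
rewrite integral_nneseries//.
rewrite -(fineK (fin_expectation_clog K0)) muleC -nneseriesZl//.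
apply: eq_eseriesr => k _; rewrite fineK ?fin_expectation_clog// muleC; apply/esym.
apply: (expectation_past_next mX iX (measurable_below q k) (@below_past q k) mc).
by move=> y; exact: clog_ge0.
Qed.

(** [large k] is the event that [Q_k * prodM k] exceeds [1], with the multipliers
    truncated at [1] for the sake of the last exit argument. *)
Definition large k : set Omega := [set s | 1 < (s k).2 * minprod s k]%R.

Lemma measurable_large k : measurable (large k).
Proof.
rewrite -[X in measurable X]setTI.
rewrite (_ : large k = (fun s => (s k).2 * minprod s k)%R @^-1` `]1%R, +oo[); last first.
  by apply/seteqP; split => s /=; rewrite in_itv/= andbT.
apply: measurable_funM => //; [exact: measurable_coord2|exact: measurable_minprod].
Qed.

Lemma prob_large k : P [set w | large k (z w)] =
  \int[P]_w P [set w' | below (X 0%N w).2 k (z w')].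
Proof.
have mI : measurable_fun setT (fun s : Omega => (\1_(large k) s)%:E : \bar R).
  by apply/measurable_EFinP; exact: (measurable_indic (measurable_large k)).
rewrite (prob_indic P mX (measurable_large k)).
rewrite (ge0_expectation_splice (F := fun s => (\1_(large k) s)%:E) k mX iX)//.
rewrite (fubini_tonelli (fun ww => (\1_(large k) (splice k (z ww.1) (z ww.2)))%:E))//.
- apply: eq_integral => w _; rewrite (prob_indic P mX (measurable_below _ k)).
  apply: eq_integral => w' _ /=; rewrite !indicE; congr ((nat_of_bool _)%:R%:E).
  by apply/idP/idP; rewrite !inE /large /below /= minprod_past// /splice ltnn subnn.
- apply: (measurableT_comp mI).
  rewrite (_ : (fun ww : T * T => _) = (fun st : Omega * Omega => splice k st.1 st.2 : Omega)
    \o (fun ww => (z ww.1, z ww.2)))//.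
  apply: (measurableT_comp (measurable_splice k)); apply/measurable_fun_pair.
  + by apply: (measurableT_comp (measurable_z mX)); exact: measurable_fst.
  + by apply: (measurableT_comp (measurable_z mX)); exact: measurable_snd.
Qed.

Hypothesis renewal_integral : \int[P]_(w in [set w | (1 < ln (X 0%N w).2)%R])
  ((ln (X 0%N w).2)%:E / \int[P]_w' (clog (ln (X 0%N w).2) (X 0%N w').1)%:E) = +oo.

(** Summing over [k] under the law of [Q], the renewal function is at least
    [ln q] divided by the mean of [clog (ln q)], whose mean is infinite. *)
Lemma sum_large : \sum_(k <oo) P [set w | large k (z w)] = +oo.
Proof.
have mP k : measurable_fun setT (fun w => P [set w' | below (X 0%N w).2 k (z w')]).
  under eq_fun do rewrite (prob_indic P mX (measurable_below _ k)).
  apply: (@measurable_fun_fubini_tonelli_F _ _ _ _ _ P (fun ww =>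
    (\1_(below (X 0%N ww.1).2 k) (z ww.2))%:E)) => [|ww]; last by rewrite lee_fin.
  rewrite (_ : (fun ww : T * T => _) = (fun ww =>
    (\1_([set x : R | 1 < x]%R) ((X 0%N ww.1).2 * minprod (z ww.2) k)%R)%:E)); last first.
    by apply/funext => ww; rewrite !indicE; congr ((nat_of_bool _)%:R%:E);
      apply/idP/idP; rewrite !inE.
  apply/measurable_EFinP; apply: measurableT_comp.
    apply: measurable_indic; rewrite (_ : [set x | _] = `]1%R, +oo[%classic) //.
    by apply/seteqP; split => x /=; rewrite in_itv/= andbT.
  apply: measurable_funM.
    apply: (measurableT_comp measurable_snd); apply: (measurableT_comp (mX 0%N)).
    exact: measurable_fst.
  apply: (measurableT_comp (f := fun s : Omega => minprod s k) (g := fun ww : T * T => z ww.2)).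
    exact: measurable_minprod.
  by apply: (measurableT_comp (measurable_z mX)); exact: measurable_snd.
under eq_eseriesr do rewrite prob_large.
rewrite -integral_nneseries//; apply/eqP; rewrite eq_le leey/= -renewal_integral.
set D := [set w | _].
have mlnQ : measurable_fun setT (fun w => ln (X 0%N w).2).
  apply: (measurableT_comp (measurable_ln (R := R))).
  exact: (measurableT_comp measurable_snd).
have mD : measurable D.
  rewrite -[X in measurable X]setTI.
  rewrite (_ : D = (fun w => ln (X 0%N w).2) @^-1` `]1%R, +oo[); last first.
    by apply/seteqP; split => w /=; rewrite in_itv/= andbT.
  exact: mlnQ.
rewrite integral_mkcond; set f := _ \_ _.
(* the sum over [k] is the renewal function of the truncated walk at [ln Q] *)
have fle w : f w <= \sum_(k <oo) P [set w' | below (X 0%N w).2 k (z w')].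
  rewrite /f patchE; case: ifPn => [|_]; last by apply: nneseries_ge0.
  rewrite inE /D /= => lnq; set K := ln (X 0%N w).2 in lnq *.
  have K0 : (0 <= K)%R by rewrite ltW// (lt_trans _ lnq).
  have q0 : (0 < (X 0%N w).2)%R.
    by rewrite ltNge; apply/negP => q0; move: lnq; rewrite /K ln0// ltr10.
  have qE : (X 0%N w).2 = expR K by rewrite lnK.
  have := renewal_lower_bound K0 qE.
  set N := \sum_(k <oo) _; set E := \int[P]_w' _ => KNE.
  have Efin : E \is a fin_num := fin_expectation_clog K0.
  have E0 : 0 < E.
    rewrite lt0e; apply/andP; split.
      apply: contraTneq KNE => ->; rewrite mule0 -ltNge lte_fin.
      exact: lt_trans lnq.
    by apply: integral_ge0 => w' _; rewrite lee_fin clog_ge0.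
  have fE0 : (0 < fine E)%R by rewrite fine_gt0// E0 ltey_eq Efin.
  by rewrite -(fineK Efin) inver gt_eqF// lee_pdivrMr// fineK.
have f0 w : 0 <= f w.
  rewrite /f patchE; case: ifPn => [|//]; rewrite inE /D /= => lnq.
  have K0 : (0 <= ln (X 0%N w).2)%R by rewrite ltW// (lt_trans _ lnq).
  rewrite mule_ge0 ?lee_fin// inve_ge0; apply: integral_ge0 => w' _.
  by rewrite lee_fin clog_ge0.
rewrite !ge0_integralTE//; last by move=> w; exact: nneseries_ge0.
apply: ereal_sup_le => _ [h /= hf <-]; exists h => // w.
exact: le_trans (hf w) (fle w).
Qed.

(** If with a positive probability no term were large from the index [N] on, then
    by last exit the probabilities of the large terms would have a finite sum. *)
Lemma large_io : {ae P, forall w, forall N, exists2 k, (N <= k)%N & large k (z w)}.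
Proof.
apply: ae_foralln => N.
pose B : set Omega := [set s | forall k, (N <= k)%N -> ~ large k s].
have mB : measurable B.
  rewrite (_ : B = \bigcap_(k in [set k | (N <= k)%N]) ~` large k)//.
  by apply: bigcap_measurableType => k _; apply: measurableC; exact: measurable_large.
suff PB : P [set w | B (z w)] = 0.
  exists [set w | B (z w)]; split => //; first exact: measurable_sequence_event.
  by move=> w /= h k Nk lk; apply: h; exists k.
apply/eqP; rewrite -measure_le0 leNgt; apply/negP => PB.
pose A n : set Omega := if n is k.+1 then large k else set0.
have AP n : depends_on_past n (A n).
  case: n => [|n] s t //=; rewrite /large /= minprod_past ?leqnSn//.
  by rewrite /splice ltnSn.
have mA n : measurable (A n) by case: n => [|n] //=; exact: measurable_large.
have AB s n m : nneg s -> A n s -> B (shift n s) -> (n + N.+1 <= m)%N -> ~ A m s.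
  move=> s0 _ Bs; case: m => [|m]; first by rewrite addnS.
  rewrite addnS => nm /= lm; have {}nm : (n + N <= m)%N by [].
  apply: (Bs (m - n)%N); first lia.
  have nm' : (n + (m - n))%N = m by rewrite subnKC// (leq_trans (leq_addr _ _) nm).
  rewrite /large /= /shift nm'; apply: lt_le_trans lm _.
  rewrite -{2}nm' minprod_shift ler_wpM2l//; first by case: (s0 m).
  rewrite ler_piMl ?minprod_le1//.
  exact: (minprod_ge0 (m - n) (nneg_shift n s0)).
have bound := last_exit_bound mX iX X_ge0 mA mB AP AB PB.
have : \sum_(k <oo) P [set w | large k (z w)] <=
    (N.+1%:R / fine (P [set w | B (z w)]))%:E.
  apply: lime_le; first exact: is_cvg_nneseries.
  apply: nearW => K; apply: le_trans (bound K.+1).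
  by rewrite big_nat_recl//= leeDr// measure_ge0.
by rewrite sum_large leye_eq.
Qed.

Lemma le_perpetuity s n m : nneg s -> (n <= m)%N ->
  (perpetuity s n <= perpetuity s m)%R.
Proof.
move=> s0; elim: m => [|m IH]; first by rewrite leqn0 => /eqP ->.
rewrite leq_eqVlt => /predU1P[->//|]; rewrite ltnS => /IH /le_trans; apply.
by rewrite /= lerDl mulr_ge0 ?prodM_ge0//; case: (s0 m).
Qed.

Lemma perpetuity_unbounded s : nneg s ->
  (forall N, exists2 k, (N <= k)%N & large k s) ->
  forall r : nat, exists n, (r%:R <= perpetuity s n)%R.
Proof.
move=> s0 io; elim=> [|r [n rn]]; first by exists 0%N.
have [k nk lk] := io n; exists k.+1; rewrite /= -natr1 lerD//.
  exact: le_trans rn (le_perpetuity s0 nk).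
apply: le_trans (ltW lk) _; rewrite mulrC ler_wpM2r ?minprod_le_prodM//.
by case: (s0 k).
Qed.

Lemma measurable_perpetuity n : measurable_fun setT (fun s : Omega => perpetuity s n).
Proof.
elim: n => [|n IH] /=; first exact: measurable_cst.
apply: measurable_funD => //; apply: measurable_funM; first exact: measurable_prodM.
exact: measurable_coord2.
Qed.

(** The one-dimensional laws of the chain from [0] are those of the perpetuities,
    which increase to infinity; other starting points give larger values. *)
Lemma escape_in_probability (r e : R) : (0 < e)%R -> exists n, forall x, (0 <= x)%R ->
  op P X n (lev r) x <= e%:E.
Proof.
move=> e0; pose A n : set Omega := [set s | perpetuity s n <= r]%R.
have mA n : measurable (A n).
  rewrite -[X in measurable X]setTI.
  rewrite (_ : A n = (fun s => perpetuity s n) @^-1` `]-oo, r]); last first.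
    by apply/seteqP; split => s /=; rewrite in_itv.
  exact: measurable_perpetuity.
have mAz n : measurable [set w | A n (z w)] by exact: measurable_sequence_event.
have cap0 : P (\bigcap_n [set w | A n (z w)]) = 0.
  apply/negligibleP; first exact: bigcap_measurableType.
  apply: negligibleS large_io => w /= h io.
  have [n rn] := perpetuity_unbounded (X_ge0 w) io (Num.bound `|r|).
  have := h n Logic.I; rewrite /A /= leNgt => /negP; apply.
  apply: lt_le_trans rn; apply: le_lt_trans (archi_boundP (normr_ge0 r)).
  exact: ler_norm.
have cvgA : P [set w | A n (z w)] @[n --> \oo] --> P (\bigcap_n [set w | A n (z w)]).
  apply: nonincreasing_cvg_mu => //.
  - by rewrite -ge0_fin_numE// fin_num_measure.
  - exact: bigcap_measurableType.
  - move=> n m nm; apply/subsetPset => w /= Am; apply: le_trans Am.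
    exact: le_perpetuity (X_ge0 w) nm.
rewrite cap0 in cvgA.
have [n Hn] : exists n, P [set w | A n (z w)] <= e%:E.
  have /fine_cvgP[_ /cvgr0_norm_lt/(_ _ e0)[N _ /(_ N (leqnn N))]] := cvgA.
  rewrite /= ger0_norm ?fine_ge0// => lt; exists N.
  by rewrite -(fineK (fin_num_measure P _ (mAz N))) lee_fin ltW.
exists n => x x0; apply: le_trans Hn; rewrite (op_lev P mX).
apply: (@le_trans _ _ (P [set w | (traj 0 (z w) n <= r)%R])).
  apply: le_measure; rewrite ?inE.
  - exact: (measurable_sequence_event mX (measurable_traj_le x n r)).
  - exact: (measurable_sequence_event mX (measurable_traj_le 0 n r)).
  - by move=> w /=; apply: le_trans; exact: le_traj.
rewrite -(prob_flip mX iX n (measurable_traj_le 0 n r)).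
rewrite le_eqVlt; apply/orP; left; apply/eqP; congr (P _).
by apply/seteqP; split => w; rewrite /A /= traj_flip.
Qed.

End Escape.

(** * Stieltjes measures and Helly selection *)

Section StieltjesMeasures.
Context {R : realType}.

Section Stieltjes.
Variable G : cumulative R R.

(** The Lebesgue-Stieltjes measure, on the Borel sets of [R] itself. *)
Definition stieltjes : set R -> \bar R := lebesgue_stieltjes_measure G.

Let stieltjes0 : stieltjes set0 = 0%E.
Proof. exact: (@measure0 _ _ _ (lebesgue_stieltjes_measure G)). Qed.

Let stieltjes_ge0 A : (0 <= stieltjes A)%E.
Proof. exact: (@measure_ge0 _ _ _ (lebesgue_stieltjes_measure G)). Qed.

Let stieltjes_sigma_additive : semi_sigma_additive stieltjes.
Proof.
exact: (@measure_semi_sigma_additive _ _ _ (lebesgue_stieltjes_measure G)).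
Qed.

HB.instance Definition _ := isMeasure.Build _ _ _ stieltjes
  stieltjes0 stieltjes_ge0 stieltjes_sigma_additive.

Let stieltjes_sigma_finite : sigma_finite setT stieltjes.
Proof. exact: (@sigma_finiteT _ _ _ (lebesgue_stieltjes_measure G)). Qed.

HB.instance Definition _ := @Measure_isSigmaFinite.Build _ _ _ stieltjes
  stieltjes_sigma_finite.

Lemma stieltjes_itv a b : a <= b -> stieltjes `]a, b]%classic = (G b - G a)%:E.
Proof.
move=> ab; rewrite /stieltjes /lebesgue_stieltjes_measure /measure_extension/=.
by rewrite measurable_mu_extE/= ?wlength_itv_bnd//; exact: is_ocitv.
Qed.

(** The measure is an infimum over countable covers by half-open intervals, so
    domination on these intervals is enough. *)
Lemma stieltjes_dominates (m : {measure set R -> \bar R}) :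
  (forall a b, a <= b -> (m `]a, b]%classic <= (G b - G a)%:E)%E) ->
  forall A, measurable A -> (m A <= stieltjes A)%E.
Proof.
move=> mG A mA; apply: le_ereal_inf_tmp => _ [F [mF AF] <-].
have mF' k : measurable (F k : set R) by apply: sub_sigma_algebra; exact: mF.
apply: le_trans (measure_sigma_subadditive _ mF' mA AF) _.
apply: lee_nneseries => // k _; have [[a b] _ /= <-] := mF k.
have [ab|ba] := leP a b; first by rewrite wlength_itv_bnd// mG.
by rewrite set_itv_ge ?bnd_simp -?leNgt ?(ltW ba)// measure0.
Qed.

End Stieltjes.

Lemma stieltjes_exists (G : R -> R) : nondecreasing G -> right_continuous G ->
  exists nu : {sigma_finite_measure set R -> \bar R},
    (forall a b, a <= b -> nu `]a, b]%classic = (G b - G a)%:E) /\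
    (forall m : {measure set R -> \bar R},
      (forall a b, a <= b -> (m `]a, b]%classic <= (G b - G a)%:E)%E) ->
      forall A, measurable A -> (m A <= nu A)%E).
Proof.
move=> ndG rcG; pose mixG := isCumulative.Build R _ R G ndG rcG.
pose cG : cumulative R R := HB.pack G mixG.
exists (stieltjes cG); split; first by move=> a b; exact: (stieltjes_itv cG).
by move=> m; exact: (@stieltjes_dominates cG).
Qed.

End StieltjesMeasures.

Section HellySelection.
Context {R : realType}.
Implicit Types (F : nat -> R -> R).

Lemma ultra_fmap T U (f : T -> U) (F : set_system T) :
  UltraFilter F -> UltraFilter (f @ F).
Proof.
move=> UF; have PF := @ultra_proper _ _ UF; split; first exact: fmap_proper_filter.
move=> H PH FH; apply/seteqP; split => // A HA.
have [//|nA] := in_ultra_setVsetC (f @^-1` A) UF.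
have HnA : H (~` A) by apply: FH.
by exfalso; apply: (@filter_not_empty _ H); rewrite -(setICr A); exact: filterI.
Qed.

(** Helly's selection theorem, on the rationals: limits along an ultrafilter give
    the values of [G], and a diagonal choice of indices a sequence. *)
Lemma helly_rat F (C : R -> R) : (forall n r, 0 <= F n r <= C r) ->
  exists (f : nat -> nat) (G : rat -> R), (forall k, (k <= f k)%N) /\
    forall q : rat, F (f k) (ratr q) @[k --> \oo] --> G q.
Proof.
move=> FC.
have [U [UU sU]] := ultraFilterLemma (eventually_filter : ProperFilter \oo).
have PU := @ultra_proper _ _ UU.
have H q : exists l : R, F n (ratr q) @[n --> U] --> l.
  have UF : UltraFilter (F n (ratr q) @[n --> U]) by exact: ultra_fmap.
  have := @segment_compact R 0 (C (ratr q)); rewrite compact_ultra.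
  move=> /(_ _ UF)[|l [_ Ul]]; last by exists l.
  have : U [set n | F n (ratr q) \in `[0, C (ratr q)]].
    by apply: filterE => n; rewrite /= in_itv/= FC.
  exact.
have [G HG] := choice H.
(* at stage [k] the first [k] rationals in an enumeration are approximated *)
have near_all k : exists n, (k <= n)%N /\
    forall i, (i < k)%N -> forall q, unpickle i = Some q ->
      `|G q - F n (ratr q)| < k.+1%:R^-1.
  have UA : U [set n | forall i, (i < k)%N -> forall q, unpickle i = Some q ->
      `|G q - F n (ratr q)| < k.+1%:R^-1].
    elim: {1}k => [|m IH]; first by apply: filterE => n i.
    have Um : U [set n | forall q, unpickle m = Some q ->
        `|G q - F n (ratr q)| < k.+1%:R^-1].
      case: (unpickle m : option rat) => [q|]; last by apply: filterE.
      have /cvgrPdist_lt/(_ (k.+1%:R^-1)) := HG q.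
      rewrite invr_gt0 ltr0Sn => /(_ isT) Uq.
      by apply: filterS Uq => n /= h _ [<-].
    apply: filterS2 IH Um => n IH' hm i; rewrite ltnS leq_eqVlt => /predU1P[->//|].
    exact: IH'.
  have Uk : U [set n | (k <= n)%N] by apply: sU; exists k.
  by have [n [n1 n2]] := filter_ex (filterI Uk UA); exists n.
have [f Hf] := choice near_all; exists f, G; split; first by move=> k; case: (Hf k).
move=> q; apply/cvgrPdist_lt => e e0.
have [m me] : exists m : nat, (m.+1%:R^-1 : R) < e.
  have [m] := ltr_add_invr (y := 0 : R) e0.
  by rewrite add0r; exists m.
exists (maxn m (pickle q).+1) => // k mqk.
have mk := leq_trans (leq_maxl _ _) mqk; have qk := leq_trans (leq_maxr _ _) mqk.
have [_ /(_ _ qk q (pickleK q))] := Hf k; move/lt_le_trans; apply.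
by apply: le_trans (ltW me); rewrite lef_pV2 ?posrE// ler_nat.
Qed.

(** The right-continuous function that a nondecreasing function on the
    rationals induces on the real line. *)
Definition right_limit (G : rat -> R) (r : R) : R :=
  inf [set G q | q in [set q : rat | r < ratr q]].

Section RightLimit.
Variable G : rat -> R.
Hypothesis G_nd : forall p q : rat, p <= q -> G p <= G q.
Hypothesis G_ge0 : forall q, 0 <= G q.

Let inf_spec (r : R) : has_inf [set G q | q in [set q : rat | r < ratr q]].
Proof.
split; last by exists 0 => _ [q _ <-].
have r1 : r < r + 1 by rewrite ltrDl.
by have [q] := rat_in_itvoo r1; rewrite in_itv/= => /andP[rq _]; exists (G q), q.
Qed.

Lemma right_limit_le (r : R) (q : rat) : r < ratr q -> right_limit G r <= G q.
Proof. by move=> rq; apply: ge_inf; [case: (inf_spec r)|exists q]. Qed.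

Lemma right_limit_ge (q : rat) (r : R) : ratr q <= r -> G q <= right_limit G r.
Proof.
move=> qr; apply: lb_le_inf; first by case: (inf_spec r).
move=> _ [p /= rp <-]; apply: G_nd; rewrite -(ler_rat R).
exact: ltW (le_lt_trans qr rp).
Qed.

Lemma right_limit_adherent (r e : R) : 0 < e ->
  exists2 q : rat, r < ratr q & G q < right_limit G r + e.
Proof. by move=> /inf_adherent/(_ (inf_spec r))[_ [q rq <-] qe]; exists q. Qed.

Lemma right_limit_nondecreasing : nondecreasing (right_limit G).
Proof.
move=> r t rt; apply: lb_le_inf; first by case: (inf_spec t).
by move=> _ [q /= tq <-]; apply: right_limit_le; exact: le_lt_trans tq.
Qed.

Lemma right_limit_right_continuous : right_continuous (right_limit G).
Proof.
move=> r; apply/cvgrPdist_lt => e e0.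
have [q rq qe] := right_limit_adherent r e0.
near=> t.
have rt : r < t by near: t; exact: nbhs_right_gt.
have tq : t < ratr q by near: t; exact: nbhs_right_lt.
have h1 := right_limit_nondecreasing (ltW rt).
have h2 := right_limit_le tq.
by rewrite ler0_norm ?subr_le0// opprB; lra.
Unshelve. all: by end_near. Qed.

End RightLimit.

End HellySelection.

(** * Occupation ratios *)

Section LimitInferior.
Context {R : realType}.
Local Open Scope ereal_scope.

Lemma limn_einf_ge (u : (\bar R)^nat) A N : (forall n, (N <= n)%N -> A <= u n) ->
  A <= limn_einf u.
Proof.
move=> Au; rewrite limn_einf_lim; apply: lime_ge; first exact: is_cvg_einfs.
exists N => // n /= Nn; apply: le_ereal_inf_tmp => _ [m /= nm <-].
exact/Au/(leq_trans Nn).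
Qed.

Lemma limn_einf_le (u : (\bar R)^nat) A N : (forall n, (N <= n)%N -> u n <= A) ->
  limn_einf u <= A.
Proof.
move=> uA; rewrite limn_einf_lim; apply: lime_le; first exact: is_cvg_einfs.
exists N => // n /= Nn; apply: le_trans (uA n Nn).
by apply: ereal_inf_lbound; exists n => /=.
Qed.

Lemma measurable_limn_einf d (T : measurableType d) (u : nat -> T -> \bar R) :
  (forall n, measurable_fun setT (u n)) ->
  measurable_fun setT (fun w => limn_einf (u ^~ w)).
Proof.
move=> mu; apply: (emeasurable_fun_cvg (fun n w => einfs (u ^~ w) n)).
  by move=> n; exact: measurable_fun_einfs.
by move=> w _; rewrite limn_einf_lim; exact: is_cvg_einfs.
Qed.

End LimitInferior.

Section OccupationRatios.
Context {d : measure_display} {T : measurableType d} {R : realType}.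
Variables (P : probability T R) (X : nat -> T -> R * R).
Hypothesis mX : forall k, measurable_fun setT (X k).
Hypothesis iX : iid P X.
Hypothesis X_ge0 : forall w, nneg (X ^~ w).
Variable c : R.
Hypothesis c_ge0 : 0 <= c.
Hypothesis bounded_io : {ae P, forall w, forall x, forall n,
  exists2 m, (n <= m)%N & traj x (X ^~ w) m <= c}.
Local Notation Omega := (seq_space (R * R)%type).
Local Notation z w := ((X ^~ w) : Omega).
Local Notation op := (op P X).

Section Potential.
Local Open Scope ereal_scope.

(** Borel-Cantelli: a finite expected number of visits would make the visits
    to [[0, c]] stop almost surely. *)
Lemma potential_infinite x : \sum_(k <oo) op k (lev c) x = +oo.
Proof.
pose A n := [set w | (traj x (z w) n <= c)%R].
have mA n : measurable (A n).
  exact: (measurable_sequence_event mX (measurable_traj_le x n c)).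
under eq_eseriesr do rewrite (op_lev P mX).
apply/eqP; rewrite -leye_eq leNgt; apply/negP => /(lim_sup_set_cvg0 mA) L0.
have L1 : P (lim_sup_set A) = 1.
  apply: ae_prob1.
    apply: bigcap_measurableType => n _; apply: bigcup_measurable => k _; exact: mA.
  apply: filterS bounded_io => w h n _.
  by have [m nm hm] := h x n; exists m.
by have /eqP := etrans (esym L0) L1; rewrite eq_sym onee_eq0.
Qed.

Lemma potential_unbounded x (A : R) : exists n,
  A%:E <= \sum_(0 <= k < n) op k (lev c) x.
Proof.
apply: contrapT => /forallNP h; have := potential_infinite x.
apply/eqP; rewrite lt_eqF//; apply: (@le_lt_trans _ _ A%:E); last exact: ltry.
apply: lime_le.
  by apply: is_cvg_nneseries => k _ _; apply: op_ge0; exact: lev_ge0.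
by apply: nearW => n; rewrite ltW// ltNge; exact/negP/h.
Qed.

Lemma hit_pos x : exists m, 0 < op m (lev c) x.
Proof.
apply: contrapT => /forallNP h; have [n] := potential_unbounded x 1.
rewrite big1 ?lee_fin ?ler10// => k _; apply/eqP.
rewrite eq_le (op_ge0 _ _ _ (@lev_ge0 R c)) andbT leNgt; exact/negP/h.
Qed.

End Potential.

Definition prob_le k r : R := fine (P [set w | traj 0 (z w) k <= r]).

Lemma prob_leE k r : (prob_le k r)%:E = op k (lev r) 0.
Proof.
rewrite (op_lev P mX) fineK// fin_num_measure//.
exact: (measurable_sequence_event mX (measurable_traj_le 0 k r)).
Qed.

Lemma prob_le_ge0 k r : 0 <= prob_le k r.
Proof. by rewrite fine_ge0. Qed.

Lemma prob_le_le1 k r : prob_le k r <= 1.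
Proof.
rewrite -lee_fin prob_leE (op_lev P mX) probability_le1//.
exact: (measurable_sequence_event mX (measurable_traj_le 0 k r)).
Qed.

Lemma prob_le_nd k r t : r <= t -> prob_le k r <= prob_le k t.
Proof.
move=> rt; rewrite -lee_fin !prob_leE; apply: le_op => //.
- exact: measurable_lev.
- exact: lev_ge0.
- exact: measurable_lev.
- move=> y _; rewrite !levE lee_fin; case: (leP y r) => [yr|_]; last by rewrite ler_nat.
  by rewrite (le_trans yr rt).
Qed.

Lemma prob_le_lt0 k r : r < 0 -> prob_le k r = 0.
Proof.
move=> r0; rewrite /prob_le (_ : [set w | _] = set0) ?measure0//.
apply/seteqP; split => // w /= h; have := le_lt_trans h r0.
by rewrite ltNge traj_ge0.
Qed.

Lemma prob_le0 r : 0 <= r -> prob_le 0 r = 1.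
Proof.
move=> r0; rewrite /prob_le (_ : [set w | _] = setT) ?probability_setT//.
by apply/seteqP; split.
Qed.

Definition occupation n r : R := \sum_(0 <= k < n.+1) prob_le k r.

(** The distribution functions of the occupation measures of the chain from [0],
    normalised at [c] so as to be locally bounded. *)
Definition ratio n r : R := occupation n r / occupation n c.

Lemma occupation_ge1 n : 1 <= occupation n c.
Proof.
by rewrite /occupation big_nat_recl//= prob_le0// lerDl sumr_ge0// => k _; exact: prob_le_ge0.
Qed.

Lemma occupation_gt0 n : 0 < occupation n c.
Proof. exact: lt_le_trans ltr01 (occupation_ge1 n). Qed.

Lemma occupation_ge0 n r : 0 <= occupation n r.
Proof. by apply: sumr_ge0 => k _; exact: prob_le_ge0. Qed.

Lemma occupation_unbounded A : exists N, forall n, (N <= n)%N -> A <= occupation n c.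
Proof.
have [N HN] := potential_unbounded 0 A; exists N => n Nn.
rewrite -lee_fin; apply: (le_trans HN).
under eq_bigr do rewrite -prob_leE; rewrite sumEFin lee_fin /occupation.
rewrite [leRHS](@big_cat_nat _ _ _ N)//=; last exact: leqW.
by rewrite lerDl sumr_ge0// => k _; exact: prob_le_ge0.
Qed.

Lemma ratio_ge0 n r : 0 <= ratio n r.
Proof. by rewrite divr_ge0 ?occupation_ge0// ltW ?occupation_gt0. Qed.

Lemma ratio_nd n r t : r <= t -> ratio n r <= ratio n t.
Proof.
move=> rt; rewrite ler_wpM2r ?invr_ge0 ?(ltW (occupation_gt0 n))//.
by apply: ler_sum => k _; exact: prob_le_nd.
Qed.

Lemma ratio_ge1 n r : c <= r -> 1 <= ratio n r.
Proof.
by move=> /(ratio_nd n); rewrite {1}/ratio divff// gt_eqF// occupation_gt0.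
Qed.

Lemma ratio_lt0 n r : r < 0 -> ratio n r = 0.
Proof. by move=> r0; rewrite /ratio /occupation big1 ?mul0r// => k _; exact: prob_le_lt0. Qed.

(** The interval [[0, c]] can be reached from [[0, r]] in a fixed number of
    steps with a positive probability, which is least from [r]. *)
Lemma ratio_bounded r : exists C, forall n, ratio n r <= C.
Proof.
wlog r0 : r / 0 <= r.
  move=> H; have [C HC] := H (Num.max r 0) ltac:(by rewrite le_max lexx orbT).
  by exists C => n; apply: le_trans (HC n); rewrite ratio_nd// le_max lexx.
have [m hm] := hit_pos r; set D := op m (lev c) r in hm.
have Dfin : D \is a fin_num.
  rewrite /D (op_lev P mX) fin_num_measure//.
  exact: (measurable_sequence_event mX (measurable_traj_le r m c)).
pose e := fine D; have e0 : 0 < e by rewrite -lte_fin fineK.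
have step k : e * prob_le k r <= prob_le (k + m) c.
  rewrite -lee_fin EFinM fineK// !prob_leE (opD mX iX)//; last 2 first.
  - exact: measurable_lev.
  - exact: lev_ge0.
  rewrite -[D]fineK// -op_scale//; last 3 first.
  - exact: ltW.
  - exact: measurable_lev.
  - exact: lev_ge0.
  apply: le_op => //.
  - by apply: measurable_funeM; exact: measurable_lev.
  - by move=> y; rewrite mule_ge0 ?lev_ge0// lee_fin ltW.
  - by apply: measurable_op => //; [exact: measurable_lev|exact: lev_ge0].
  - move=> y y0; rewrite levE; have [yr|_] := leP y r; last first.
      by rewrite mule0; apply: op_ge0; exact: lev_ge0.
    rewrite mule1 fineK// /D !(op_lev P mX); apply: le_measure; rewrite ?inE.
    + exact: (measurable_sequence_event mX (measurable_traj_le r m c)).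
    + exact: (measurable_sequence_event mX (measurable_traj_le y m c)).
    + by move=> w /=; apply: le_trans; exact: le_traj.
exists ((1 + m%:R) / e) => n.
rewrite /ratio ler_pdivrMr ?occupation_gt0// mulrAC ler_pdivlMr//.
have h1 : occupation n r * e <= occupation n c + m%:R.
  rewrite mulrC /occupation mulr_sumr.
  apply: (@le_trans _ _ (\sum_(0 <= k < n.+1) prob_le (k + m) c)).
    by apply: ler_sum => k _; exact: step.
  rewrite -[X in X <= _]add0r.
  have -> : \sum_(0 <= k < n.+1) prob_le (k + m) c = \sum_(m <= k < n.+1 + m) prob_le k c.
    by rewrite -{2}(add0n m) big_addn addnK.
  apply: (@le_trans _ _ (\sum_(0 <= k < n.+1 + m) prob_le k c)).
    rewrite add0r [leRHS](@big_cat_nat _ _ _ m)//= ?leq_addl// lerDr.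
    by apply: sumr_ge0 => k _; exact: prob_le_ge0.
  rewrite (@big_cat_nat _ _ _ n.+1)//= ?leq_addr// lerD2l.
  rewrite -[leRHS]mulr1 mulr_natl -{2}(addKn n.+1 m) -sumr_const_nat.
  by apply: ler_sum => k _; exact: prob_le_le1.
apply: le_trans h1 _; rewrite mulrDl mul1r lerD2l ler_peMr//.
exact: occupation_ge1.
Qed.

End OccupationRatios.

(** * Excessive limits of the occupation measures *)

Section ExcessiveLimit.
Context {d : measure_display} {T : measurableType d} {R : realType}.
Variables (P : probability T R) (X : nat -> T -> R * R).
Hypothesis mX : forall k, measurable_fun setT (X k).
Hypothesis iX : iid P X.
Hypothesis X_ge0 : forall w, nneg (X ^~ w).
Hypothesis M_gt0 : {ae P, forall w, forall k, 0 < (X k w).1}.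
Variable c : R.
Hypothesis c_ge0 : 0 <= c.
Hypothesis bounded_io : {ae P, forall w, forall x, forall n,
  exists2 m, (n <= m)%N & traj x (X ^~ w) m <= c}.
Local Notation Omega := (seq_space (R * R)%type).
Local Notation z w := ((X ^~ w) : Omega).
Local Notation op := (op P X).
Local Notation prob_le := (prob_le P X).
Local Notation ratio := (ratio P X c).
Local Notation occupation := (occupation P X).

(** The preimage of [p] under [x |-> y.1 * x + y.2], that is [(p - y.2) / y.1];
    the exponential makes the measurability of the inverse immediate. *)
Definition preimage_affine (p : R) (y : R * R) : R := (p - y.2) * expR (- ln y.1).

Lemma affine_le p y x : 0 < y.1 -> (y.1 * x + y.2 <= p) = (x <= preimage_affine p y).
Proof.
move=> y0; rewrite /preimage_affine expRN lnK ?posrE//.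
by rewrite ler_pdivlMr// -lerBrDr mulrC.
Qed.

Lemma preimage_affine_le p q y : p <= q -> preimage_affine p y <= preimage_affine q y.
Proof. by move=> pq; rewrite ler_wpM2r ?expR_ge0// lerB. Qed.

Lemma preimage_affine_lt p q y : p < q -> preimage_affine p y < preimage_affine q y.
Proof. by move=> pq; rewrite ltr_pM2r ?expR_gt0// ltrD2r. Qed.

Lemma measurable_preimage_affine p : measurable_fun setT (preimage_affine p).
Proof.
apply: measurable_funM.
  by apply: measurable_funB => //; exact: measurable_snd.
apply: (measurableT_comp (f := @expR R)); first exact: measurable_expR.
apply: (measurableT_comp (f := @GRing.opp R)) => //.
by apply: (measurableT_comp (measurable_ln (R := R))); exact: measurable_fst.
Qed.

Lemma measurable_preimage_affineX p :
  measurable_fun setT (fun w => preimage_affine p (X 0%N w)).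
Proof. exact: (measurableT_comp (measurable_preimage_affine p)). Qed.

Lemma measurable_prob_le k : measurable_fun setT (prob_le k).
Proof.
by apply: nondecreasing_measurable => // r t rt; exact: prob_le_nd.
Qed.

(** Conditioning on the first [k] inputs and integrating over the last one. *)
Lemma prob_leS k q :
  (\int[P]_w (prob_le k (preimage_affine q (X 0%N w)))%:E = (prob_le k.+1 q)%:E)%E.
Proof.
apply/esym; rewrite (prob_leE P mX) {1}/op.
have mlev := measurable_lev (R := R) q.
rewrite (ge0_expectation_splice (F := fun s => lev q (traj 0 s k.+1)) k mX iX); last 2 first.
- by apply: (measurableT_comp mlev); exact: measurable_traj2.
- by move=> s; exact: lev_ge0.
pose g (ww : T * T) := lev q (traj 0 (splice k (z ww.1) (z ww.2)) k.+1).
have mg : measurable_fun setT g.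
  apply: (measurableT_comp mlev).
  rewrite (_ : (fun ww : T * T => _) = (fun s : Omega => traj 0 s k.+1) \o
    (fun st : Omega * Omega => splice k st.1 st.2 : Omega) \o (fun ww => (z ww.1, z ww.2)))//.
  apply: (measurableT_comp (f := (fun s : Omega => traj 0 s k.+1) \o
    (fun st : Omega * Omega => splice k st.1 st.2 : Omega))).
    apply: (measurableT_comp (measurable_traj2 0 k.+1)).
    exact: measurable_splice.
  apply/measurable_fun_pair.
  + by apply: (measurableT_comp (measurable_z mX)); exact: measurable_fst.
  + by apply: (measurableT_comp (measurable_z mX)); exact: measurable_snd.
have g0 ww : (0 <= g ww)%E by exact: lev_ge0.
rewrite (fubini_tonelli g)//; apply: ae_eq_integral => //.
- exact: (@measurable_fun_fubini_tonelli_G _ _ _ _ _ P g mg g0).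
- apply/measurable_EFinP; apply: (measurableT_comp (measurable_prob_le k)).
  exact: measurable_preimage_affineX.
- apply: filterS M_gt0 => w /(_ 0%N) M0 _; rewrite (prob_leE P mX).
  apply: eq_integral => w' _; rewrite /g /= traj_past// /splice ltnn subnn.
  by rewrite !levE affine_le.
Qed.

Lemma measurable_occupation n : measurable_fun setT (occupation n).
Proof.
apply: nondecreasing_measurable => // r t rt.
by apply: ler_sum => k _; exact: prob_le_nd.
Qed.

Lemma measurable_ratio n : measurable_fun setT (ratio n).
Proof. by apply: nondecreasing_measurable => // r t rt; exact: ratio_nd. Qed.

Lemma expectation_ratio n q :
  (\int[P]_w (ratio n (preimage_affine q (X 0%N w)))%:E =
   ((\sum_(0 <= k < n.+1) prob_le k.+1 q) / occupation n c)%:E)%E.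
Proof.
have o0 := occupation_gt0 P X c_ge0 n.
under eq_integral do rewrite /ratio mulrC EFinM.
rewrite ge0_integralZl//.
- rewrite mulrC EFinM; congr (_ * _)%E; rewrite -sumEFin.
  under eq_integral do rewrite /occupation -sumEFin.
  rewrite ge0_integral_sum//; last 2 first.
  + move=> k; apply/measurable_EFinP; apply: (measurableT_comp (measurable_prob_le k)).
    exact: measurable_preimage_affineX.
  + by move=> k w _; rewrite lee_fin prob_le_ge0.
  by apply: eq_bigr => k _; rewrite prob_leS.
- apply/measurable_EFinP; apply: (measurableT_comp (measurable_occupation n)).
  exact: measurable_preimage_affineX.
- by move=> w _; rewrite lee_fin occupation_ge0.
- by rewrite lee_fin invr_ge0 ltW.
Qed.

Variables (f : nat -> nat) (G : rat -> R).
Hypothesis f_ge : forall k, (k <= f k)%N.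
Hypothesis ratio_cvg : forall q : rat, ratio (f k) (ratr q) @[k --> \oo] --> G q.
Local Notation H := (right_limit G).

Lemma limit_nd p q : p <= q -> G p <= G q.
Proof.
move=> pq; rewrite -(cvg_lim _ (@ratio_cvg p))// -(cvg_lim _ (@ratio_cvg q))//.
apply: ler_lim; [by apply: cvgP (@ratio_cvg p)|by apply: cvgP (@ratio_cvg q)|].
by apply: nearW => k; apply: ratio_nd => //; rewrite ler_rat.
Qed.

Lemma limit_ge0 q : 0 <= G q.
Proof.
rewrite -(cvg_lim _ (@ratio_cvg q))//; apply: limr_ge; first by apply: cvgP (@ratio_cvg q).
by apply: nearW => k; exact: ratio_ge0.
Qed.

Lemma limit_lt0 q : ratr q < 0 :> R -> G q = 0.
Proof.
move=> q0; rewrite -(cvg_lim _ (@ratio_cvg q))//.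
by under eq_fun do rewrite ratio_lt0//; rewrite lim_cst.
Qed.

Lemma limit_ge1 q : c <= ratr q -> 1 <= G q.
Proof.
move=> q0; rewrite -(cvg_lim _ (@ratio_cvg q))//.
by apply: limr_ge; [apply: cvgP (@ratio_cvg q)|apply: nearW => k; exact: ratio_ge1].
Qed.

Lemma ratio_liminf a b e : a < b -> 0 < e -> exists N, forall k, (N <= k)%N ->
  H a - e <= ratio (f k) b.
Proof.
move=> ab e0; have [q] := rat_in_itvoo ab; rewrite in_itv/= => /andP[aq qb].
have /cvgrPdist_lt/(_ _ e0)[N _ HN] := @ratio_cvg q.
exists N => k /HN /=; rewrite ltr_norml => /andP[_ h].
have h1 := ratio_nd P mX X_ge0 c_ge0 (f k) (ltW qb).
have h2 := right_limit_le limit_ge0 aq; lra.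
Qed.

Lemma ratio_limsup a e : 0 < e -> exists N, forall k, (N <= k)%N ->
  ratio (f k) a <= H a + e.
Proof.
move=> e0; have e2 : 0 < e / 2 by rewrite divr_gt0.
have [q aq qe] := right_limit_adherent limit_ge0 a e2.
have /cvgrPdist_lt/(_ _ e2)[N _ HN] := @ratio_cvg q.
exists N => k /HN /=; rewrite ltr_norml => /andP[h _].
have h1 := ratio_nd P mX X_ge0 c_ge0 (f k) (ltW aq); lra.
Qed.

Local Open Scope ereal_scope.

(** Fatou's lemma turns the approximate invariance of the normalised occupation
    measures into an inequality for their limit. *)
Lemma limit_excessive_itv (p q : rat) (b : R) : (ratr p <= b)%R -> (b < ratr q)%R ->
  \int[P]_w (H (preimage_affine b (X 0%N w)) - H (preimage_affine (ratr p) (X 0%N w)))%:E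
  <= (G q - G p)%:E.
Proof.
move=> pb bq; have pq : (ratr p <= ratr q :> R)%R by exact: le_trans pb (ltW bq).
have ndH : nondecreasing H := right_limit_nondecreasing limit_ge0.
have mH (t : R) : measurable_fun setT (fun w => H (preimage_affine t (X 0%N w))).
  apply: (measurableT_comp (f := H)); last exact: measurable_preimage_affineX.
  by apply: nondecreasing_measurable => // r s; exact: ndH.
pose Phi k w := (ratio (f k) (preimage_affine (ratr q) (X 0%N w)) -
  ratio (f k) (preimage_affine (ratr p) (X 0%N w)))%R.
have mR k (t : R) : measurable_fun setT
    (fun w => (ratio (f k) (preimage_affine t (X 0%N w)))%:E).
  apply/measurable_EFinP; apply: (measurableT_comp (measurable_ratio (f k))).
  exact: measurable_preimage_affineX.
have mPhi k : measurable_fun setT (fun w => (Phi k w)%:E).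
  by apply/measurable_EFinP; apply: measurable_funB; apply/measurable_EFinP; exact: mR.
have Phi0 k w : 0 <= (Phi k w)%:E.
  by rewrite lee_fin subr_ge0 ratio_nd// preimage_affine_le.
apply: (@le_trans _ _ (\int[P]_w limn_einf (fun k => (Phi k w)%:E))).
  apply: ge0_le_integral => //.
  - move=> w _; rewrite lee_fin subr_ge0.
    by apply: ndH; exact: preimage_affine_le.
  - by apply/measurable_EFinP; apply: measurable_funB; exact: mH.
  - exact: (measurable_limn_einf mPhi).
  - move=> w _; apply/lee_addgt0Pr => e e0; have e2 : (0 < e / 2)%R by rewrite divr_gt0.
    have [N1 H1] := ratio_liminf (preimage_affine_lt (X 0%N w) bq) e2.
    have [N2 H2] := ratio_limsup (preimage_affine (ratr p) (X 0%N w)) e2.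
    rewrite -leeBlDr//; apply: (@limn_einf_ge _ _ _ (maxn N1 N2)) => k Nk.
    have := H1 k (leq_trans (leq_maxl _ _) Nk); have := H2 k (leq_trans (leq_maxr _ _) Nk).
    by rewrite -EFinB lee_fin /Phi; lra.
apply: le_trans (fatou P measurableT mPhi (fun k w _ => Phi0 k w)) _.
apply/lee_addgt0Pr => e e0; have e3 : (0 < e / 3)%R by rewrite divr_gt0.
have /cvgrPdist_lt/(_ _ e3)[N1 _ H1] := @ratio_cvg q.
have /cvgrPdist_lt/(_ _ e3)[N2 _ H2] := @ratio_cvg p.
have [N3 H3] := occupation_unbounded mX bounded_io ((e / 3)^-1)%R.
apply: (@limn_einf_le _ _ _ (maxn (maxn N1 N2) N3)) => k Nk.
have {}H1 := H1 k (leq_trans (leq_trans (leq_maxl _ _) (leq_maxl _ _)) Nk).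
have {}H2 := H2 k (leq_trans (leq_trans (leq_maxr _ _) (leq_maxl _ _)) Nk).
have {}H3 := H3 (f k) (leq_trans (leq_trans (leq_maxr _ _) Nk) (f_ge k)).
have o0 := occupation_gt0 P X c_ge0 (f k).
have IPhi : \int[P]_w (Phi k w)%:E =
    ((\sum_(0 <= j < (f k).+1) prob_le j.+1 (ratr q)) / occupation (f k) c -
     (\sum_(0 <= j < (f k).+1) prob_le j.+1 (ratr p)) / occupation (f k) c)%:E.
  set vq := (_ / _)%R; set vp := (_ / _)%R.
  have : \int[P]_w (Phi k w)%:E + vp%:E = vq%:E.
    rewrite /vp /vq -!expectation_ratio -ge0_integralD//.
      by apply: eq_integral => w _; rewrite -EFinD /Phi subrK.
    by move=> w _; rewrite lee_fin; exact: ratio_ge0.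
  by case: (\int[P]_w _) => [r||]//; rewrite -EFinD => -[<-]; rewrite addrK.
rewrite IPhi lee_fin.
(* shifting time by one changes the occupation by at most two terms *)
have shift_sum t : (\sum_(0 <= j < (f k).+1) prob_le j.+1 t =
    occupation (f k) t + prob_le (f k).+1 t - prob_le 0 t)%R.
  apply/eqP; rewrite eq_sym subr_eq /occupation; apply/eqP.
  by rewrite -(big_nat_recr (f k).+1 0 (fun j => prob_le j t))//= big_nat_recl// addrC.
have b1 := prob_le_le1 P mX (f k).+1 (ratr q).
have b2 := prob_le_ge0 P X (f k).+1 (ratr p).
have b3 := prob_le_nd P mX X_ge0 0 pq.
rewrite -mulrBl !shift_sum.
have : ((occupation (f k) (ratr q) + prob_le (f k).+1 (ratr q) - prob_le 0 (ratr q) -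
   (occupation (f k) (ratr p) + prob_le (f k).+1 (ratr p) - prob_le 0 (ratr p))) /
    occupation (f k) c <= ratio (f k) (ratr q) - ratio (f k) (ratr p) + e / 3)%R.
  rewrite /ratio -mulrBl ler_pdivrMr// mulrDl divfK ?gt_eqF//.
  have : (1 <= e / 3 * occupation (f k) c)%R by rewrite -ler_pdivrMl// mulr1.
  lra.
move/le_trans; apply.
move: H1 H2; rewrite /= !ltr_norml => /andP[h1 _] /andP[_ h2]; lra.
Qed.

End ExcessiveLimit.

(** * Excessive measures are invariant *)

Section InvariantIntegral.
Context {d : measure_display} {T : measurableType d} {R : realType}.
Variables (P : probability T R) (X : nat -> T -> R * R).
Hypothesis mX : forall k, measurable_fun setT (X k).
Hypothesis iX : iid P X.
Hypothesis X_ge0 : forall w, nneg (X ^~ w).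
Variable nu : {sigma_finite_measure set R -> \bar R}.
Local Notation Omega := (seq_space (R * R)%type).
Local Notation z w := ((X ^~ w) : Omega).
Local Notation op := (op P X).
Local Open Scope ereal_scope.

Lemma measurable_step : measurable_fun setT (fun xw : R * T => traj xw.1 (z xw.2) 1).
Proof.
rewrite (_ : (fun xw : R * T => _) = (fun xs : R * Omega => traj xs.1 xs.2 1%N) \o
  (fun xw => (xw.1, z xw.2)))//.
apply: (measurableT_comp (measurable_traj 1)).
apply/measurable_fun_pair; first exact: measurable_fst.
by apply: (measurableT_comp (measurable_z mX)); exact: measurable_snd.
Qed.

(** The law after one step of the chain whose initial law is [nu]. *)
Lemma step_law_exists : exists mu : {measure set R -> \bar R},
  forall f, measurable_fun setT f -> (forall x, 0 <= f x) ->
    \int[mu]_x f x = \int[nu]_x op 1 f x.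
Proof.
unshelve refine (ex_intro _ (pushforward (nu \x P)
  (fun xw : R * T => traj xw.1 (z xw.2) 1) : {measure set R -> \bar R}) _).
  exact: measurable_step.
move=> f mf f0; rewrite (ge0_integral_pushforward measurable_step)//.
rewrite preimage_setT (fubini_tonelli1 (f \o (fun xw : R * T => traj xw.1 (z xw.2) 1)))//.
  by apply: (measurableT_comp mf); exact: measurable_step.
by move=> xw; exact: f0.
Qed.

Lemma invariant_integral f :
  (forall A, measurable A -> nu A = \int[nu]_x op 1 (EFin \o \1_A) x) ->
  measurable_fun setT f -> (forall x, 0 <= f x) ->
  \int[nu]_x op 1 f x = \int[nu]_x f x.
Proof.
move=> inv mf f0; have [mu Hmu] := step_law_exists; rewrite -Hmu//.
apply: eq_measure_integral => A mA _.
apply: (etrans _ (esym (inv A mA))).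
rewrite -Hmu//; first by rewrite integral_indic// setIT.
- exact/measurable_EFinP/measurable_indic.
- by move=> x; rewrite lee_fin.
Qed.

End InvariantIntegral.

Section ExistenceOfInvariantMeasure.
Context {d : measure_display} {T : measurableType d} {R : realType}.
Variables (P : probability T R) (X : nat -> T -> R * R).
Hypothesis mX : forall k, measurable_fun setT (X k).
Hypothesis iX : iid P X.
Hypothesis X_ge0 : forall w, nneg (X ^~ w).
Variable c : R.
Hypothesis bounded_io : {ae P, forall w, forall x, forall n,
  exists2 m, (n <= m)%N & traj x (X ^~ w) m <= c}.
Local Notation Omega := (seq_space (R * R)%type).
Local Notation z w := ((X ^~ w) : Omega).
Local Notation op := (op P X).
Local Open Scope ereal_scope.

(** A measure that dominates its image under one step of the chain, and is
    finite on half-lines, is invariant: the Green potential of [[0, c]] being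
    infinite, the mass lost in one step vanishes. *)
Lemma excessive_invariant (nu : {sigma_finite_measure set R -> \bar R}) :
  (forall b, nu `]-oo, b]%classic < +oo) ->
  (forall f, measurable_fun setT f -> (forall x, 0 <= f x) ->
    \int[nu]_x op 1 f x <= \int[nu]_x f x) ->
  forall A, measurable A -> nu A = \int[nu]_x op 1 (EFin \o \1_A) x.
Proof.
move=> nu_fin exc.
have [mu Hmu] := step_law_exists P mX nu.
have muE A : measurable A -> mu A = \int[nu]_x op 1 (EFin \o \1_A) x.
  move=> mA; rewrite -Hmu//; first by rewrite integral_indic// setIT.
  - exact/measurable_EFinP/measurable_indic.
  - by move=> x; rewrite lee_fin.
have le_mu A : measurable A -> mu A <= nu A.
  move=> mA; have := exc (EFin \o \1_A); rewrite integral_indic// setIT -muE//; apply.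
  - exact/measurable_EFinP/measurable_indic.
  - by move=> x; rewrite lee_fin.
suff H (A : set R) (b : R) : measurable A -> A `<=` `]-oo, b]%classic -> nu A = mu A.
  move=> A mA; rewrite -muE//.
  have UA : A = \bigcup_n (A `&` `]-oo, n%:R]%classic).
    rewrite -setI_bigcupr; apply/esym/setIidl => x _.
    exists (Num.bound `|x|) => //=; rewrite in_itv/=.
    exact: le_trans (ler_norm x) (ltW (archi_boundP (normr_ge0 x))).
  have mAn n : measurable (A `&` `]-oo, n%:R]%classic : set R) by exact: measurableI.
  have ndA : nondecreasing_seq (fun n => A `&` `]-oo, n%:R]%classic : set R).
    move=> m n mn; apply/subsetPset => x [Ax] /=; rewrite in_itv/= => xm; split => //=.
    by rewrite in_itv/= (le_trans xm)// ler_nat.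
  have mU : measurable (\bigcup_n (A `&` `]-oo, n%:R]%classic : set R)).
    exact: bigcup_measurable.
  rewrite UA; apply: (@cvg_unique _ (@ereal_hausdorff R) _ _ _ _
    (nondecreasing_cvg_mu mAn mU ndA)).
  apply: cvg_trans (nondecreasing_cvg_mu mAn mU ndA).
  rewrite (_ : nu \o _ = mu \o (fun n => A `&` `]-oo, n%:R]%classic))//.
  by apply/funext => n /=; apply: (H _ n%:R) => // x [].
move=> mA Ab; apply/eqP; rewrite eq_le le_mu// andbT.
have mlev := measurable_lev (R := R) c; have lev0 := @lev_ge0 R c.
have mop k : measurable_fun setT (op k (lev c)) by exact: (measurable_op P mX).
have opl0 k x : 0 <= op k (lev c) x by exact: op_ge0.
(* on [A] the potential up to time [n] is at least its value at [b], which is unbounded *)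
pose f n x := \sum_(0 <= k < n) op k (lev c) x.
have mf n : measurable_fun setT (f n) by exact: emeasurable_sum.
have f0 n x : 0 <= f n x by exact: sume_ge0.
have opl1 k x : op k (lev c) x <= 1.
  rewrite (op_lev P mX) probability_le1//.
  exact: (measurable_sequence_event mX (measurable_traj_le x k c)).
have opfin k x : op k (lev c) x \is a fin_num.
  by rewrite ge0_fin_numE// (le_lt_trans (opl1 k x))// ltry.
have ffin n x : f n x \is a fin_num by apply/sum_fin_numP => k _ _; exact: opfin.
have nulev : \int[nu]_x lev c x < +oo.
  rewrite /lev integral_indic//; last first.
    by rewrite (_ : [set y | _] = `]-oo, c]%classic)//; apply/seteqP.
  by rewrite setIT; apply: le_lt_trans (nu_fin c); rewrite le_eqVlt; apply/orP; left; apply/eqP.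
have nuop k : \int[nu]_x op k (lev c) x <= \int[nu]_x lev c x.
  elim: k => [|k IH]; first by rewrite (op0 P).
  apply: le_trans IH; rewrite -(add1n k) (opD mX iX)//; exact: exc.
have nuf n : \int[nu]_x f n x < +oo.
  rewrite ge0_integral_sum//; apply: lte_sum_pinfty => k _.
  exact: le_lt_trans (nuop k) nulev.
have f_next n x : f n x <= lev c x + op 1 (f n) x.
  rewrite (op_sum P mX)// /f; case: n => [|n]; first by rewrite !big_nil adde0.
  rewrite big_nat_recl// big_nat_recr//= (op0 P) leeD2l//.
  rewrite -[leLHS]adde0; apply: leeD; last exact: op_ge0.
  by apply: lee_sum => k _; rewrite -(add1n k) (opD mX iX).
have key n : f n b * nu A <= \int[nu]_x lev c x + f n b * mu A.
  pose h x := f n x - f n b * (\1_A x)%:E.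
  have S0 : (0 <= fine (f n b))%R by exact: fine_ge0.
  have mI : measurable_fun setT (EFin \o \1_A : R -> \bar R).
    exact/measurable_EFinP/measurable_indic.
  have mSI : measurable_fun setT (fun x => (fine (f n b))%:E * (\1_A x)%:E).
    exact: measurable_funeM.
  have fb : f n b = (fine (f n b))%:E by rewrite fineK.
  have mh : measurable_fun setT h.
    by apply: emeasurable_funB => //; rewrite fb.
  have h0 x : 0 <= h x.
    rewrite /h indicE; case: (boolP (x \in A)) => [|_]; last by rewrite mule0 sube0.
    rewrite inE => /Ab /=; rewrite in_itv/= => xb.
    rewrite mule1 leeBrDr// add0e; apply: lee_sum => k _; rewrite !(op_lev P mX).
    apply: le_measure; rewrite ?inE.
    + exact: (measurable_sequence_event mX (measurable_traj_le b k c)).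
    + exact: (measurable_sequence_event mX (measurable_traj_le x k c)).
    + by move=> w /=; apply: le_trans; exact: le_traj.
  have fE x : f n x = h x + (fine (f n b))%:E * (\1_A x)%:E.
    by rewrite -fb /h subeK// fin_numM// ffin.
  have opf x : op 1 (f n) x = op 1 h x + (fine (f n b))%:E * op 1 (EFin \o \1_A) x.
    rewrite -(op_scale P mX)//; last by move=> y; rewrite lee_fin.
    rewrite -(op_add P mX)//; last by move=> y; rewrite mule_ge0// lee_fin.
    by congr (op 1 _ _); apply/funext => y; rewrite fE.
  have nuE : \int[nu]_x f n x = \int[nu]_x h x + f n b * nu A.
    rewrite (eq_integral _ _ (fun x _ => fE x)) ge0_integralD//; last first.
      by move=> x _; rewrite mule_ge0// lee_fin.
    by rewrite ge0_integralZl//= integral_indic// setIT -fb.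
  have nuh : \int[nu]_x h x \is a fin_num.
    rewrite ge0_fin_numE; last exact: integral_ge0.
    apply: le_lt_trans (nuf n); apply: ge0_le_integral => // x _.
    by rewrite fE leeDl// mule_ge0// lee_fin.
  have mop1 g : measurable_fun setT g -> (forall x, 0 <= g x) ->
    measurable_fun setT (op 1 g) by exact: (measurable_op P mX).
  have opI0 x : 0 <= op 1 (EFin \o \1_A) x by apply: op_ge0 => y; rewrite lee_fin.
  have : \int[nu]_x f n x <= \int[nu]_x lev c x + \int[nu]_x op 1 (f n) x.
    rewrite -ge0_integralD//; [|by move=> x _; apply: op_ge0|exact: mop1].
    apply: ge0_le_integral => //.
    by apply: emeasurable_funD => //; exact: mop1.
  rewrite nuE (eq_integral _ _ (fun x _ => opf x)) ge0_integralD//; first last.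
  - by apply: measurable_funeM; apply: mop1 => // x; rewrite lee_fin.
  - by move=> x _; rewrite mule_ge0// lee_fin.
  - exact: mop1.
  - by move=> x _; exact: op_ge0.
  rewrite ge0_integralZl// -?muE// -?fb; last first.
    by apply: mop1 => // x; rewrite lee_fin.
  move=> /le_trans h1; have {}h1 := h1 _ (leeD2l _ (leeD2r _ (exc h mh h0))).
  by move: h1; rewrite addeCA leeD2lE.
have nuA : nu A \is a fin_num.
  rewrite ge0_fin_numE//; apply: le_lt_trans (nu_fin b).
  by apply: le_measure; rewrite ?inE.
have muA : mu A \is a fin_num.
  by rewrite ge0_fin_numE// (le_lt_trans (le_mu _ mA))// -ge0_fin_numE.
have C_fin : \int[nu]_x lev c x \is a fin_num.
  by rewrite ge0_fin_numE//; exact: integral_ge0.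
rewrite leNgt; apply/negP => lt.
have [n] := potential_unbounded mX bounded_io b
  ((fine (\int[nu]_x lev c x) + 1) / (fine (nu A) - fine (mu A)))%R.
have d0 : (0 < fine (nu A) - fine (mu A))%R by rewrite subr_gt0 -lte_fin !fineK.
have := key n; rewrite -/(f n b) -(fineK (ffin n b)) -(fineK nuA) -(fineK muA) -(fineK C_fin).
rewrite -!EFinM -!EFinD !lee_fin ler_pdivrMr//; lra.
Qed.

End ExistenceOfInvariantMeasure.

(** * Existence of an invariant measure *)

Section ExistenceOfInvariantMeasure.
Context {d : measure_display} {T : measurableType d} {R : realType}.
Variables (P : probability T R) (X : nat -> T -> R * R).
Hypothesis mX : forall k, measurable_fun setT (X k).
Hypothesis iX : iid P X.
Hypothesis X_ge0 : forall w, nneg (X ^~ w).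
Hypothesis M_gt0 : {ae P, forall w, forall k, 0 < (X k w).1}.
Variable c : R.
Hypothesis c_ge0 : 0 <= c.
Hypothesis bounded_io : {ae P, forall w, forall x, forall n,
  exists2 m, (n <= m)%N & traj x (X ^~ w) m <= c}.
Local Notation Omega := (seq_space (R * R)%type).
Local Notation z w := ((X ^~ w) : Omega).
Local Notation op := (op P X).
Local Open Scope ereal_scope.

Section Preimage.
Variables (nu : {sigma_finite_measure set R -> \bar R}) (A : set R).
Hypothesis mA : measurable A.
Let g (xw : R * T) : \bar R := (\1_A (traj xw.1 (z xw.2) 1))%:E.

Let mg : measurable_fun setT g.
Proof.
apply/measurable_EFinP; apply: (measurableT_comp (measurable_indic mA)).
exact: measurable_step.
Qed.

Let g0 xw : 0 <= g xw. Proof. by rewrite lee_fin. Qed.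

Let gE w : \int[nu]_x g (x, w) = nu [set x | A (traj x (z w) 1)].
Proof.
have mB : measurable ([set x | A (traj x (z w) 1)] : set R).
  rewrite -[X in measurable X]setTI.
  have := measurableT_comp (measurable_step mX) (pair2_measurable w).
  by apply; [exact: measurableT|].
by rewrite -[in RHS](setIT [set x | _]) -integral_indic.
Qed.

Lemma measurable_measure_preimage :
  measurable_fun setT (fun w => nu [set x | A (traj x (z w) 1)]).
Proof.
apply: eq_measurable_fun (fun w _ => gE w) _.
exact: (@measurable_fun_fubini_tonelli_G _ _ _ _ _ nu g mg g0).
Qed.

Lemma integral_indic_preimage : \int[nu]_x op 1 (EFin \o \1_A) x =
  \int[P]_w nu [set x | A (traj x (z w) 1)].
Proof.
by rewrite [LHS](fubini_tonelli g)//; apply: eq_integral => w _; exact: gE.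
Qed.

End Preimage.

(** A limit point of the normalised occupation measures of the chain from [0]:
    it dominates its image under one step on half-open intervals, hence on all
    Borel sets, and a dominating measure is invariant. The normalisation at [c]
    keeps the limit nonzero and locally finite. *)
Theorem invariant_exists : exists nu : {sigma_finite_measure set R -> \bar R},
  [/\ nu [set x | (x < 0)%R] = 0, nu setT <> 0, forall b, nu `]-oo, b]%classic < +oo &
    forall A, measurable A -> nu A = \int[nu]_x op 1 (EFin \o \1_A) x].
Proof.
have [C HC] : exists C : R -> R, forall r n, (ratio P X c n r <= C r)%R.
  by have [C HC] := choice (ratio_bounded mX iX X_ge0 c_ge0 bounded_io); exists C.
have [|f [G [f_ge ratio_cvg]]] := @helly_rat R (ratio P X c) C.
  by move=> n r; rewrite HC andbT ratio_ge0.
have Gnd := limit_nd mX X_ge0 c_ge0 ratio_cvg.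
have Gge0 := limit_ge0 ratio_cvg.
pose H := right_limit G.
have Hnd : nondecreasing H := right_limit_nondecreasing Gge0.
have Hrc : right_continuous H := right_limit_right_continuous Gge0.
have [nu [nuE nu_dom]] := stieltjes_exists Hnd Hrc.
have H_lt0 (r : R) : (r < 0)%R -> H r = 0%R.
  move=> r0; have [q] := rat_in_itvoo r0; rewrite in_itv/= => /andP[rq q0].
  apply/eqP; rewrite eq_le; apply/andP; split.
    by rewrite -(limit_lt0 X_ge0 ratio_cvg q0) right_limit_le.
  have [|p] := @rat_in_itvoo R (r - 1) r; first by rewrite ltrBlDr ltrDl.
  rewrite in_itv/= => /andP[_ pr]; apply: le_trans (Gge0 p) _.
  by apply: right_limit_ge => //; exact: ltW.
have mH : measurable_fun setT H.
  by apply: nondecreasing_measurable => // r s; exact: Hnd.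
have nu_lt0 (r : R) : (r < 0)%R -> nu `]-oo, r]%classic = 0.
  move=> r0.
  pose F n : set R := `](r - n%:R)%R, r]%classic.
  have UA : (`]-oo, r]%classic : set R) = \bigcup_n F n.
    apply/seteqP; split => x /=; rewrite in_itv/=; last first.
      by move=> [n _]; rewrite /F/= in_itv/= => /andP[].
    move=> xr; exists (Num.bound `|(r - x)%R|%R).+1 => //=; rewrite /F/= in_itv/= xr andbT.
    rewrite ltrBlDr -ltrBlDl (le_lt_trans (ler_norm _))//.
    by rewrite (lt_trans (archi_boundP (normr_ge0 _)))// ltr_nat.
  rewrite UA; apply/eqP; rewrite -measure_le0.
  have mF n : measurable (F n) by exact: measurable_itv.
  apply: le_trans (measure_sigma_subadditive nu mF (bigcup_measurable (fun n _ => mF n))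
    (@subset_refl _ _)) _.
  rewrite eseries0// => n _ _; apply: etrans (nuE _ _ _) _; first by rewrite gerBl.
  rewrite !H_lt0 ?subrr//; apply: le_lt_trans r0; by rewrite gerBl.
have nu_fin (b : R) : nu `]-oo, b]%classic < +oo.
  have b1 : (- (`|b| + 1) <= b)%R.
    by rewrite lerNl; apply: le_trans (ler_norm _) _; rewrite normrN lerDl.
  have -> : `]-oo, b]%classic = (`]-oo, (- (`|b| + 1))%R]%classic `|`
      `](- (`|b| + 1))%R, b]%classic) :> set R.
    apply/seteqP; split => x /=; rewrite !in_itv/=.
      by move=> ->; rewrite andbT; case: (leP x); [left|right].
    by move=> [xb|/andP[]//]; exact: le_trans xb b1.
  apply: le_lt_trans (measureU2 _ _ _) _ => //.
  rewrite [X in X + _](nu_lt0 (- (`|b| + 1))%R) ?oppr_lt0 ?ltr_wpDl// add0e.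
  by rewrite [X in X < _](nuE _ _ b1) ltry.
have nu_open0 : nu [set x | (x < 0)%R] = 0.
  pose F n : set R := `]-oo, (- n.+1%:R^-1)%R]%classic.
  have UA : [set x : R | (x < 0)%R] = \bigcup_n F n.
    apply/seteqP; split => x /=; last first.
      by move=> [n _]; rewrite /F/= in_itv/= => /le_lt_trans; apply; rewrite oppr_lt0 invr_gt0.
    move=> x0; have [n nx] := ltr_add_invr x0; exists n => //=.
    by rewrite /F/= in_itv/= lerNr -[leRHS]add0r lerBrDl ltW.
  rewrite UA; apply/eqP; rewrite -measure_le0.
  have mF n : measurable (F n) by exact: measurable_itv.
  apply: le_trans (measure_sigma_subadditive nu mF (bigcup_measurable (fun n _ => mF n))
    (@subset_refl _ _)) _.
  rewrite eseries0// => n _ _; apply: nu_lt0; by rewrite oppr_lt0 invr_gt0.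
exists nu; split => //.
  have [p] := @rat_in_itvoo R (-1 - 1) (-1) ltac:(by rewrite ltrBlDr ltrDl).
  have [q] := @rat_in_itvoo R c (c + 1) ltac:(by rewrite ltrDl).
  rewrite !in_itv/= => /andP[cq _] _.
  have h1 : (1 <= H (ratr q))%R.
    by apply: le_trans (limit_ge1 mX X_ge0 c_ge0 ratio_cvg (ltW cq)) _; exact: right_limit_ge.
  have : nu `](-1)%R, (ratr q)%R]%classic <= nu setT by apply: le_measure; rewrite ?inE.
  rewrite nuE; last by rewrite (le_trans _ (le_trans c_ge0 (ltW cq)))// lerN10.
  rewrite (H_lt0 (-1)%R) ?ltrN10// subr0 => h2 n0; move: h2; rewrite n0 lee_fin => h2.
  by have := le_trans h1 h2; rewrite ler10.
have [mu Hmu] := step_law_exists P mX nu.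
have muE A : measurable A -> mu A = \int[nu]_x op 1 (EFin \o \1_A) x.
  move=> mA; rewrite -Hmu//; first by rewrite integral_indic// setIT.
  - exact/measurable_EFinP/measurable_indic.
  - by move=> x; rewrite lee_fin.
have mu_rat (p : rat) (a b : R) : (a < ratr p)%R -> (ratr p <= b)%R ->
    mu `](ratr p)%R, b]%classic <= (H b - H a)%:E.
  move=> ap pb; apply/lee_addgt0Pr => e e0.
  have [q bq qe] := right_limit_adherent Gge0 b e0.
  apply: (@le_trans _ _ (G q - G p)%:E); last first.
    rewrite -EFinD lee_fin; have := right_limit_le Gge0 ap; rewrite -/(H a).
    by rewrite -/(H b) in qe; lra.
  rewrite muE// integral_indic_preimage//.
  apply: le_trans (limit_excessive_itv mX iX X_ge0 M_gt0 c_ge0 bounded_io f_ge ratio_cvg pb bq).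
  rewrite le_eqVlt; apply/orP; left; apply/eqP; apply: ae_eq_integral => //.
  - exact: measurable_measure_preimage.
  - apply/measurable_EFinP; apply: measurable_funB; apply: measurableT_comp (mH) _;
      exact: measurable_preimage_affineX.
  - apply: filterS M_gt0 => w /(_ 0%N) M0 _.
    rewrite -nuE; last exact: preimage_affine_le.
    congr (nu _); apply/seteqP; split => x /=; rewrite !in_itv/=;
      by rewrite !ltNge !affine_le.
have mu_itv (a b : R) : (a <= b)%R -> mu `]a, b]%classic <= (H b - H a)%:E.
  rewrite le_eqVlt => /predU1P[->|ab].
    by rewrite set_itvoc0 measure0 subrr.
  pose u n : R := (a + (b - a) / n.+1%:R)%R.
  have ua n : (a < u n)%R by rewrite ltrDl divr_gt0// subr_gt0.
  have ub n : (u n <= b)%R.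
    by rewrite -lerBrDl ler_pdivrMr// ler_peMr ?subr_ge0 ?(ltW ab)// ler1n.
  have UA : (`]a, b]%classic : set R) = \bigcup_n (`](u n), b]%classic : set R).
    apply/seteqP; split => x /=; rewrite in_itv/=; last first.
      move=> [n _ /=]; rewrite in_itv/= => /andP[/(lt_trans (ua n)) -> ->]//.
    move=> /andP[ax xb]; have [|n] := @ltr_add_invr R a (a + (x - a) / (b - a))%R.
      by rewrite ltrDl divr_gt0// subr_gt0.
    rewrite ltrD2l ltr_pdivlMr ?subr_gt0// => nx; exists n => //=.
    by rewrite in_itv/= xb andbT /u -ltrBrDl mulrC.
  have mu_n n : mu `](u n), b]%classic <= (H b - H a)%:E.
    have [p] := rat_in_itvoo (ua n); rewrite in_itv/= => /andP[ap pu].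
    apply: le_trans (mu_rat p a b ap (le_trans (ltW pu) (ub n))).
    apply: le_measure; rewrite ?inE// => x /=; rewrite !in_itv/= => /andP[ux ->].
    by rewrite (lt_trans pu ux).
  have mU n : measurable (`](u n), b]%classic : set R) by [].
  have ndU : nondecreasing_seq (fun n => `](u n), b]%classic : set R).
    move=> m n mn; apply/subsetPset => x /=; rewrite !in_itv/= => /andP[ux ->].
    rewrite andbT; apply: le_lt_trans ux; rewrite lerD2l ler_wpM2l ?subr_ge0 ?(ltW ab)//.
    by rewrite lef_pV2 ?posrE// ler_nat.
  have mUU := bigcup_measurable (fun n _ => mU n).
  have := nondecreasing_cvg_mu (mu := mu) mU (mUU setT) ndU; rewrite -UA => /cvg_lim <- //.
  apply: lime_le; first by apply: cvgP (nondecreasing_cvg_mu (mu := mu) mU (mUU setT) ndU).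
  by apply: nearW => n; exact: mu_n.
have dom := nu_dom mu mu_itv.
apply: (excessive_invariant mX iX X_ge0 bounded_io nu_fin) => g mg g0.
by rewrite -Hmu//; exact: ge0_le_measure_integral.
Qed.

End ExistenceOfInvariantMeasure.

(** * Null sets of invariant measures *)

Section MassOfInvariantMeasures.
Context {d : measure_display} {T : measurableType d} {R : realType}.
Variables (P : probability T R) (X : nat -> T -> R * R).
Hypothesis mX : forall k, measurable_fun setT (X k).
Hypothesis iX : iid P X.
Hypothesis X_ge0 : forall w, nneg (X ^~ w).
Variable nu : {sigma_finite_measure set R -> \bar R}.
Hypothesis nu_neg : (nu [set x : R | (x < 0)%R] = 0)%E.
Hypothesis nu_fin : forall b : R, (nu `]-oo, b]%classic < +oo)%E.
Hypothesis nu_inv : forall A, measurable A ->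
  nu A = (\int[nu]_x op P X 1 (EFin \o \1_A) x)%E.
Local Notation Omega := (seq_space (R * R)%type).
Local Notation z w := ((X ^~ w) : Omega).
Local Notation op := (op P X).
Local Open Scope ereal_scope.

Lemma ae_nonneg : {ae nu, forall x : R, (0 <= x)%R}.
Proof.
exists [set x : R | (x < 0)%R]; split => //.
  by rewrite (_ : [set x | _] = (`]-oo, (0 : R)%R[%classic : set R)).
by move=> x /= /negP; rewrite -ltNge.
Qed.

Lemma integral_op n f : measurable_fun setT f -> (forall x, 0 <= f x) ->
  \int[nu]_x op n f x = \int[nu]_x f x.
Proof.
move=> mf f0; elim: n => [|n IH]; first by rewrite op0.
rewrite -(add1n n) (opD mX iX)// -IH; apply: (invariant_integral mX) => //.
- exact: measurable_op.
- exact: op_ge0.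
Qed.

Lemma integral_lev b : \int[nu]_x lev b x = nu `]-oo, b]%classic.
Proof.
rewrite /lev (_ : [set y | _] = (`]-oo, b]%classic : set R)); last first.
  by apply/seteqP; split => x /=; rewrite in_itv.
by rewrite integral_indic// setIT.
Qed.

(** Invariance expresses the mass of a half-line as the integral of the probability
    to be there at time [n], which is uniformly small: a finite measure would
    give it mass [0]. *)
Lemma infinite_mass :
  (forall (r e : R), (0 < e)%R -> exists n, forall x, (0 <= x)%R -> op n (lev r) x <= e%:E) ->
  nu setT <> 0 -> nu setT = +oo.
Proof.
move=> escape nu0; apply/eqP; rewrite -leye_eq leNgt; apply/negP => fin.
have nur (r : R) : nu `]-oo, r]%classic = 0.
  apply/eqP; rewrite -measure_le0; apply/lee_addgt0Pr => e e0; rewrite add0e.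
  pose m := fine (nu setT); have m0 : (0 <= m)%R by rewrite fine_ge0.
  have em : (0 < e / (m + 1))%R by rewrite divr_gt0// ltr_wpDl.
  have [n Hn] := escape r _ em.
  apply: (@le_trans _ _ (\int[nu]_x lev r x)); first by rewrite integral_lev.
  rewrite -(integral_op n) //; [|exact: measurable_lev|exact: lev_ge0].
  apply: (@le_trans _ _ (\int[nu]_x (e / (m + 1))%:E)).
    apply: ae_ge0_le_integral => //.
    - by move=> x _; apply: op_ge0; exact: lev_ge0.
    - by apply: (measurable_op P mX); [exact: measurable_lev|exact: lev_ge0].
    - by move=> x _; rewrite lee_fin ltW.
    - by apply: filterS ae_nonneg => x x0 _; exact: Hn.
  have mE : nu setT = m%:E by rewrite /m fineK// ge0_fin_numE.
  rewrite integral_cst//; apply: (@le_trans _ _ ((e / (m + 1))%:E * m%:E)).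
    by rewrite -mE.
  rewrite -EFinM lee_fin.
  rewrite mulrAC ler_pdivrMr ?ltr_wpDl// ler_pM2l//; lra.
apply: nu0.
have UA : [set: R] = \bigcup_n `]-oo, n%:R]%classic.
  apply/esym/seteqP; split => // x _; exists (Num.bound `|x|) => //=.
  by rewrite in_itv/= (le_trans (ler_norm x))// ltW// archi_boundP.
have mF n : measurable (`]-oo, n%:R]%classic : set R) by exact: measurable_itv.
apply/eqP; rewrite UA -measure_le0.
apply: le_trans (measure_sigma_subadditive nu mF (bigcup_measurable (fun n _ => mF n))
  (@subset_refl _ _)) _.
rewrite eseries0// => n _ _; exact: nur.
Qed.

Section TransientSets.
Variable c : R.
Hypothesis c_ge0 : (0 <= c)%R.
Hypothesis bounded_io : {ae P, forall w, forall x, forall n,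
  exists2 m, (n <= m)%N & (traj x (X ^~ w) m <= c)%R}.


Definition gtr (x : R) : \bar R := (\1_[set y | (c < y)%R] x)%:E.

Lemma measurable_gtr : measurable_fun setT gtr.
Proof.
apply/measurable_EFinP/measurable_indic.
rewrite (_ : [set y | _] = `]c, +oo[%classic)//; apply/seteqP; split => x /=;
  by rewrite in_itv/= andbT.
Qed.

Lemma gtr_ge0 x : 0 <= gtr x. Proof. by rewrite lee_fin. Qed.

Lemma gtrE x : gtr x = ((c < x)%R)%:R%:E.
Proof. by rewrite /gtr indicE; congr ((nat_of_bool _)%:R%:E); apply/idP/idP; rewrite inE. Qed.

Lemma lev_gtr x a : 0 <= a -> lev c x * a + gtr x * a = a.
Proof.
by rewrite levE gtrE; case: leP => _ _; rewrite ?mul1e ?mul0e ?adde0 ?add0e.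
Qed.

(** The probability, from [x], that the chain is above [c] at the times
    [1], ..., [n]. *)
Fixpoint above n : R -> \bar R :=
  if n is n'.+1 then op 1 (fun y => gtr y * above n' y) else fun=> 1.

(** The probability, from [x], that [n] is the first time at which the chain
    is in [[0, c]]. *)
Fixpoint first_hit n : R -> \bar R :=
  if n is n'.+1 then fun y => gtr y * op 1 (first_hit n') y else lev c.

Lemma above_ge0 n x : 0 <= above n x.
Proof.
elim: n x => [|n IH] x; first exact: lee01.
by apply: op_ge0 => y; rewrite mule_ge0 ?gtr_ge0.
Qed.

Lemma first_hit_ge0 n x : 0 <= first_hit n x.
Proof.
elim: n x => [|n IH] x; first exact: lev_ge0.
by rewrite mule_ge0 ?gtr_ge0// op_ge0.
Qed.

Lemma measurable_above n : measurable_fun setT (above n).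
Proof.
elim: n => [|n IH]; first exact: measurable_cst.
apply: (measurable_op P mX).
  by apply: emeasurable_funM => //; exact: measurable_gtr.
by move=> y; rewrite mule_ge0 ?gtr_ge0 ?above_ge0.
Qed.

Lemma measurable_first_hit n : measurable_fun setT (first_hit n).
Proof.
elim: n => [|n IH]; first exact: measurable_lev.
apply: emeasurable_funM; first exact: measurable_gtr.
by apply: (measurable_op P mX) => // y; exact: first_hit_ge0.
Qed.

Let op_fh n x : 0 <= op 1 (first_hit n) x.
Proof. by apply: op_ge0; exact: first_hit_ge0. Qed.

Let mop_fh n : measurable_fun setT (op 1 (first_hit n)).
Proof.
apply: (measurable_op P mX); [exact: measurable_first_hit|exact: first_hit_ge0].
Qed.

(** An excursion above [c] either ends at the next time or goes on. *)
Lemma first_hit_above n x : op 1 (first_hit n) x + above n.+1 x = above n x.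
Proof.
elim: n x => [|n IH] x /=.
  under [X in _ + op 1 X _]eq_fun do rewrite mule1.
  rewrite -(op_add P mX) //; [|exact: measurable_lev|exact: lev_ge0|exact: measurable_gtr
    |exact: gtr_ge0].
  rewrite -[RHS](op_cst P X 1 1 x); congr (op 1 _ x); apply/funext => y.
  by have := lev_gtr y (@lee01 R); rewrite !mule1.
rewrite -(op_add P mX); last 4 first.
- by apply: emeasurable_funM; [exact: measurable_gtr|exact: mop_fh].
- by move=> y; rewrite mule_ge0 ?gtr_ge0 ?op_fh.
- by apply: emeasurable_funM; [exact: measurable_gtr|exact: (measurable_above n.+1)].
- by move=> y; rewrite mule_ge0 ?gtr_ge0 ?(above_ge0 n.+1).
congr (op 1 _ x); apply/funext => y.
by rewrite -ge0_muleDr ?op_fh ?(above_ge0 n.+1)// IH.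
Qed.

Lemma above_le1 n x : above n x <= 1.
Proof.
elim: n => [|n IH] //; apply: le_trans IH.
by rewrite -(first_hit_above n) leeDr// op_fh.
Qed.

Lemma aboveE n x :
  above n x = P [set w | forall k, (k < n)%N -> (c < traj x (z w) k.+1)%R].
Proof.
have mA m y : measurable ([set s | forall k, (k < m)%N -> (c < traj y s k.+1)%R] : set Omega).
  rewrite (_ : [set s | _] = \bigcap_(k in `I_m) ~` [set s | (traj y s k.+1 <= c)%R]).
    apply: bigcap_measurableType => k _; apply: measurableC; exact: measurable_traj_le.
  by apply/seteqP; split => s /= h k km; have := h k km; rewrite ltNge => /negP.
elim: n x => [|n IH] x.
  by rewrite /= (_ : [set w | _] = setT) ?probability_setT//; apply/seteqP; split.
rewrite (prob_indic P mX (mA n.+1 x)).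
rewrite (ge0_expectation_splice (F := fun s => (\1_[set s : Omega | forall k, (k < n.+1)%N ->
  (c < traj x s k.+1)%R] s)%:E) 1 mX iX); last 2 first.
- exact/measurable_EFinP/measurable_indic.
- by move=> s; rewrite lee_fin.
apply: eq_integral => w _.
transitivity (gtr (traj x (z w) 1) * above n (traj x (z w) 1)) => //.
rewrite IH (prob_indic P mX (mA n _)) gtrE.
rewrite -ge0_integralZl//; last first.
  apply: (measurable_z_comp mX (F := fun s => (\1_[set s : Omega | forall k, (k < n)%N ->
    (c < traj (traj x (z w) 1) s k.+1)%R] s)%:E)).
  exact/measurable_EFinP/measurable_indic.
apply: eq_integral => w' _; rewrite !indicE -EFinM -natrM mulnb; congr (_%:R%:E).
have step k : traj x (splice 1 (z w) (z w')) k.+2 = traj (traj x (z w) 1) (z w') k.+1.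
  by rewrite -(add1n k.+1) traj_shift shift_splice traj_past.
congr nat_of_bool; apply/andP/idP; rewrite !inE.
  move=> [c1 h] [_|k kn]; first by rewrite traj_past.
  by rewrite step; exact: (h k kn).
move=> h; split; first by have := h 0%N isT; rewrite traj_past.
by move=> k kn; rewrite -step; exact: (h k.+1 kn).
Qed.

(** The events decrease to that of never coming back, which is null. *)
Lemma above_cvg0 x : above n x @[n --> \oo] --> 0.
Proof.
pose A n := [set w | forall k, (k < n)%N -> (c < traj x (z w) k.+1)%R].
have mA n : measurable (A n).
  rewrite /A (_ : [set s | _] = \bigcap_(k in `I_n) ~` [set w | (traj x (z w) k.+1 <= c)%R]).
    apply: bigcap_measurableType => k _; apply: measurableC.
    exact: (measurable_sequence_event mX (measurable_traj_le x k.+1 c)).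
  by apply/seteqP; split => s /= h k km; have := h k km; rewrite ltNge => /negP.
have mcap : measurable (\bigcap_n A n) by exact: bigcap_measurableType.
have niA : nonincreasing_seq A.
  move=> m n mn; apply/subsetPset => w /= h k km; exact: h (leq_trans km mn).
have A0 : P (A 0%N) < +oo by rewrite (le_lt_trans (probability_le1 P _)) ?ltry.
have Pcap : P (\bigcap_n A n) = 0.
  apply/negligibleP => //; apply: negligibleS bounded_io => w /= h h2.
  have [[//|m] _ hm] := h2 x 1%N; have := h m.+1 Logic.I m (ltnSn m).
  by rewrite ltNge hm.
rewrite -Pcap (_ : above ^~ x = P \o A); last by apply/funext => n; rewrite aboveE.
exact: (nonincreasing_cvg_mu A0 mA mcap niA).
Qed.

(** Time reversal under the invariant measure: the mass of the paths that
    first enter [[0, c]] at time [n] equals that of the excursions which leave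
    [[0, c]] and last more than [n] steps. *)
Lemma integral_first_hit n :
  \int[nu]_x first_hit n x = \int[nu]_x (lev c x * above n x).
Proof.
have mlev := measurable_lev (R := R) c; have lev0 := @lev_ge0 R c.
elim: n => [|n IH] /=; first by apply: eq_integral => x _; rewrite mule1.
have m1 : measurable_fun setT (fun x => lev c x * op 1 (first_hit n) x).
  by apply: emeasurable_funM.
have m2 : measurable_fun setT (fun x => lev c x * above n.+1 x).
  by apply: emeasurable_funM => //; exact: measurable_above.
have m3 : measurable_fun setT (fun x => gtr x * op 1 (first_hit n) x).
  by apply: emeasurable_funM => //; exact: measurable_gtr.
have h1 : \int[nu]_x (lev c x * op 1 (first_hit n) x) +
    \int[nu]_x (gtr x * op 1 (first_hit n) x) = \int[nu]_x first_hit n x.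
  rewrite -ge0_integralD//; last 2 first.
  - by move=> x _; rewrite mule_ge0 ?op_fh.
  - by move=> x _; rewrite mule_ge0 ?op_fh ?gtr_ge0.
  rewrite -(integral_op 1); [|exact: measurable_first_hit|exact: first_hit_ge0].
  by apply: eq_integral => x _; rewrite lev_gtr ?op_fh.
have h2 : \int[nu]_x (lev c x * op 1 (first_hit n) x) +
    \int[nu]_x (lev c x * above n.+1 x) = \int[nu]_x (lev c x * above n x).
  rewrite -ge0_integralD//; last 2 first.
  - by move=> x _; rewrite mule_ge0 ?op_fh.
  - by move=> x _; rewrite mule_ge0 ?above_ge0.
  apply: eq_integral => x _; rewrite -ge0_muleDr ?op_fh ?above_ge0//.
  by rewrite first_hit_above.
have fin : \int[nu]_x (lev c x * op 1 (first_hit n) x) \is a fin_num.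
  rewrite ge0_fin_numE; last by apply: integral_ge0 => x _; rewrite mule_ge0 ?op_fh.
  apply: le_lt_trans (nu_fin c); rewrite -integral_lev; apply: ge0_le_integral => //.
    by move=> x _; rewrite mule_ge0 ?op_fh.
  move=> x _; rewrite -[leRHS]mule1 lee_wpmul2l//; apply: le_trans (above_le1 n x).
  by rewrite -first_hit_above leeDl// above_ge0.
have cancel (a b b' e : \bar R) : a \is a fin_num -> a + b = e -> a + b' = e -> b = b'.
  by case: a => // r _ <- /(congr1 (fun t => t - r%:E)); rewrite !(addeC r%:E) !addeK.
exact: cancel fin (etrans h1 IH) h2.
Qed.

Lemma integral_first_hit_cvg0 : \int[nu]_x first_hit n x @[n --> \oo] --> 0.
Proof.
have mlev := measurable_lev (R := R) c; have lev0 := @lev_ge0 R c.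
under eq_fun do rewrite integral_first_hit.
have ilev : nu.-integrable setT (lev c).
  apply/integrableP; split => //; under eq_integral do rewrite gee0_abs//.
  by rewrite integral_lev; exact: nu_fin.
have := @dominated_convergence _ _ _ nu setT measurableT
  (fun n x => lev c x * above n x) (cst 0) (lev c).
rewrite integral0 => -[] //.
- by move=> n; apply: emeasurable_funM => //; exact: measurable_above.
- apply: aeW => x _; rewrite -[cst 0 x](mule0 (lev c x)).
  by apply: cvgeZl; [rewrite levE|exact: above_cvg0].
- apply: aeW => x n _; rewrite gee0_abs ?mule_ge0 ?above_ge0//.
  by rewrite -[leRHS]mule1 lee_wpmul2l// above_le1.
Qed.

(** A set below [c] whose expected number of visits is bounded, uniformly in
    the starting point, is null: up to time [n] its occupation by the
    stationary chain, which is proportional to [n], is at most the bound times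
    the mass of the paths that have entered [[0, c]], which is [o(n)]. *)
Lemma null_of_bounded_visits (K : set R) (C : R) : measurable K ->
  K `<=` `]-oo, c]%classic ->
  (forall n x, (0 <= x)%R -> \sum_(0 <= k < n) op k (EFin \o \1_K) x <= C%:E) ->
  nu K = 0.
Proof.
move=> mK Kc visits.
have mI : measurable_fun setT (EFin \o \1_K : R -> \bar R).
  exact/measurable_EFinP/measurable_indic.
have I0 x : 0 <= (EFin \o \1_K : R -> \bar R) x by rewrite lee_fin.
have C0 : (0 <= C)%R.
  by rewrite -lee_fin; apply: le_trans (visits 0%N 0%R (lexx _)); rewrite big_nil.
have fh0 := first_hit_ge0; have mfh := measurable_first_hit.
have visits_le n x : (0 <= x)%R -> \sum_(0 <= k < n) op k (EFin \o \1_K) x <=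
    C%:E * \sum_(0 <= j < n) first_hit j x.
  elim: n x => [|n IH] x x0; first by rewrite !big_nil mule0.
  have [xc|cx] := leP x c.
    apply: le_trans (visits n.+1 x x0) _; rewrite -[leLHS]mule1 lee_wpmul2l//.
    rewrite big_nat_recl//= levE xc leeDl// sume_ge0// => j _.
    by rewrite mule_ge0 ?gtr_ge0 ?op_fh.
  rewrite big_nat_recl// (op0 P) big_nat_recl//= levE (lt_geF cx)/= add0e.
  rewrite indicE memNset ?add0e; last first.
    by move=> /Kc /=; rewrite in_itv/= leNgt cx.
  have -> : \sum_(0 <= j < n) gtr x * op 1 (first_hit j) x =
      \sum_(0 <= j < n) op 1 (first_hit j) x.
    by apply: eq_bigr => j _; rewrite gtrE cx mul1e.
  have -> : \sum_(0 <= j < n) op j.+1 (EFin \o \1_K) x =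
      \sum_(0 <= j < n) op 1 (op j (EFin \o \1_K)) x.
    by apply: eq_bigr => j _; rewrite -(add1n j) (opD mX iX).
  have mop j : measurable_fun setT (op j (EFin \o \1_K)) by exact: (measurable_op P mX).
  have opI j y : 0 <= op j (EFin \o \1_K) y by exact: op_ge0.
  rewrite -(op_sum P mX)// -(op_sum P mX)// -(op_scale P mX)//; last 2 first.
  - exact: emeasurable_sum.
  - by move=> y; exact: sume_ge0.
  apply: le_op => //.
  - exact: emeasurable_sum.
  - by move=> y; exact: sume_ge0.
  - by apply: measurable_funeM; exact: emeasurable_sum.
pose a j := \int[nu]_x first_hit j x.
have nuK n : n%:R%:E * nu K <= C%:E * \sum_(0 <= j < n) a j.
  have -> : n%:R%:E * nu K = \int[nu]_x (\sum_(0 <= k < n) op k (EFin \o \1_K) x).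
    rewrite ge0_integral_sum//; last 2 first.
    - by move=> k; exact: (measurable_op P mX).
    - by move=> k x _; exact: op_ge0.
    rewrite (eq_bigr (fun=> nu K)); last first.
      by move=> k _; rewrite integral_op// integral_indic// setIT.
    elim: {visits_le} n => [|n IH]; first by rewrite big_nil mul0e.
    by rewrite big_nat_recr//= -IH -natr1 EFinD ge0_muleDl ?lee_fin// mul1e.
  rewrite /a -ge0_integral_sum// -ge0_integralZl//; last 2 first.
  - exact: emeasurable_sum.
  - by move=> x _; exact: sume_ge0.
  apply: ae_ge0_le_integral => //.
  - by move=> x _; apply: sume_ge0 => k _; exact: op_ge0.
  - by apply: emeasurable_sum => k; exact: (measurable_op P mX).
  - by move=> x _; rewrite mule_ge0// sume_ge0.
  - by apply: measurable_funeM; exact: emeasurable_sum.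
  - by apply: filterS ae_nonneg => x x0 _; exact: visits_le.
have a_le j : a j <= nu `]-oo, c]%classic.
  rewrite /a integral_first_hit -integral_lev; apply: ge0_le_integral => //.
  - by move=> x _; rewrite mule_ge0 ?lev_ge0 ?above_ge0.
  - by apply: emeasurable_funM; [exact: measurable_lev|exact: measurable_above].
  - exact: measurable_lev.
  - by move=> x _; rewrite -[leRHS]mule1 lee_wpmul2l ?lev_ge0 ?above_le1.
have a_ge0 j : 0 <= a j by exact: integral_ge0.
have a_fin j : a j \is a fin_num.
  by rewrite ge0_fin_numE// (le_lt_trans (a_le j))// nu_fin.
have nuKfin : nu K \is a fin_num.
  rewrite ge0_fin_numE//; apply: le_lt_trans (nu_fin c).
  by apply: le_measure; rewrite ?inE.
pose u j := fine (a j).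
have /fine_cvgP[_ u0] : a n @[n --> \oo] --> (0%R)%:E by exact: integral_first_hit_cvg0.
pose m := fine (nu K); have m0 : (0 <= m)%R by exact: fine_ge0.
have um n : (n%:R * m <= C * \sum_(0 <= j < n) u j)%R.
  rewrite -lee_fin !EFinM -sumEFin /u /m fineK//.
  by under [in leRHS]eq_bigr do rewrite fineK//; exact: nuK.
suff : m = 0%R by move=> mE; rewrite -[nu K]fineK// -/m mE.
apply/eqP; rewrite eq_le m0 andbT.
have cv : (C * arithmetic_mean u n)%R @[n --> \oo] --> (0 : R)%R.
  by rewrite -(mulr0 C); apply: cvgMl_tmp; exact: cesaro.
rewrite -(cvg_lim _ cv)//; apply: limr_ge; first exact: cvgP cv.
apply: nearW => n; rewrite /arithmetic_mean mulrCA ler_pdivlMl//.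
Qed.

End TransientSets.
End MassOfInvariantMeasures.

(** * Mass of the attractor *)

(** Indexing a cover by an abstract countable type keeps the encoding of the index
    by integers away from computation. *)
Lemma null_of_countable_cover {d} {T : measurableType d} {R : realType}
    (mu : {measure set T -> \bar R}) (A : set T) (I : countType) (B : I -> set T) :
  measurable A -> (forall i, measurable (B i)) -> (forall i, mu (B i) = 0%E) ->
  A `<=` \bigcup_i B i -> mu A = 0%E.
Proof.
move=> mA mB B0 AB.
pose F n := if @unpickle I n is Some i then B i else set0.
have mF n : measurable (F n) by rewrite /F; case: unpickle => [i|//].
have AF : A `<=` \bigcup_n F n.
  by move=> x /AB[i _ Bx]; exists (pickle i) => //; rewrite /F pickleK.
apply/eqP; rewrite -measure_le0.
apply: le_trans (measure_sigma_subadditive mu mF mA AF) _.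
by rewrite eseries0// => n _ _; rewrite /F; case: unpickle => [i|]; rewrite ?measure0.
Qed.

Section MassOfAttractor.
Context {d : measure_display} {T : measurableType d} {R : realType}.
Variables (P : probability T R) (X : nat -> T -> R * R).
Hypothesis mX : forall k, measurable_fun setT (X k).
Hypothesis iX : iid P X.
Hypothesis X_ge0 : forall w, nneg (X ^~ w).
Hypothesis prodM_cvg0 : {ae P, forall w, (prodM (X ^~ w) n @[n --> \oo] --> 0)}.
Hypothesis M_gt0 : {ae P, forall w, forall k, 0 < (X k w).1}.
Local Notation Omega := (seq_space (R * R)%type).
Local Notation z w := ((X ^~ w) : Omega).
Local Notation op := (op P X).

(** If the chain almost surely leaves a neighbourhood of a ball for ever, then
    so do all its trajectories issued from that ball, from a deterministic time
    on, with a probability bounded below: the numbers of visits of the ball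
    have uniformly bounded expectations. *)
Lemma bounded_visits (q r r' : R) : r < r' ->
  {ae P, forall w, exists N, forall m, (N <= m)%N -> r' <= `|traj 0 (z w) m - q|} ->
  exists C : R, forall n (x : R), 0 <= x ->
    (\sum_(0 <= k < n) op k (EFin \o \1_[set y : R | (`|y - q| <= r)%R]) x <= C%:E)%E.
Proof.
move=> rr ae_away; pose b := `|q| + `|r|.
have mfd n (x : R) : measurable_fun setT (fun s : Omega => `|traj x s n - q|).
  apply: measurableT_comp => //.
  by apply: measurable_funB => //; exact: measurable_traj2.
have mdist n (x a : R) : measurable ([set s | `|traj x s n - q| <= a] : set Omega).
  rewrite -[X in measurable X]setTI.
  rewrite (_ : [set s | _] = (fun s => `|traj x s n - q|) @^-1` `]-oo, a]%classic); last first.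
    by apply/seteqP; split => s /=; rewrite in_itv.
  apply: mfd => //; exact: measurable_itv.
pose A' m : set Omega := [set s | r' <= `|traj 0 s m - q| /\ prodM s m * b < r' - r].
have mA' m : measurable (A' m).
  have mp : measurable_fun setT (fun s : Omega => prodM s m * b).
    by apply: measurable_funM => //; exact: measurable_prodM.
  have -> : A' m = (setT `&` (fun s => `|traj 0 s m - q|) @^-1` `[r', +oo[%classic) `&`
      (setT `&` (fun s => prodM s m * b) @^-1` `]-oo, r' - r[%classic).
    by rewrite !setTI; apply/seteqP; split => s /=; rewrite !in_itv/= andbT.
  by apply: measurableI; [apply: mfd|apply: mp] => //; exact: measurable_itv.
have aeA' : {ae P, forall w, exists N, forall m, (N <= m)%N -> A' m (z w)}.
  apply: filterS2 ae_away prodM_cvg0 => w [N1 H1] cw.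
  have b1 : 0 < b + 1 by rewrite ltr_wpDl// addr_ge0.
  have d0 : 0 < (r' - r) / (b + 1).
    by rewrite divr_gt0 ?subr_gt0.
  have /cvgrPdist_lt/(_ _ d0)[N2 _ H2] := cw.
  exists (maxn N1 N2) => m; rewrite geq_max => /andP[/H1 h1 /H2 /=].
  rewrite sub0r normrN => h2; split => //.
  have p0 : 0 <= prodM (z w) m by exact: prodM_ge0.
  rewrite ger0_norm// ltr_pdivlMr// in h2.
  by apply: (@le_lt_trans _ _ (prodM (z w) m * (b + 1))) => //; rewrite ler_wpM2l// lerDl.
have [N PN] := prob_eventually (fun m => measurable_sequence_event mX (mA' m)) aeA'.
pose B : set Omega := \bigcap_(m in [set m | (N <= m)%N]) A' m.
have mB : measurable B by exact: bigcap_measurableType.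
exists (N%:R / fine (P [set w | B (z w)])) => n x x0.
pose A k : set Omega := [set s | `|traj x s k - q| <= r].
have -> : (\sum_(0 <= k < n) op k (EFin \o \1_[set y : R | (`|y - q| <= r)%R]) x =
    \sum_(0 <= k < n) P [set w | A k (z w)])%E.
  by apply: eq_bigr => k _; rewrite (prob_indic P mX (mdist k x r)).
apply: (last_exit_bound mX iX X_ge0 (A := A) (B := B) (N := N)) => //.
- by move=> k; exact: mdist.
- by move=> k s t; rewrite /A/= traj_past.
- move=> s k m s0; rewrite /A /= => Ak Bk km.
  have y0 : 0 <= traj x s k by exact: traj_ge0.
  have yb : traj x s k <= b.
    have h1 := ler_norm (traj x s k - q); have h2 := ler_norm q; have h3 := ler_norm r.
    rewrite /b; lra.
  have Nmk : (N <= m - k)%N.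
    by rewrite /= leq_subRL ?(leq_trans (leq_addr _ _) km).
  have [h1 h2] := Bk (m - k)%N Nmk.
  rewrite -{1}(subnKC (leq_trans (leq_addr _ _) km)) traj_shift => hm.
  set t := shift k s in h1 h2 hm; set i := (m - k)%N in h1 h2 hm.
  have p0 : 0 <= prodM t i by apply: prodM_ge0; exact: nneg_shift.
  have h3 := traj_sub (traj x s k) 0 t i; rewrite subr0 in h3.
  have h4 : prodM t i * traj x s k <= prodM t i * b by rewrite ler_wpM2l.
  have h5 : 0 <= prodM t i * traj x s k by rewrite mulr_ge0.
  have h6 := ler_distD (traj (traj x s k) t i) (traj 0 t i) q.
  have h7 : `|traj 0 t i - traj (traj x s k) t i| = prodM t i * traj x s k.
    by rewrite distrC h3 ger0_norm.
  by rewrite h7 in h6; lra.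
Qed.

Variable nu : {sigma_finite_measure set R -> \bar R}.
Hypothesis nu_neg : (nu [set x : R | (x < 0)%R] = 0)%E.
Hypothesis nu_fin : forall b : R, (nu `]-oo, b]%classic < +oo)%E.
Hypothesis nu_inv : forall A, measurable A ->
  nu A = (\int[nu]_x op 1 (EFin \o \1_A) x)%E.
Variable c : R.
Hypothesis c_ge0 : 0 <= c.
Hypothesis bounded_io : {ae P, forall w, forall x, forall n,
  exists2 m, (n <= m)%N & traj x (X ^~ w) m <= c}.

Lemma null_transient_ball (q r r' : R) : r < r' ->
  {ae P, forall w, exists N, forall m, (N <= m)%N -> r' <= `|traj 0 (z w) m - q|} ->
  nu [set y : R | `|y - q| <= r] = 0%E.
Proof.
move=> rr ae_away; have [C HC] := bounded_visits rr ae_away.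
pose c' := Num.max c (`|q| + `|r|).
have io' : {ae P, forall w, forall x, forall n,
    exists2 m, (n <= m)%N & traj x (X ^~ w) m <= c'}.
  apply: filterS bounded_io => w h x n; have [m nm hm] := h x n.
  by exists m => //; rewrite le_max hm.
apply: (null_of_bounded_visits mX iX X_ge0 nu_neg nu_fin nu_inv io' _ _ HC).
  rewrite (_ : [set y | _] = `[q - r, q + r]%classic); first exact: measurable_itv.
  by apply/seteqP; split => y /=; rewrite in_itv/= ler_distl.
move=> y /= yq; rewrite in_itv/= le_max; apply/orP; right.
have h1 := ler_norm (y - q); have h2 := ler_norm q; have h3 := ler_norm r; lra.
Qed.

(** The complement of the attractor is covered by the countably many rational balls,
    slightly shrunk, which almost every trajectory leaves for ever. *)
Lemma null_compl_attractor : nu (~` attractor P X) = 0%E.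
Proof.
pose B (i : rat * rat * nat) : set R :=
  if `[< P [set w | io_near (traj 0 (z w)) (ratr i.1.1) (ratr i.1.2)] = 1%E >] then set0
  else [set y : R | `|y - ratr i.1.1| <= ratr i.1.2 - i.2.+1%:R^-1].
apply: (@null_of_countable_cover _ _ _ nu _ _ B).
- apply: measurableC; apply: closed_measurable.
  exact: (closed_attractor mX iX prodM_cvg0 M_gt0).
- move=> [[q e] k]; rewrite /B /=; case: asboolP => [_|h] //.
  rewrite (_ : [set y | _] = `[ratr q - (ratr e - k.+1%:R^-1),
    ratr q + (ratr e - k.+1%:R^-1)]%classic); first exact: measurable_itv.
  by apply/seteqP; split => y /=; rewrite in_itv/= ler_distl.
- move=> [[q e] k]; rewrite /B /=; case: asboolP => [_|h]; first exact: measure0.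
  apply: (@null_transient_ball _ _ (ratr e - k.+2%:R^-1)).
    by rewrite ltrD2l ltrN2 ltf_pV2 ?posrE// ltr_nat.
  have [p0|//] := io_near_zero_one mX iX prodM_cvg0 M_gt0 (ratr q) (ratr e).
  have mW := measurable_sequence_event mX (measurable_io_near (R := R) (ratr q) (ratr e)).
  exists [set w | io_near (traj 0 (z w)) (ratr q) (ratr e)]; split => //.
  move=> w /= nw; exists k.+1 => n; apply: contrapT => hn; apply: nw; exists n => m nm.
  by rewrite leNgt; apply/negP => hm; apply: hn; exists m.
- move=> x /existsNP[q /existsNP[e /not_implyP[xqe h]]].
  have [k hk] := ltr_add_invr xqe; exists (q, e, k) => //; rewrite /B /=.
  by case: asboolP => // _ /=; rewrite lerBrDr ltW.
Qed.

Lemma attractor_infinite_mass :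
  (forall (r e : R), (0 < e)%R ->
    exists n, forall x, (0 <= x)%R -> (op n (lev r) x <= e%:E)%E) ->
  nu setT <> 0%E -> nu (attractor P X) = +oo%E.
Proof.
move=> escape nu0.
rewrite -(infinite_mass mX iX nu_neg nu_inv escape nu0).
have mL : measurable (attractor P X).
  apply: closed_measurable; exact: (closed_attractor mX iX prodM_cvg0 M_gt0).
rewrite -[in RHS](setvU (attractor P X)) measureU//; last 2 first.
- exact: measurableC.
- by rewrite setICl.
rewrite -[LHS]add0e; congr (_ + _)%E; exact/esym/null_compl_attractor.
Qed.

End MassOfAttractor.

(** * Locally finite measures and laws *)

Section LocallyFiniteMeasures.
Context {R : realType}.
Local Open Scope ereal_scope.

(** The complements relative to [K] of the sets that are contained in a set of finite
    measure form a filter, which cannot cluster at any point. *)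
Lemma locally_finite_compact (nu : {measure set R -> \bar R}) (K : set R) :
  locally_finite nu -> compact K ->
  exists N, [/\ measurable N, K `<=` N & nu N < +oo].
Proof.
move=> lf cK; apply: contrapT => noN.
pose F : set_system R := [set B | exists N, [/\ measurable N, K `\` B `<=` N & nu N < +oo]].
have FF : ProperFilter F.
  split; first by move=> [N [mN KN fN]]; apply: noN; exists N; split => // x Kx; apply: KN; split.
  split.
  - by exists set0; split; rewrite ?measure0 ?ltry// setDT.
  - move=> B C [N [mN BN fN]] [N' [mN' CN fN']]; exists (N `|` N'); split.
    + exact: measurableU.
    + by rewrite setDIr; exact: setUSS.
    + by apply: le_lt_trans (measureU2 _ mN mN') _; rewrite lte_add_pinfty.
  - by move=> B C BC [N [mN BN fN]]; exists N; split => // x [Kx nCx]; apply: BN; split => // /BC/nCx.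
have FK : F K by exists set0; split; rewrite ?measure0 ?ltry// setDv.
have [x [Kx cl]] := cK F FF FK.
have [U [oU Ux fU]] := lf x.
have FU : F (~` U).
  exists U; split => //; first exact: open_measurable.
  by move=> y [_ /contrapT].
by have [y []] := cl _ _ FU (open_nbhs_nbhs (conj oU Ux)).
Qed.

Lemma locally_finite_ray (nu : {measure set R -> \bar R}) :
  nu [set x : R | (x < 0)%R] = 0 -> locally_finite nu ->
  forall b : R, nu `]-oo, b]%classic < +oo.
Proof.
move=> nu0 lf b.
have [N [mN bN fN]] := locally_finite_compact lf (@segment_compact R 0 b).
have m0 : measurable [set x : R | (x < 0)%R].
  by rewrite (_ : [set x | _] = (`]-oo, (0 : R)%R[%classic : set R)).
apply: (@le_lt_trans _ _ (nu ([set x : R | (x < 0)%R] `|` N))).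
  apply: le_measure; rewrite ?inE//; first exact: measurableU.
  move=> x /=; rewrite in_itv/= => xb; case: (ltP x 0%R) => [|x0]; first by left.
  by right; apply: bN => /=; rewrite in_itv/= x0.
apply: le_lt_trans (measureU2 _ m0 mN) _.
by rewrite [X in X + _]nu0 add0e.
Qed.

Section SigmaFinite.
Variable nu : {measure set R -> \bar R}.
Hypothesis nu_fin : forall b : R, nu `]-oo, b]%classic < +oo.

(** The bound is an argument so that the sigma-finite structure can be inferred. *)
Definition as_sigma_finite & (forall b : R, nu `]-oo, b]%classic < +oo) :
  set R -> \bar R := nu.
Local Notation mu := (as_sigma_finite nu_fin).

Let mu0 : mu set0 = 0. Proof. exact: measure0. Qed.

Let mu_ge0 A : 0 <= mu A. Proof. exact: measure_ge0. Qed.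

Let mu_sigma_additive : semi_sigma_additive mu.
Proof. exact: measure_semi_sigma_additive. Qed.

HB.instance Definition _ := isMeasure.Build _ _ _ mu mu0 mu_ge0 mu_sigma_additive.

Let mu_sigma_finite : sigma_finite setT mu.
Proof.
exists (fun n => `]-oo, n%:R]%classic).
  apply/esym/seteqP; split => // x _; exists (Num.bound `|x|%R) => //=.
  by rewrite in_itv/= (le_trans (ler_norm x))// ltW// archi_boundP.
by move=> n; split; [exact: measurable_itv|exact: nu_fin].
Qed.

HB.instance Definition _ := @Measure_isSigmaFinite.Build _ _ _ mu mu_sigma_finite.

Lemma sigma_finite_copy :
  exists nu' : {sigma_finite_measure set R -> \bar R}, forall A, nu' A = nu A.
Proof. by exists mu. Qed.

End SigmaFinite.

End LocallyFiniteMeasures.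

Section SameLaw.
Context {d d' : measure_display} {T : measurableType d} {E : measurableType d'}
  {R : realType}.
Variable P : probability T R.
Local Open Scope ereal_scope.

Lemma ge0_integral_same_law (X Y : T -> E) (f : E -> \bar R) :
  measurable_fun setT X -> measurable_fun setT Y ->
  (forall A, measurable A -> P (X @^-1` A) = P (Y @^-1` A)) ->
  measurable_fun setT f -> (forall x, 0 <= f x) ->
  \int[P]_w f (X w) = \int[P]_w f (Y w).
Proof.
move=> mX mY XY mf f0.
transitivity (\int[pushforward P X]_x f x).
  by rewrite (ge0_integral_pushforward mX).
transitivity (\int[pushforward P Y]_x f x); last by rewrite (ge0_integral_pushforward mY).
by apply: (@eq_measure_integral _ _ _ _
  (measure_function_pushforward__canonical__measure_function_Measure P mY)
  (measure_function_pushforward__canonical__measure_function_Measure P mX)) => A mA _; exact: XY.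
Qed.

End SameLaw.

(** * The hypotheses in terms of the inputs *)

Section Inputs.
Context {d : measure_display} {T : measurableType d} {R : realType}.
Variables (P : probability T R) (M Q : nat -> {RV P >-> R}).
Hypothesis M_ge0 : forall k w, 0 <= M k w.
Hypothesis Q_ge0 : forall k w, 0 <= Q k w.
Hypothesis MQ_iid : iid P (fun k w => (M k w, Q k w)).
Implicit Types (w : T).

(** The chain reads its inputs from the index [1] on, trajectories from [0] on. *)
Definition input k w : R * R := (M k.+1 w, Q k.+1 w).

Lemma measurable_inputs k : measurable_fun setT (fun w => (M k w, Q k w)).
Proof. exact: measurable_fun_pair. Qed.

Lemma measurable_input k : measurable_fun setT (input k).
Proof. exact: measurable_inputs. Qed.

Lemma input_iid : iid P input.
Proof. exact: (iid_reindex succn_inj MQ_iid). Qed.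

Lemma input_ge0 w : nneg (input ^~ w).
Proof. by move=> k; split; [exact: M_ge0|exact: Q_ge0]. Qed.

Lemma law_M k (A : set R) : measurable A -> P (M k @^-1` A) = P (M 0%N @^-1` A).
Proof.
move=> mA; have mA' : measurable (fst @^-1` A : set (R * R)).
  by rewrite -[X in measurable X]setTI; exact: measurable_fst.
by have [_ /(_ k _ mA')] := MQ_iid.
Qed.

Lemma law_Q k (A : set R) : measurable A -> P (Q k @^-1` A) = P (Q 0%N @^-1` A).
Proof.
move=> mA; have mA' : measurable (snd @^-1` A : set (R * R)).
  by rewrite -[X in measurable X]setTI; exact: measurable_snd.
by have [_ /(_ k _ mA')] := MQ_iid.
Qed.

Lemma chain_traj x n w : chain (fun k => M k) (fun k => Q k) x n w = traj x (input ^~ w) n.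
Proof. by elim: n => //= n ->. Qed.

Lemma Pi_prodM n w : Pi (fun k => M k) n w = prodM (input ^~ w) n.
Proof.
rewrite /Pi; elim: n => [|n IH]; first by rewrite big_geq.
by rewrite big_nat_recr//= IH.
Qed.

Lemma input_gt0 : P [set w | M 0%N w = 0] = 0%E ->
  {ae P, forall w, forall k, 0 < (input k w).1}.
Proof.
move=> M0; apply: ae_foralln => k; have m0 : measurable [set 0 : R] by [].
exists (M k.+1 @^-1` [set 0]); split.
- by rewrite -[X in measurable X]setTI; exact: measurable_funPT.
- exact: etrans (law_M k.+1 m0) M0.
- move=> w /= /negP; rewrite -leNgt => h; apply/eqP; by rewrite eq_le h M_ge0.
Qed.

Local Open Scope ereal_scope.

(** Truncation from above at [K] of the negative part of the logarithm, with the
    infinite value at [0] becoming [K]. *)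
Lemma log_minus_clog (K p : R) : (0 <= K)%R -> (0 <= p)%R ->
  mine K%:E (log_minus p) = (clog K p)%:E.
Proof.
move=> K0; rewrite le_eqVlt => /predU1P[<-|p0].
  rewrite /log_minus le0_lneNy// (min_l (leNye 0)) (_ : - -oo = +oo)// min_l ?leey//.
  by rewrite /clog min_l ?ler01// max_r ?expR_ge0// expRK opprK.
rewrite /log_minus lne_EFin// -EFin_min -EFinN -EFin_min; congr (_%:E).
have [p1|p1] := leP 1%R p.
  by rewrite (min_r (ln_ge0 p1)) oppr0 clog_eq0// min_r.
have lp : (ln p < 0)%R by rewrite ln_lt0// p0.
rewrite (min_l (ltW lp)) /clog (min_l (ltW p1)).
have [pK|pK] := leP p (expR (- K)).
  have : (ln p <= - K)%R by rewrite -[leRHS]expRK ler_ln ?posrE ?expR_gt0.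
  by rewrite expRK opprK => h; rewrite min_l// lerNr.
have : (- K < ln p)%R by rewrite -[ltLHS]expRK ltr_ln ?posrE ?expR_gt0.
by move=> h; rewrite min_r// lerNl ltW.
Qed.

Lemma measurable_lne_EFin : measurable_fun setT (fun r : R => lne r%:E).
Proof.
apply: measurable_fun_ifT => //; first exact: measurable_fun_ler.
by apply/measurable_EFinP; exact: measurable_ln.
Qed.

Lemma measurable_log_minus : measurable_fun setT (fun r : R => log_minus r).
Proof.
rewrite /log_minus; apply: measurableT_comp => //.
by apply: measurable_mine; [exact: measurable_lne_EFin|exact: measurable_cst].
Qed.

Lemma log_minus_ge0 (p : R) : 0 <= log_minus p.
Proof. by rewrite oppe_ge0 ge_min lexx orbT. Qed.

Lemma integral_clog k (K : R) : (0 <= K)%R ->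
  \int[P]_w (clog K (M k w))%:E = \int[P]_w (clog K (M 0%N w))%:E.
Proof.
move=> K0; apply: (@ge0_integral_same_law _ _ _ _ _ P (M k) (M 0%N) (EFin \o clog K)) => //.
- by move=> A mA; apply: law_M.
- apply/measurable_EFinP; exact: measurable_clog.
- by move=> p; rewrite lee_fin clog_ge0.
Qed.

(** Monotone truncation and Fatou's lemma. *)
Lemma input_clog : \int[P]_w log_minus (M 0%N w) = +oo -> forall A : R,
  exists2 K : R, (0 <= K)%R & A%:E <= \int[P]_w (clog K (input 0 w).1)%:E.
Proof.
move=> inf A; apply: contrapT => h.
have hA n : \int[P]_w (clog n%:R (M 0%N w))%:E <= A%:E.
  rewrite leNgt; apply/negP => lt; apply: h; exists n%:R => //=.
  by rewrite integral_clog// ltW.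
pose g n w := (clog n%:R (M 0%N w))%:E : \bar R.
have mg n : measurable_fun setT (g n).
  by apply/measurable_EFinP; apply: (measurableT_comp (measurable_clog n%:R)).
have g0 n w : 0 <= g n w by rewrite lee_fin clog_ge0.
suff : +oo <= A%:E by rewrite leye_eq.
rewrite -inf; apply: (@le_trans _ _ (\int[P]_w limn_einf (g ^~ w))).
  apply: ge0_le_integral => //.
  - by move=> w _; exact: log_minus_ge0.
  - exact: (measurableT_comp measurable_log_minus).
  - exact: measurable_limn_einf.
  - move=> w _; case: (log_minus _) (log_minus_ge0 (M 0%N w)) (fun n : nat =>
      @log_minus_clog n%:R (M 0%N w) (ler0n _ _) (M_ge0 _ _)) => [r| |//] r0 E.
      apply: (@limn_einf_ge _ _ _ (Num.bound r)) => n rn; rewrite /g -E min_r// lee_fin.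
      by rewrite (le_trans (ltW (archi_boundP r0)))// ler_nat.
    rewrite leye_eq; apply/eqP; apply: eq_infty => r.
    apply: (@limn_einf_ge _ _ _ (Num.bound `|r|%R)) => n rn; rewrite /g -E min_l ?leey// lee_fin.
    rewrite (le_trans (ler_norm r))// (le_trans (ltW (archi_boundP (normr_ge0 r))))//.
    by rewrite ler_nat.
apply: le_trans (fatou P measurableT mg (fun n w _ => g0 n w)) _.
by apply: (@limn_einf_le _ _ _ 0) => n _; exact: hA.
Qed.

(** The tail of [ln Q] is [O (1 / t)] at infinity by assumption, and any
    probability is [O (1 / t)] on a bounded interval. *)
Lemma input_Q_tail : s_star P (fun k => Q k) < +oo -> exists2 C : R, (0 <= C)%R &
  forall t, (0 < t)%R -> P [set w | (t <= ln (1 + (input 0 w).2))%R] <= (C / t)%:E.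
Proof.
rewrite /s_star /limf_esup => /ereal_inf_lt[_ [V [t0 [_ t0V]] <-] supV].
have [S S0 HS] : exists2 S : R, (0 <= S)%R & forall t, (t0 < t)%R -> (0 < t)%R ->
    P [set w | t%:E < lne (Q 0%N w)%:E] <= (S / t)%:E.
  set v := ereal_sup _ in supV.
  have [S S0 vS] : exists2 S : R, (0 <= S)%R & v <= S%:E.
    exists (Num.max 0 (fine v))%R; first by rewrite le_max lexx.
    by move: v supV => [r _|//|_] /=; rewrite ?leNye// lee_fin le_max lexx orbT.
  exists S => // t tt0 tp; rewrite EFinM muleC lee_pdivlMl//.
  by apply: le_trans vS; apply: ereal_sup_ubound; exists t => //; exact: t0V.
(* beyond [t1] both [t / 2 > t0] and [expR t - 1 > expR (t / 2)] hold *)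
pose t1 := (2 + 2 * `|t0|)%R; have t10 : (0 < t1)%R by rewrite ltr_wpDr// mulr_ge0.
have mQ k (A : set R) : measurable A -> measurable (Q k @^-1` A).
  by move=> mA; rewrite -[X in measurable X]setTI; exact: measurable_funPT.
exists (2 * S + t1)%R => [|t tp]; first by rewrite addr_ge0 ?mulr_ge0// ltW.
have mB : measurable [set q : R | (t <= ln (1 + q))%R].
  rewrite -[X in measurable X]setTI (_ : [set q | _] = (fun q => ln (1 + q)) @^-1` `[t, +oo[%classic).
    have mf : measurable_fun setT (fun q : R => ln (1 + q)%R).
      by apply: (measurableT_comp (measurable_ln (R := R))); exact: measurable_funD.
    by apply: mf => //; exact: measurable_itv.
  by apply/seteqP; split => q /=; rewrite in_itv/= andbT.
rewrite -[X in P X]/(Q 1%N @^-1` [set q | (t <= ln (1 + q))%R]) law_Q//.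
have [tt1|t1t] := leP t t1.
  apply: (le_trans (probability_le1 P (mQ _ _ mB))).
  by rewrite lee_fin ler_pdivlMr// mul1r (le_trans tt1)// lerDr mulr_ge0.
apply: (@le_trans _ _ (P [set w | (t / 2)%:E < lne (Q 0%N w)%:E])).
  apply: le_measure; rewrite ?inE; first exact: mQ.
    rewrite (_ : [set w | _] = Q 0%N @^-1`
      ([set: R] `&` (fun q => lne q%:E) @^-1` `](t / 2)%:E, +oo]%classic)); last first.
      by rewrite setTI; apply/seteqP; split => w /=; rewrite in_itv/= leey andbT.
    by apply: mQ; apply: measurable_lne_EFin => //; exact: emeasurable_itv.
  move=> w /= h.
  have t2 : (1 <= t / 2)%R by have := normr_ge0 t0; rewrite /t1 in t1t; lra.
  have q1 : (0 < 1 + Q 0%N w)%R by rewrite ltr_pwDl.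
  have e1 : (expR t <= 1 + Q 0%N w)%R by rewrite -[leRHS]lnK ?posrE// ler_expR.
  have e2 : (expR t = expR (t / 2) * expR (t / 2))%R by rewrite -expRD -splitr.
  have e3 : (1 + t / 2 <= expR (t / 2))%R := expR_ge1Dx _.
  have e4 : (expR (t / 2) < Q 0%N w)%R by nra.
  suff : (t / 2)%:E < lne (Q 0%N w)%:E by [].
  rewrite lne_EFin ?(lt_trans (expR_gt0 _) e4)// lte_fin -[ltLHS]expRK ltr_ln ?posrE ?expR_gt0//.
  exact: lt_trans (expR_gt0 _) e4.
apply: le_trans (HS _ _ _) _.
- by have := ler_norm t0; rewrite /t1 in t1t; lra.
- by rewrite divr_gt0.
- rewrite lee_fin invf_div mulrA [(S * 2)%R]mulrC ler_wpM2r ?invr_ge0 ?(ltW tp)//.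
  by rewrite lerDl ltW.
Qed.

Let mean_clog (y : R) : R := fine (\int[P]_w (clog (Num.max y 0) (M 0%N w))%:E).

Lemma integral_clog_fin (y : R) : (0 <= y)%R ->
  \int[P]_w (clog y (M 0%N w))%:E \is a fin_num.
Proof.
move=> y0; rewrite ge0_fin_numE; last by apply: integral_ge0 => w _; rewrite lee_fin clog_ge0.
apply: (@le_lt_trans _ _ (\int[P]_w y%:E)).
  apply: ge0_le_integral => //.
  - by move=> w _; rewrite lee_fin clog_ge0.
  - by apply/measurable_EFinP; apply: (measurableT_comp (measurable_clog y)).
  - by move=> w _; rewrite lee_fin clog_le.
by rewrite integral_cst//= probability_setT mule1 ltry.
Qed.

Lemma measurable_mean_clog : measurable_fun setT mean_clog.
Proof.
apply: nondecreasing_measurable; first exact: measurableT.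
move=> x y xy; have x0 : (0 <= Num.max x 0)%R by rewrite le_max lexx orbT.
have xy0 : (Num.max x 0 <= Num.max y 0)%R.
  by rewrite ge_max !le_max xy lexx orbT.
apply: fine_le.
- exact: integral_clog_fin.
- exact: integral_clog_fin (le_trans x0 xy0).
have mc (K : R) : measurable_fun setT (fun w => (clog K (M 0%N w))%:E).
  by apply/measurable_EFinP; apply: (measurableT_comp (measurable_clog K)).
apply: ge0_le_integral => //.
- by move=> w _; rewrite lee_fin clog_ge0.
- move=> w _; rewrite lee_fin /clog lerN2 ler_ln ?posrE ?lt_max ?expR_gt0 ?orbT//.
  by rewrite ge_max !le_max lexx ler_expR lerN2 xy0 orbT.
Qed.

(** The integral that defines [I_Q], moved from the law of [ln Q] to the
    probability space; this needs the integrand [J_minus] to be measurable, and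
    on reals it is a quotient by a monotone function. *)
Lemma input_renewal : I_Q P (fun k => M k) (fun k => Q k) = +oo ->
  \int[P]_(w in [set w | (1 < ln (input 0 w).2)%R])
  ((ln (input 0 w).2)%:E / \int[P]_w' (clog (ln (input 0 w).2) (input 0 w').1)%:E) = +oo.
Proof.
rewrite /I_Q => <-.
pose j (y : R) : \bar R := y%:E / (mean_clog y)%:E.
have mj : measurable_fun setT j.
  rewrite (_ : j = fun y => if (0 < mean_clog y)%R then
      (y * expR (- ln (mean_clog y)))%:E else y%:E * +oo).
    apply: measurable_fun_ifT.
    - by apply: measurable_fun_ltr => //; exact: measurable_mean_clog.
    - apply/measurable_EFinP; apply: measurable_funM => //.
      apply: (measurableT_comp (f := @expR R)); first exact: measurable_expR.
      apply: (measurableT_comp (f := @GRing.opp R)) => //.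
      by apply: (measurableT_comp (measurable_ln (R := R))); exact: measurable_mean_clog.
    - by apply: emeasurable_funM => //; apply/measurable_EFinP.
  apply/funext => y; rewrite /j; have : (0 <= mean_clog y)%R.
    by apply: fine_ge0; apply: integral_ge0 => w _; rewrite lee_fin clog_ge0// le_max lexx orbT.
  rewrite le_eqVlt => /predU1P[<-|y0]; first by rewrite ltxx inve0.
  by rewrite y0 inver gt_eqF// expRN lnK// EFinM.
pose L k w := lne (Q k w)%:E.
have mL k : measurable_fun setT (L k).
  exact: (measurableT_comp measurable_lne_EFin).
pose D : set (\bar R) := [set x | 1 < x < +oo].
have DE x : D x -> exists2 y : R, x = y%:E & (1 < y)%R.
  by rewrite /D/=; case: x => [y| |]; rewrite ?ltxx ?andbF// => /andP[y1 _]; exists y.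
have mD : measurable D.
  rewrite (_ : D = [set` Interval (BRight 1) (BLeft (+oo : \bar R))]); first exact: emeasurable_itv.
  by apply/seteqP; split => x /=; rewrite in_itv.
pose f : \bar R -> \bar R := (j \o fine) \_ D.
have mf : measurable_fun setT f.
  apply/(measurable_restrictT _ mD); apply: (measurableT_comp mj).
  exact: fine_measurable.
have jE y : (1 < y)%R -> J_minus P (fun k => M k) y%:E = j y.
  move=> y1; have y0 : (0 <= y)%R by rewrite (le_trans _ (ltW y1)).
  rewrite /J_minus /j /mean_clog max_l// fineK ?integral_clog_fin//.
  congr (_ / _); apply: eq_integral => w _; rewrite log_minus_clog//.
have f0 x : 0 <= f x.
  rewrite /f patchE; case: ifPn => //; rewrite inE => /DE[y -> y1].
  rewrite /j /= mule_ge0 ?lee_fin ?(le_trans _ (ltW y1))// inve_ge0 lee_fin.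
  by apply: fine_ge0; apply: integral_ge0 => w _; rewrite lee_fin clog_ge0// le_max lexx orbT.
have -> : \int[log_law P (fun k => Q k)]_(x in D) J_minus P (fun k => M k) x =
    \int[P]_w f (L 0%N w).
  transitivity (\int[log_law P (fun k => Q k)]_x f x); last first.
    by rewrite /log_law (ge0_integral_pushforward (mL 0%N)).
  rewrite [LHS]integral_mkcond; first exact: (mL 0%N).
  move=> mL0; apply: eq_integral => x _.
  rewrite /f !patchE; case: ifPn => //; rewrite inE => /DE[y -> y1].
  by rewrite /= jE.
rewrite -(@ge0_integral_same_law _ _ _ _ _ P (L 1%N) (L 0%N) f)//; last first.
  move=> A mA.
  have mB : measurable ([set: R] `&` (fun q => lne q%:E) @^-1` A).
    exact: measurable_lne_EFin.
  rewrite setTI in mB; exact: (law_Q 1 mB).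
rewrite integral_mkcond; apply: eq_integral => w _.
have Q_gt0 : (1 < ln (Q 1%N w))%R -> (0 < Q 1%N w)%R.
  by move=> q1; rewrite ltNge; apply/negP => /ln0 q0; rewrite q0 ltr10 in q1.
have LD : (L 1%N w \in D) = (w \in [set w | (1 < ln (input 0 w).2)%R]).
  apply/idP/idP; rewrite !inE.
    by move=> /DE[y]; rewrite /L /=; case: ifPn => // q0 [<-].
  move=> h; rewrite /L lne_EFin; last exact: Q_gt0.
  by apply/andP; split; [rewrite lte_fin|rewrite ltry].
rewrite /f !patchE LD; case: ifPn => //; rewrite inE /= => q1.
have q0 := Q_gt0 q1.
rewrite /L lne_EFin//= /j /mean_clog max_l ?(le_trans _ (ltW q1))//.
by rewrite fineK ?integral_clog_fin ?(le_trans _ (ltW q1))// integral_clog ?(le_trans _ (ltW q1)).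
Qed.

End Inputs.

(** * Null recurrence *)

Section Invariance.
Context {d : measure_display} {T : measurableType d} {R : realType}.
Variables (P : probability T R) (M Q : nat -> {RV P >-> R}).
Hypothesis MQ_iid : iid P (fun k w => (M k w, Q k w)).
Local Open Scope ereal_scope.

Lemma op_input (A : set R) x : measurable A ->
  op P (input M Q) 1 (EFin \o \1_A) x = P [set w | A (M 0%N w * x + Q 0%N w)%R].
Proof.
move=> mA; pose B := [set y : R * R | A (y.1 * x + y.2)%R].
have mB : measurable B.
  rewrite -[B]setTI; have mf : measurable_fun setT (fun y : R * R => y.1 * x + y.2)%R.
    apply: measurable_funD; last exact: measurable_snd.
    by apply: measurable_funM => //; exact: measurable_fst.
  exact: mf.
have mC : measurable ([set s | A (traj x s 1)] : set (seq_space (R * R)%type)).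
  rewrite -[X in measurable X]setTI; exact: measurable_traj2.
have [_ /(_ 1%N B mB) law] := MQ_iid.
transitivity (P [set w | A (traj x (input M Q ^~ w) 1)]); last exact: law.
by rewrite (prob_indic P (measurable_input M Q) mC).
Qed.

Lemma integral_op_input (nu : {measure set R -> \bar R}) (A : set R) : measurable A ->
  nu [set x : R | (x < 0)%R] = 0 ->
  \int[nu]_x op P (input M Q) 1 (EFin \o \1_A) x =
  \int[nu]_(x in `[0%R, +oo[) P [set w | A (M 0%N w * x + Q 0%N w)%R].
Proof.
move=> mA nu0; have m0 : measurable [set x : R | (x < 0)%R].
  by rewrite (_ : [set x | _] = (`]-oo, (0 : R)%R[%classic : set R)).
have I0 (x : R) : 0 <= (EFin \o \1_A : R -> \bar R) x by rewrite lee_fin.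
have mI : measurable_fun setT (EFin \o \1_A : R -> \bar R).
  exact/measurable_EFinP/measurable_indic.
rewrite (ge0_negligible_integral _ _ _ _ nu0)//; last 2 first.
- by apply: (measurable_op P (measurable_input M Q)).
- by move=> x _; exact: op_ge0.
rewrite (_ : setT `\` _ = `[0%R, +oo[%classic); last first.
  apply/seteqP; split => x /=; rewrite in_itv/= andbT.
    by move=> [_ /negP]; rewrite -leNgt.
  by move=> x0; split => //; apply/negP; rewrite -leNgt.
by apply: eq_integral => x _; rewrite op_input.
Qed.

End Invariance.

Lemma accumulation_setE {R : realType} (u : nat -> R) :
  \bigcap_m closure [set u n | n in [set n | (m <= n)%N]] = [set p | clusters u p].
Proof. by apply/seteqP; split => p h m //; exact: h. Qed.

Theorem theorem3p5 (d : measure_display) (T : measurableType d) (R : realType)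
    (P : probability T R) (M Q : nat -> {RV P >-> R})
    (M_ge0 : forall k w, 0 <= M k w)
    (Q_ge0 : forall k w, 0 <= Q k w)
    (MQ_iid : iid P (fun k w => (M k w, Q k w)))
    (M_neq0 : P [set w | M 0%N w = 0] = 0%E)
    (Q_nontrivial : (P [set w | Q 0%N w = 0%R] < 1)%E)
    (nondegenerate : forall r : R, 0 <= r ->
       (P [set w | (M 0%N w * r + Q 0%N w)%R = r] < 1)%E)
    (Pi_cvg0 : {ae P, forall w, (fun n => Pi M n w) @ \oo --> 0})
    (I_Q_infinite : I_Q P M Q = +oo%E)
    (log_plus_infinite : (\int[P]_w log_plus (M 0%N w))%E = +oo%E)
    (log_minus_infinite : (\int[P]_w log_minus (M 0%N w))%E = +oo%E)
    (s_star_finite : (s_star P Q < +oo)%E) :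
  null_recurrent P M Q.
Proof.
have mX := measurable_input M Q; have iX := input_iid MQ_iid.
have X_ge0 := input_ge0 M_ge0 Q_ge0; have M_gt0 := input_gt0 M_ge0 MQ_iid M_neq0.
have prodM_cvg0 : {ae P, forall w, prodM (input M Q ^~ w) n @[n --> \oo] --> 0}.
  apply: filterS Pi_cvg0 => w; rewrite (_ : prodM _ = fun n => Pi M n w)//.
  by apply/funext => n; rewrite (Pi_prodM M Q).
have [c0 c0_ge0 drift] := ladder_lyapunov mX iX X_ge0 prodM_cvg0
  (input_Q_tail Q_ge0 MQ_iid s_star_finite) (input_clog M_ge0 MQ_iid log_minus_infinite).
have not_transient := lyapunov_not_transient mX iX X_ge0 prodM_cvg0
  measurable_lnln lnln_ge0 lnln_unbounded c0_ge0 drift.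
have escape := escape_in_probability mX iX X_ge0 prodM_cvg0
  (input_renewal M_ge0 MQ_iid I_Q_infinite).
pose L := attractor P (input M Q).
have L_neq0 : L !=set0 := attractor_neq0 mX iX X_ge0 prodM_cvg0 M_gt0 not_transient.
have L_closed : closed L := closed_attractor mX iX prodM_cvg0 M_gt0.
have ae_acc := ae_accumulation mX iX prodM_cvg0 M_gt0.
have [c c_ge0 bounded_io] := ae_bounded_io mX iX X_ge0 prodM_cvg0 M_gt0 L_neq0.
split.
  exists L; split => //.
    by move=> p /(attractor_ge0 mX iX X_ge0 prodM_cvg0 M_gt0) p0; rewrite /= in_itv/= p0.
  move=> x U _ oU [p [Lp Up]].
  have mU n : measurable [set w | U (chain M Q x n w)].
    rewrite (_ : [set w | _] = [set w | U (traj x (input M Q ^~ w) n)]); last first.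
      by apply/seteqP; split => w /=; rewrite (chain_traj M Q).
    apply: (measurable_sequence_event mX (C := [set s | U (traj x s n)])).
    rewrite -[X in measurable X]setTI; apply: measurable_traj2 => //; exact: open_measurable.
  apply: ae_prob1.
    by apply: bigcap_measurableType => n _; apply: bigcup_measurable => k _; exact: mU.
  apply: filterS ae_acc => w [_ /(_ x) accL] n _.
  have : [set p | clusters (traj x (input M Q ^~ w)) p] p by rewrite accL.
  move=> /(_ n U (open_nbhs_nbhs (conj oU Up)))[_ [[m nm <-] Um]].
  by exists m => //=; rewrite (chain_traj M Q).
exists L; split.
- split => //; apply: filterS ae_acc => w [_ accL] x _.
  rewrite /L -(accL x) -accumulation_setE (_ : traj x _ = fun n => chain M Q x n w)//.
  by apply/funext => n; rewrite (chain_traj M Q).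
- have [nu [nu_neg nu_neq0 nu_fin nu_inv]] := invariant_exists mX iX X_ge0 M_gt0 c_ge0 bounded_io.
  exists nu; split => //.
  + move=> x; exists `]-oo, (x + 1)[%classic; split => //.
    * by rewrite /= in_itv/= ltrDl.
    * apply: le_lt_trans (nu_fin (x + 1)); apply: le_measure; rewrite ?inE//.
      by move=> y /=; rewrite !in_itv/=; exact: ltW.
  + by split => // A mA; exact: etrans (nu_inv A mA) (integral_op_input MQ_iid mA nu_neg).
- move=> nu [nu_neq0 nu_lf [nu_neg nu_inv]].
  have nu_fin := locally_finite_ray nu_neg nu_lf.
  have [mu muE] := sigma_finite_copy nu_fin.
  rewrite -muE; apply: (attractor_infinite_mass mX iX X_ge0 prodM_cvg0 M_gt0 _ _ _
    bounded_io escape); rewrite ?muE//.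
  + by move=> b; rewrite muE.
  + move=> A mA; rewrite muE nu_inv// -(integral_op_input MQ_iid)//.
    by apply: eq_measure_integral => B mB _; exact/esym/muE.
Qed.
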